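(* Consider the planar piecewise linear systems with real parameters $(\gamma_L,\gamma_R,b,x_L,x_R)$ $$\begin{cases}\dot x=2\gamma_L x-y-b,\\ \dot y=(1+\gamma_L^2)(x-x_L),\end{cases}\ \text{if } x\le 0,\qquad \begin{cases}\dot x=2\gamma_R x-y+b,\\ \dot y=(1+\gamma_R^2)(x-x_R),\end{cases}\ \text{if } x>0.$$ Let $\eta$ be a non-zero real number. The local cyclicity of the periodic orbit at infinity, of center type, defined by $\gamma_L=-\gamma_R=-\eta$, $x_L=x_R=0$ and $b=0$, when perturbed in this class of systems, is at least $3$.
   Context: On $\Sigma=\{x=0\}$ the systems are understood with the Filippov convention; orbits far from the origin cross $\Sigma$ and turn around the origin, so there is a ''periodic orbit at infinity''. It is of center type if all orbits sufficiently far from the origin are periodic. The local cyclicity of the periodic orbit at infinity of a given center system, within the class, is the maximum number of limit cycles of big amplitude that can bifurcate from it, i.e. the maximum $k$ such that in every neighborhood of the given parameter values and for every $M>0$ there are parameters $(\gamma_L,\gamma_R,b,x_L,x_R)$ in that neighborhood whose system has $k$ limit cycles (isolated crossing periodic orbits) intersecting the positive $y$-axis at ordinates larger than $M$. *)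

(* Defs.v *)
From Stdlib Require Import Reals.
From Coquelicot Require Import Coquelicot.
Open Scope R_scope.

(* Parameters, in the order (gammaL, gammaR, b, xL, xR). *)
Definition param : Type := (R * R * R * R * R)%type.

Definition left_field (m : param) (p : R * R) : R * R :=
  let '(gammaL, gammaR, b, xL, xR) := m in
  let '(x, y) := p in
  (2 * gammaL * x - y - b, (1 + gammaL ^ 2) * (x - xL)).

Definition right_field (m : param) (p : R * R) : R * R :=
  let '(gammaL, gammaR, b, xL, xR) := m in
  let '(x, y) := p in
  (2 * gammaR * x - y + b, (1 + gammaR ^ 2) * (x - xR)).

(* Filippov's set-valued field: the closed segment joining the two vectors on
   the switching line x = 0. *)
Definition filippov (m : param) (p v : R * R) : Prop :=
  (fst p < 0 -> v = left_field m p) /\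
  (0 < fst p -> v = right_field m p) /\
  (fst p = 0 -> exists s : R, 0 <= s <= 1 /\
     v = plus (scal (1 - s) (left_field m p)) (scal s (right_field m p))).

Definition diff_quot (z : R -> R * R) (t h : R) : R * R :=
  scal (/ h) (minus (z (t + h)) (z t)).

(* Solutions are piecewise smooth: they have a derivative on each side at every
   time, both in the Filippov set.  Off the line x = 0 the two derivatives agree,
   so this is the classical equation there; at a crossing point every element of
   the Filippov set is transversal to the line, so the solution passes from one
   half-plane to the other; motion along the line is possible only where the
   Filippov set contains a vertical vector. *)
Definition solution (m : param) (z : R -> R * R) : Prop :=
  forall t : R,
    (exists v, filippov m (z t) v /\
       filterlim (diff_quot z t) (at_left 0) (locally v)) /\
    (exists v, filippov m (z t) v /\
       filterlim (diff_quot z t) (at_right 0) (locally v)).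

Definition periodic (z : R -> R * R) : Prop :=
  (exists t, z t <> z 0) /\
  (exists T, 0 < T /\ forall t, z (t + T) = z t).

(* Orbits are sets, so that distinctness ignores time parametrization. *)
Definition periodic_orbit (m : param) (C : R * R -> Prop) : Prop :=
  exists z, solution m z /\ periodic z /\ forall p, C p <-> exists t, z t = p.

Definition crossing_point (m : param) (p : R * R) : Prop :=
  fst p = 0 /\ 0 < fst (left_field m p) * fst (right_field m p).

Definition crossing_periodic_orbit (m : param) (C : R * R -> Prop) : Prop :=
  periodic_orbit m C /\
  (exists p, C p /\ fst p = 0) /\
  (forall p, C p -> fst p = 0 -> crossing_point m p).

(* Isolated among all periodic orbits, crossing or not. *)
Definition limit_cycle (m : param) (C : R * R -> Prop) : Prop :=
  crossing_periodic_orbit m C /\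
  exists delta, 0 < delta /\
    forall C', periodic_orbit m C' ->
      (forall p, C' p -> exists q, C q /\ ball q delta p) ->
      forall p, C' p <-> C p.

Definition has_big_limit_cycles (m : param) (k : nat) (M : R) : Prop :=
  exists C : nat -> R * R -> Prop,
    (forall i, (i < k)%nat ->
       limit_cycle m (C i) /\ exists y, 0 < y /\ M < y /\ C i (0, y)) /\
    (forall i j, (i < k)%nat -> (j < k)%nat -> i <> j ->
       ~ (forall p, C i p <-> C j p)).

Definition bifurcate_from_infinity (m0 : param) (k : nat) : Prop :=
  forall U : param -> Prop, locally m0 U ->
  forall M : R, 0 < M ->
    exists m : param, U m /\ has_big_limit_cycles m k M.

(* The maximum of the numbers k, with value p_infty if they are unbounded. *)
Definition local_cyclicity_at_infinity (m0 : param) : Rbar :=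
  Lub_Rbar (fun r => exists k : nat, r = INR k /\ bifurcate_from_infinity m0 k).

Definition center_at_infinity (m : param) : Prop :=
  exists r : R, forall p : R * R, r < norm p ->
    (exists z, solution m z /\ z 0 = p) /\
    (forall z, solution m z -> z 0 = p -> periodic z).

(* Main.v *)
(** Along a half-orbit that starts on [x = 0] and flies for a time [t] around a focus,
    both end heights are explicit functions of [t].  Hence a periodic orbit crossing
    [x = 0] twice is a solution [(T, T')] of two equations in the left and right flight
    times.  Eliminating [T'] leaves one equation [F (T) = 0], and in the coordinate
    [x = coord h t], which vanishes at [t = PI] (orbits at infinity), the expansion of [F] is
    [c0 + c1 x + c2 x^2 + c3 x^3 + o(x^3)] with [c3 <> 0].  The scale of [(b, xL, xR)] is
    free; their ratios and [gammaL + gammaR] tune [c2], [c1] and [c0] in turn, each much smaller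
    than the previous one and with alternating signs, so [F] has three sign changes.
    The zeros are made isolated by moving [b]: [F (T) = 0] reads [f (T) = beta] with [f] of
    class C1, and there are values [beta] taken on three intervals where [f] is
    strictly monotone. *)

Require Import Defs.
From Stdlib Require Import Reals Ranalysis5 ZArith Lra Lia.
From Coquelicot Require Import Coquelicot.
Open Scope R_scope.

(** * One-sided derivatives *)

(** Filippov solutions need be neither unique nor smooth on [x = 0], and a limit cycle must be
    isolated among all periodic orbits. Where [|y| > |b|] the whole Filippov segment points to one
    side of the line, so a solution crossing there has to follow the explicit arcs; periodic orbits
    close to a cycle are then controlled by a monotone return map.

    Both foci are put at positive abscissas: the left one is on the far side of the line, so left
    flights last less than [PI], and the right one lies in its own half-plane, so right flights last
    more.

    The coordinate is the reciprocal of the mean of [ret_height c] and [ret_height (- c)]. In it the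
    sum of the two closing equations is free of [beta] and makes [T'] explicit: the new coordinate
    is [- lam] times the old one. For equal slopes the remaining equation is
    [beta x + V x - V (- lam x) = 0], where [V] is [skew] in this coordinate. At [lam = 1] its left
    side is odd, so [c0] and [c2] vanish there; [c3] comes from the cubic coefficient of [V], [lam]
    opens [c2], [beta] opens [c1] and the difference of slopes opens [c0]. *)

Definition dquot (f : R -> R) (t h : R) : R := (f (t + h) - f t) / h.

Lemma diff_quot_coords (F : (R -> Prop) -> Prop) {FF : Filter F} z t v :
  filterlim (diff_quot z t) F (locally v) <->
  filterlim (dquot (fun s => fst (z s)) t) F (locally (fst v)) /\
  filterlim (dquot (fun s => snd (z s)) t) F (locally (snd v)).
Proof.
  assert (E : forall h, diff_quot z t h =
    (dquot (fun s => fst (z s)) t h, dquot (fun s => snd (z s)) t h)).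
  { intros h. unfold diff_quot, dquot, minus, plus, opp, scal; simpl.
    unfold prod_scal, prod_plus, prod_opp, scal, plus, opp; simpl.
    unfold mult; simpl. f_equal; unfold Rdiv; ring. }
  split.
  - intros H. split.
    + apply filterlim_ext with (fun h => fst (diff_quot z t h)).
      { intros h. now rewrite E. }
      apply (filterlim_comp _ _ _ _ (fun p : R * R => fst p) _ _ _ H).
      destruct v; apply continuous_fst.
    + apply filterlim_ext with (fun h => snd (diff_quot z t h)).
      { intros h. now rewrite E. }
      apply (filterlim_comp _ _ _ _ (fun p : R * R => snd p) _ _ _ H).
      destruct v; apply continuous_snd.
  - intros [H1 H2]. apply filterlim_locally. intros eps.
    generalize (filter_and _ _ (proj1 (filterlim_locally _ _) H1 eps)
                               (proj1 (filterlim_locally _ _) H2 eps)).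
    apply filter_imp. intros h [A B]. rewrite E. now split.
Qed.

Lemma at_right_0_iff (g : R -> R) l :
  filterlim g (at_right 0) (locally l) <->
  forall eps, 0 < eps -> exists d, 0 < d /\
    forall h, 0 < h < d -> Rabs (g h - l) < eps.
Proof.
  split.
  - intros H eps He.
    destruct (proj1 (filterlim_locally _ _) H (mkposreal eps He)) as [d Hd].
    exists d; split; [apply cond_pos|]. intros h Hh.
    apply (Hd h); [|lra].
    change (Rabs (h - 0) < d). rewrite Rabs_pos_eq; lra.
  - intros H. apply filterlim_locally. intros [eps He].
    destruct (H eps He) as [d [Hd Hg]].
    exists (mkposreal d Hd). intros h Hb Hh. apply Hg.
    change (Rabs (h - 0) < d) in Hb. rewrite Rabs_pos_eq in Hb; lra.
Qed.

Lemma at_left_0_iff (g : R -> R) l :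
  filterlim g (at_left 0) (locally l) <->
  forall eps, 0 < eps -> exists d, 0 < d /\
    forall h, - d < h < 0 -> Rabs (g h - l) < eps.
Proof.
  split.
  - intros H eps He.
    destruct (proj1 (filterlim_locally _ _) H (mkposreal eps He)) as [d Hd].
    exists d; split; [apply cond_pos|]. intros h Hh.
    apply (Hd h); [|lra].
    change (Rabs (h - 0) < d). rewrite Rabs_left1; lra.
  - intros H. apply filterlim_locally. intros [eps He].
    destruct (H eps He) as [d [Hd Hg]].
    exists (mkposreal d Hd). intros h Hb Hh. apply Hg.
    change (Rabs (h - 0) < d) in Hb. rewrite Rabs_left1 in Hb; lra.
Qed.

Lemma is_derive_eps (f : R -> R) t l :
  is_derive f t l <->
  forall eps, 0 < eps -> exists d, 0 < d /\
    forall h, h <> 0 -> Rabs h < d -> Rabs (dquot f t h - l) < eps.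
Proof.
  rewrite is_derive_Reals. split.
  - intros H eps He. destruct (H eps He) as [d Hd].
    exists d; split; [apply cond_pos|]. intros h; apply Hd.
  - intros H eps He. destruct (H eps He) as [d [Hd H1]].
    now exists (mkposreal d Hd).
Qed.

Lemma is_derive_sides (f : R -> R) t l :
  is_derive f t l <->
  filterlim (dquot f t) (at_left 0) (locally l) /\
  filterlim (dquot f t) (at_right 0) (locally l).
Proof.
  rewrite is_derive_eps, at_left_0_iff, at_right_0_iff. split.
  - intros H; split; intros eps He; destruct (H eps He) as [d [Hd H1]];
      exists d; (split; [exact Hd|]); intros h Hh; apply H1; try lra;
      apply Rabs_def1; lra.
  - intros [H1 H2] eps He.
    destruct (H1 eps He) as [d1 [Hd1 A1]], (H2 eps He) as [d2 [Hd2 A2]].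
    exists (Rmin d1 d2). split; [now apply Rmin_glb_lt|].
    intros h Hh Hb. apply Rabs_def2 in Hb.
    pose proof (Rmin_l d1 d2); pose proof (Rmin_r d1 d2).
    destruct (Rlt_or_le h 0); [apply A1 | apply A2]; lra.
Qed.

(** The two one-sided derivatives may differ, as at a crossing; together they still bound the
    increment by [K * |h|], so Filippov solutions are continuous. *)
Lemma sides_continuous (f : R -> R) t l l' :
  filterlim (dquot f t) (at_left 0) (locally l) ->
  filterlim (dquot f t) (at_right 0) (locally l') ->
  continuous f t.
Proof.
  rewrite at_left_0_iff, at_right_0_iff. intros HL HR.
  destruct (HL 1 Rlt_0_1) as [d1 [Hd1 A1]], (HR 1 Rlt_0_1) as [d2 [Hd2 A2]].
  set (K := Rabs l + Rabs l' + 1).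
  assert (HK : 0 < K).
  { unfold K. pose proof (Rabs_pos l); pose proof (Rabs_pos l'). lra. }
  assert (B : forall h, Rabs h < Rmin d1 d2 -> Rabs (f (t + h) - f t) <= K * Rabs h).
  { intros h Hb. pose proof (Rmin_l d1 d2); pose proof (Rmin_r d1 d2).
    destruct (Req_dec h 0) as [->|Hh].
    - rewrite Rplus_0_r, Rminus_diag, Rabs_R0. lra.
    - replace (f (t + h) - f t) with (dquot f t h * h)
        by (unfold dquot; field; exact Hh).
      rewrite Rabs_mult. apply Rmult_le_compat_r; [apply Rabs_pos|].
      apply Rabs_def2 in Hb. unfold K.
      pose proof (Rabs_pos l); pose proof (Rabs_pos l').
      destruct (Rlt_or_le h 0).
      + specialize (A1 h ltac:(lra)).
        pose proof (Rabs_triang_inv (dquot f t h) l). lra.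
      + specialize (A2 h ltac:(lra)).
        pose proof (Rabs_triang_inv (dquot f t h) l'). lra. }
  apply filterlim_locally. intros eps.
  assert (Hd : 0 < Rmin (Rmin d1 d2) (eps / K)).
  { repeat apply Rmin_glb_lt; try assumption.
    apply Rdiv_lt_0_compat; [apply cond_pos | exact HK]. }
  exists (mkposreal _ Hd). intros s Hs.
  change (Rabs (s - t) < Rmin (Rmin d1 d2) (eps / K)) in Hs.
  change (Rabs (f s - f t) < eps).
  replace s with (t + (s - t)) at 1 by ring.
  apply Rle_lt_trans with (K * Rabs (s - t)).
  - apply B. apply Rlt_le_trans with (1 := Hs). apply Rmin_l.
  - apply Rlt_le_trans with (K * (eps / K)).
    + apply Rmult_lt_compat_l; [exact HK|].
      apply Rlt_le_trans with (1 := Hs). apply Rmin_r.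
    + right. field. lra.
Qed.

Lemma dquot_opp f t h : dquot (fun s => - f s) t h = - dquot f t h.
Proof. unfold dquot, Rdiv. ring. Qed.

(** * Point reflection and regularity of solutions *)

Lemma left_field_eq gL gR b xL xR x y :
  left_field (gL, gR, b, xL, xR) (x, y) =
  (2 * gL * x - y - b, (1 + gL ^ 2) * (x - xL)).
Proof. reflexivity. Qed.

Lemma right_field_eq gL gR b xL xR x y :
  right_field (gL, gR, b, xL, xR) (x, y) =
  (2 * gR * x - y + b, (1 + gR ^ 2) * (x - xR)).
Proof. reflexivity. Qed.

(* The point reflection of the plane exchanges the two half-planes, so every
   statement about the left half-plane transfers to the right one. *)
Definition mirror (m : param) : param :=
  let '(gL, gR, b, xL, xR) := m in (gR, gL, b, - xR, - xL).

Definition antipode (p : R * R) : R * R := (- fst p, - snd p).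

Lemma antipode_antipode p : antipode (antipode p) = p.
Proof. destruct p; unfold antipode; simpl; f_equal; ring. Qed.

Lemma filippov_mirror m p v : filippov m p v -> filippov (mirror m) (antipode p) (antipode v).
Proof.
  destruct m as [[[[gL gR] b] xL] xR], p as [x y], v as [v1 v2].
  unfold filippov, antipode, mirror; cbn [fst snd].
  rewrite !left_field_eq, !right_field_eq.
  intros [H1 [H2 H3]]. repeat split.
  - intros H. injection (H2 ltac:(lra)) as -> ->. f_equal; ring.
  - intros H. injection (H1 ltac:(lra)) as -> ->. f_equal; ring.
  - intros H. destruct H3 as [s [Hs E]]; [lra|].
    (* The reflection exchanges the two ends of the Filippov segment. *)
    exists (1 - s). split; [lra|].
    unfold plus, scal in *; simpl in *.
    unfold prod_plus, prod_scal, plus, scal, mult in *; simpl in *.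
    unfold mult in *; simpl in *.
    injection E as -> ->. f_equal; ring.
Qed.

Lemma solution_mirror m z : solution m z -> solution (mirror m) (fun t => antipode (z t)).
Proof.
  intros H t. destruct (H t) as [[v [Hv Lv]] [w [Hw Lw]]].
  assert (G : forall (F : (R -> Prop) -> Prop) {FF : Filter F} u,
     filterlim (diff_quot z t) F (locally u) ->
     filterlim (diff_quot (fun s => antipode (z s)) t) F (locally (antipode u))).
  { intros F FF u Hu. apply diff_quot_coords in Hu; [|exact FF].
    apply diff_quot_coords; [exact FF|]. destruct Hu as [Hu1 Hu2]. simpl.
    split.
    - apply filterlim_ext with (fun h => - dquot (fun s => fst (z s)) t h).
      { intros h. now rewrite <- dquot_opp. }
      apply (filterlim_comp _ _ _ _ (fun x : R => opp x) _ _ _ Hu1).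
      apply (@filterlim_opp _ R_NormedModule).
    - apply filterlim_ext with (fun h => - dquot (fun s => snd (z s)) t h).
      { intros h. now rewrite <- dquot_opp. }
      apply (filterlim_comp _ _ _ _ (fun x : R => opp x) _ _ _ Hu2).
      apply (@filterlim_opp _ R_NormedModule). }
  split.
  - exists (antipode v). split; [now apply filippov_mirror|]. now apply G; [apply at_left_proper_filter|].
  - exists (antipode w). split; [now apply filippov_mirror|]. now apply G; [apply at_right_proper_filter|].
Qed.

Lemma solution_continuous m z t :
  solution m z ->
  continuous (fun s => fst (z s)) t /\ continuous (fun s => snd (z s)) t.
Proof.
  intros H. destruct (H t) as [[v [_ Lv]] [w [_ Lw]]].
  apply diff_quot_coords in Lv; [|apply at_left_proper_filter].
  apply diff_quot_coords in Lw; [|apply at_right_proper_filter].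
  split; [apply sides_continuous with (fst v) (fst w) |
          apply sides_continuous with (snd v) (snd w)]; tauto.
Qed.

Lemma solution_left m z t :
  solution m z -> fst (z t) < 0 ->
  is_derive (fun s => fst (z s)) t (fst (left_field m (z t))) /\
  is_derive (fun s => snd (z s)) t (snd (left_field m (z t))).
Proof.
  intros H Hx. destruct (H t) as [[v [[Hv _] Lv]] [w [[Hw _] Lw]]].
  rewrite (Hv Hx) in Lv. rewrite (Hw Hx) in Lw.
  apply diff_quot_coords in Lv; [|apply at_left_proper_filter].
  apply diff_quot_coords in Lw; [|apply at_right_proper_filter].
  split; apply is_derive_sides; tauto.
Qed.

(** * Solutions inside a half-plane *)

(** With [u = x - xi] and [w = c u + 2 c xi - b - y] the left system becomes [u' = c u + w],
    [w' = c w - u]: its eigenvalues are [c + i] and [c - i], so the solution is [exp (c t)] times a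
    rotation of angular speed 1. *)
Definition flow (c b xi : R) (p : R * R) (t : R) : R * R :=
  let u := fst p - xi in
  let w := c * u + 2 * c * xi - b - snd p in
  let U := exp (c * t) * (u * cos t + w * sin t) in
  let W := exp (c * t) * (w * cos t - u * sin t) in
  (xi + U, c * U + 2 * c * xi - b - W).

Lemma flow_derive c b xi p t :
  is_derive (fun s => fst (flow c b xi p s)) t
    (2 * c * fst (flow c b xi p t) - snd (flow c b xi p t) - b) /\
  is_derive (fun s => snd (flow c b xi p s)) t
    ((1 + c ^ 2) * (fst (flow c b xi p t) - xi)).
Proof.
  unfold flow; simpl. split; auto_derive; auto; ring.
Qed.

Lemma flow_0 c b xi p : flow c b xi p 0 = p.
Proof.
  destruct p as [x y]; unfold flow; simpl.
  rewrite Rmult_0_r, exp_0, cos_0, sin_0. f_equal; ring.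
Qed.

Lemma is_derive_continuous (f : R -> R) t l : is_derive f t l -> continuous f t.
Proof. intros H. apply (@ex_derive_continuous R_AbsRing R_NormedModule). now exists l. Qed.

Lemma constant_on_segment (f : R -> R) a b :
  (forall t, a <= t <= b -> continuous f t) ->
  (forall t, a < t < b -> is_derive f t 0) ->
  forall t, a <= t <= b -> f t = f a.
Proof.
  intros Hc Hd t Ht.
  destruct (MVT_gen f a t (fun _ => 0)) as [c [_ Hf]]; [| |lra];
    rewrite Rmin_left, Rmax_right by lra; intros s Hs.
  - apply Hd; lra.
  - apply continuity_pt_filterlim, Hc; lra.
Qed.

Lemma rotation_inverse (e e' C S u w U W : R) :
  e * e' = 1 -> S * S + C * C = 1 ->
  e' * (U * C - W * S) = u -> e' * (U * S + W * C) = w ->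
  U = e * (u * C + w * S) /\ W = e * (w * C - u * S).
Proof.
  intros He HT <- <-. split.
  - transitivity ((e * e') * (U * (S * S + C * C))); [rewrite He, HT|]; ring.
  - transitivity ((e * e') * (W * (S * S + C * C))); [rewrite He, HT|]; ring.
Qed.

Lemma continuous_combination (f g h k : R -> R) t :
  continuous f t -> continuous g t -> continuous h t -> continuous k t ->
  forall e : R -> R, continuous e t ->
  continuous (fun s => e s * (f s * g s + h s * k s)) t.
Proof.
  intros Hf Hg Hh Hk e He.
  apply (continuous_mult e (fun s => f s * g s + h s * k s)); [exact He|].
  apply (continuous_plus (fun s => f s * g s) (fun s => h s * k s)).
  - now apply (continuous_mult f g).
  - now apply (continuous_mult h k).
Qed.

(** Undoing rotation and dilation turns [(u, w)] into the constants [I1] and [I2]. Derivatives are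
    required in the open interval only, since an arc begins and ends on the line, where a solution
    may have corners. *)
Lemma spiral_solution c (u w : R -> R) a T :
  (forall t, a <= t <= a + T -> continuous u t /\ continuous w t) ->
  (forall t, a < t < a + T ->
     is_derive u t (c * u t + w t) /\ is_derive w t (c * w t - u t)) ->
  forall t, 0 <= t <= T ->
    u (a + t) = exp (c * t) * (u a * cos t + w a * sin t) /\
    w (a + t) = exp (c * t) * (w a * cos t - u a * sin t).
Proof.
  intros Hc Hd t Ht.
  set (I1 := fun s => exp (- c * (s - a)) * (u s * cos (s - a) + w s * - sin (s - a))).
  set (I2 := fun s => exp (- c * (s - a)) * (u s * sin (s - a) + w s * cos (s - a))).
  assert (Ce : forall s, continuous (fun s => exp (- c * (s - a))) s).
  { intros s. eapply is_derive_continuous. auto_derive; auto. }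
  assert (Cs : forall s, continuous (fun s => sin (s - a)) s).
  { intros s. eapply is_derive_continuous. auto_derive; auto. }
  assert (Cm : forall s, continuous (fun s => - sin (s - a)) s).
  { intros s. eapply is_derive_continuous. auto_derive; auto. }
  assert (Cc : forall s, continuous (fun s => cos (s - a)) s).
  { intros s. eapply is_derive_continuous. auto_derive; auto. }
  assert (E1 : I1 (a + t) = I1 a).
  { apply constant_on_segment with (a + T); [| |lra].
    - intros s Hs. destruct (Hc s Hs).
      now apply (continuous_combination u (fun s => cos (s - a)) w (fun s => - sin (s - a))).
    - intros s Hs. destruct (Hd s Hs) as [D1 D2]. unfold I1. auto_derive.
      + repeat split; eexists; eassumption.
      + rewrite (is_derive_unique (fun v : R => u v) s _ D1), (is_derive_unique (fun v : R => w v) s _ D2). ring. }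
  assert (E2 : I2 (a + t) = I2 a).
  { apply constant_on_segment with (a + T); [| |lra].
    - intros s Hs. destruct (Hc s Hs).
      now apply (continuous_combination u (fun s => sin (s - a)) w (fun s => cos (s - a))).
    - intros s Hs. destruct (Hd s Hs) as [D1 D2]. unfold I2. auto_derive.
      + repeat split; eexists; eassumption.
      + rewrite (is_derive_unique (fun v : R => u v) s _ D1), (is_derive_unique (fun v : R => w v) s _ D2). ring. }
  unfold I1, I2 in E1, E2.
  replace (a + t - a) with t in * by ring.
  rewrite Rminus_diag, Rmult_0_r, exp_0, cos_0, sin_0 in *.
  apply (rotation_inverse (exp (c * t)) (exp (- c * t)) (cos t) (sin t)).
  - rewrite <- exp_plus. replace (c * t + - c * t) with 0 by ring. apply exp_0.
  - apply sin2_cos2.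
  - lra.
  - lra.
Qed.

Lemma linear_solution_flow c b xi (z : R -> R * R) a T :
  (forall t, a <= t <= a + T -> continuous (fun s => fst (z s)) t /\
                                continuous (fun s => snd (z s)) t) ->
  (forall t, a < t < a + T ->
     is_derive (fun s => fst (z s)) t (2 * c * fst (z t) - snd (z t) - b) /\
     is_derive (fun s => snd (z s)) t ((1 + c ^ 2) * (fst (z t) - xi))) ->
  forall t, 0 <= t <= T -> z (a + t) = flow c b xi (z a) t.
Proof.
  intros Hc Hd t Ht.
  set (x := fun s => fst (z s)) in *. set (y := fun s => snd (z s)) in *.
  set (u := fun s => x s - xi).
  set (w := fun s => c * x s + (c * xi - b) - y s).
  assert (Hc' : forall t, a <= t <= a + T -> continuous u t /\ continuous w t).
  { intros s Hs. destruct (Hc s Hs) as [Cx Cy]. split.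
    - apply (continuous_minus x (fun _ => xi)); [exact Cx | apply continuous_const].
    - apply (continuous_minus (fun s => c * x s + (c * xi - b)) y); [|exact Cy].
      apply (continuous_plus (fun s => c * x s) (fun _ => c * xi - b));
        [|apply continuous_const].
      apply (continuous_mult (fun _ => c) x); [apply continuous_const | exact Cx]. }
  assert (Hd' : forall t, a < t < a + T ->
     is_derive u t (c * u t + w t) /\ is_derive w t (c * w t - u t)).
  { intros s Hs.
    assert (D : is_derive x s (2 * c * x s - y s - b) /\
                is_derive y s ((1 + c ^ 2) * (x s - xi))) by exact (Hd s Hs).
    destruct D as [Dx Dy]. clearbody x y. split.
    - unfold u, w. auto_derive; [repeat split; eexists; eassumption|].
      rewrite (is_derive_unique (fun v : R => x v) s _ Dx). ring.
    - unfold u, w. auto_derive; [repeat split; eexists; eassumption|].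
      rewrite (is_derive_unique (fun v : R => x v) s _ Dx), (is_derive_unique (fun v : R => y v) s _ Dy). ring. }
  destruct (spiral_solution c u w a T Hc' Hd' t Ht) as [F1 F2].
  unfold flow. rewrite (surjective_pairing (z (a + t))).
  change (fst (z a)) with (x a). change (snd (z a)) with (y a).
  change (fst (z (a + t))) with (x (a + t)). change (snd (z (a + t))) with (y (a + t)).
  cbv zeta. change (x a - xi) with (u a).
  replace (c * u a + 2 * c * xi - b - y a) with (w a) by (unfold u, w; ring).
  rewrite <- F1, <- F2. unfold u, w. f_equal; ring.
Qed.

(** It also serves the right half-plane, through the point reflection: there [xi] and both heights
    enter with opposite sign. *)
Definition left_passage (c b xi y T y1 : R) : Prop :=
  0 < T /\ (forall t, 0 < t < T -> fst (flow c b xi (0, y) t) < 0) /\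
  flow c b xi (0, y) T = (0, y1).

Lemma continuous_neg_near (f : R -> R) t :
  continuous f t -> f t < 0 ->
  exists d, 0 < d /\ forall s, Rabs (s - t) < d -> f s < 0.
Proof.
  intros Hc Hf.
  destruct (proj1 (filterlim_locally _ _) Hc (mkposreal (- f t) ltac:(lra))) as [d Hd].
  exists d; split; [apply cond_pos|]. intros s Hs.
  specialize (Hd s Hs). change (Rabs (f s - f t) < - f t) in Hd.
  apply Rabs_def2 in Hd. lra.
Qed.

(** Every convex combination of [- y - b] and [- y + b] is negative when [|b| < y], so the right
    derivative of [x] is negative whichever element of the Filippov set it comes from. *)
Lemma solution_leaves_left gL gR b xL xR z t0 y :
  solution (gL, gR, b, xL, xR) z -> z t0 = (0, y) -> Rabs b < y ->
  exists h, 0 < h /\ forall s, 0 < s < h -> fst (z (t0 + s)) < 0.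
Proof.
  intros H E Hy. destruct (H t0) as [_ [v [Hv Lv]]].
  apply diff_quot_coords in Lv; [|apply at_right_proper_filter].
  destruct Lv as [Lv _].
  assert (Hb : - y < b < y) by (split; apply Rabs_def2 in Hy; lra).
  assert (Nv : fst v < 0).
  { destruct Hv as [_ [_ Hv]]. rewrite E in Hv.
    destruct (Hv eq_refl) as [s [Hs ->]].
    rewrite left_field_eq, right_field_eq.
    unfold plus, scal; simpl. unfold prod_plus, prod_scal, plus, scal, mult; simpl.
    unfold mult; simpl.
    assert (0 <= s * (y - b)) by (apply Rmult_le_pos; lra).
    assert (0 <= (1 - s) * (y + b)) by (apply Rmult_le_pos; lra).
    (* One of the two weights is at least 1/2, which makes the combination strictly negative. *)
    destruct (Rle_or_lt s (1 / 2)); nra. }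
  rewrite at_right_0_iff in Lv.
  destruct (Lv (- fst v)) as [d [Hd A]]; [lra|].
  exists d; split; [exact Hd|]. intros s Hs. specialize (A s Hs).
  apply Rabs_def2 in A. unfold dquot in A. rewrite E in A; simpl in A.
  rewrite Rminus_0_r in A.
  replace (fst (z (t0 + s))) with (fst (z (t0 + s)) / s * s) by (field; lra).
  nra.
Qed.

(** Uniqueness along an arc: let [c] be the supremum of the times up to which [z] stays strictly
    left. Up to [c] it equals the flow; if [c < T], the flow is strictly left at [c], and continuity
    carries [z] further. *)
Lemma solution_passage gL gR b xL xR z t0 y T y1 :
  solution (gL, gR, b, xL, xR) z -> z t0 = (0, y) -> Rabs b < y ->
  left_passage gL b xL y T y1 ->
  forall t, 0 <= t <= T -> z (t0 + t) = flow gL b xL (0, y) t.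
Proof.
  intros H E Hy [HT [HP _]].
  destruct (solution_leaves_left _ _ _ _ _ _ _ _ H E Hy) as [h [Hh Nh]].
  set (A := fun t => 0 < t <= T /\ forall s, 0 < s < t -> fst (z (t0 + s)) < 0).
  assert (Follow : forall c, A c -> forall t, 0 <= t <= c -> z (t0 + t) = flow gL b xL (0, y) t).
  { intros c [Hc1 Hc2] t Ht. rewrite <- E.
    apply linear_solution_flow with c; [| |exact Ht].
    - intros s _. now apply (solution_continuous _ _ s H).
    - intros s Hs.
      assert (Ns : fst (z s) < 0).
      { replace s with (t0 + (s - t0)) by ring. apply Hc2; lra. }
      destruct (solution_left _ _ _ H Ns) as [D1 D2].
      rewrite (surjective_pairing (z s)), left_field_eq in D1, D2.
      now split. }
  destruct (completeness A) as [c [Hub Hlub]].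
  - exists T. intros t [Ht _]. lra.
  - exists (Rmin h T). split.
    + split; [apply Rmin_glb_lt; lra | apply Rmin_r].
    + intros s Hs. apply Nh. pose proof (Rmin_l h T). lra.
  - assert (HcT : c <= T) by (apply Hlub; intros t [Ht _]; lra).
    assert (Hc0 : 0 < c).
    { apply Rlt_le_trans with (Rmin h T); [apply Rmin_glb_lt; lra|]. apply Hub. split.
      + split; [apply Rmin_glb_lt; lra | apply Rmin_r].
      + intros s Hs. apply Nh. pose proof (Rmin_l h T). lra. }
    assert (Ac : A c).
    { split; [lra|]. intros s Hs.
      destruct (Classical_Prop.classic (exists t, A t /\ s < t)) as [[t [[_ At] Hst]]|N].
      - apply At; lra.
      - exfalso. assert (c <= s); [|lra]. apply Hlub. intros t At.
        destruct (Rle_or_lt t s); [assumption|]. exfalso; apply N; now exists t. }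
    destruct (Rle_lt_or_eq_dec c T HcT) as [Hlt|<-]; [exfalso|now apply Follow].
    assert (Nc : fst (z (t0 + c)) < 0).
    { rewrite (Follow c Ac) by lra. apply HP; lra. }
    destruct (continuous_neg_near (fun s => fst (z s)) (t0 + c)) as [d [Hd Nd]];
      [apply (solution_continuous _ _ _ H) | exact Nc |].
    assert (Ad : A (Rmin (c + d / 2) T)).
    { split.
      + split; [apply Rmin_glb_lt; lra | apply Rmin_r].
      + intros s Hs. pose proof (Rmin_l (c + d / 2) T).
        destruct (Rlt_or_le s c); [now apply Ac|].
        apply Nd. rewrite Rabs_pos_eq; lra. }
    apply Hub in Ad. assert (c < Rmin (c + d / 2) T); [|lra].
    apply Rmin_glb_lt; lra.
Qed.

(** * Gluing two half-orbits *)

Lemma filippov_left m p : fst p <= 0 -> filippov m p (left_field m p).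
Proof.
  intros Hp. split; [reflexivity|]. split; [lra|]. intros _.
  exists 0. split; [lra|].
  destruct (left_field m p), (right_field m p).
  unfold plus, scal; simpl. unfold prod_plus, prod_scal, plus, scal, mult; simpl.
  unfold mult; simpl. f_equal; ring.
Qed.

Lemma filippov_right m p : 0 <= fst p -> filippov m p (right_field m p).
Proof.
  intros Hp. split; [lra|]. split; [reflexivity|]. intros _.
  exists 1. split; [lra|].
  destruct (left_field m p), (right_field m p).
  unfold plus, scal; simpl. unfold prod_plus, prod_scal, plus, scal, mult; simpl.
  unfold mult; simpl. f_equal; ring.
Qed.

(** A one-sided derivative sees one arc only, so at a junction of a glued curve each side is
    computed from its own arc. *)
Lemma diff_quot_right_piece (z phi : R -> R * R) t u d v :
  0 < d -> (forall h, 0 <= h < d -> z (t + h) = phi (u + h)) ->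
  is_derive (fun s => fst (phi s)) u (fst v) ->
  is_derive (fun s => snd (phi s)) u (snd v) ->
  filterlim (diff_quot z t) (at_right 0) (locally v).
Proof.
  intros Hd E D1 D2.
  apply filterlim_ext_loc with (diff_quot phi u).
  - exists (mkposreal d Hd). intros h Hb Hh.
    change (Rabs (h - 0) < d) in Hb. rewrite Rabs_pos_eq in Hb by lra.
    unfold diff_quot. rewrite E by lra.
    replace (z t) with (phi u); [reflexivity|].
    rewrite <- (Rplus_0_r t), E, Rplus_0_r by lra. reflexivity.
  - apply diff_quot_coords; [apply at_right_proper_filter|].
    apply is_derive_sides in D1; apply is_derive_sides in D2. tauto.
Qed.

Lemma diff_quot_left_piece (z phi : R -> R * R) t u d v :
  0 < d -> (forall h, - d < h <= 0 -> z (t + h) = phi (u + h)) ->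
  is_derive (fun s => fst (phi s)) u (fst v) ->
  is_derive (fun s => snd (phi s)) u (snd v) ->
  filterlim (diff_quot z t) (at_left 0) (locally v).
Proof.
  intros Hd E D1 D2.
  apply filterlim_ext_loc with (diff_quot phi u).
  - exists (mkposreal d Hd). intros h Hb Hh.
    change (Rabs (h - 0) < d) in Hb. rewrite Rabs_left1 in Hb by lra.
    unfold diff_quot. rewrite E by lra.
    replace (z t) with (phi u); [reflexivity|].
    rewrite <- (Rplus_0_r t), E, Rplus_0_r by lra. reflexivity.
  - apply diff_quot_coords; [apply at_left_proper_filter|].
    apply is_derive_sides in D1; apply is_derive_sides in D2. tauto.
Qed.

Lemma flow_left_field gL gR b xL xR p t :
  let phi := flow gL b xL p in
  is_derive (fun s => fst (phi s)) t (fst (left_field (gL, gR, b, xL, xR) (phi t))) /\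
  is_derive (fun s => snd (phi s)) t (snd (left_field (gL, gR, b, xL, xR) (phi t))).
Proof.
  intros phi. destruct (flow_derive gL b xL p t) as [D1 D2].
  rewrite (surjective_pairing (phi t)), left_field_eq. now split.
Qed.

Lemma flow_right_field gL gR b xL xR p t :
  let phi := fun s => antipode (flow gR b (- xR) p s) in
  is_derive (fun s => fst (phi s)) t (fst (right_field (gL, gR, b, xL, xR) (phi t))) /\
  is_derive (fun s => snd (phi s)) t (snd (right_field (gL, gR, b, xL, xR) (phi t))).
Proof.
  intros phi. destruct (flow_derive gR b (- xR) p t) as [D1 D2].
  rewrite (surjective_pairing (phi t)), right_field_eq. unfold phi, antipode; cbn [fst snd].
  split.
  - evar_last; [apply (is_derive_opp _ _ _ D1)|]. unfold opp; simpl. ring.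
  - evar_last; [apply (is_derive_opp _ _ _ D2)|]. unfold opp; simpl. ring.
Qed.

Lemma euclidean_quotient P t : 0 < P -> exists k, P * IZR k <= t < P * IZR k + P.
Proof.
  intros HP. exists (Int_part (t / P)).
  destruct (base_Int_part (t / P)) as [H1 H2].
  assert (E : t = P * (t / P)) by (field; lra). split.
  - rewrite E at 2. apply Rmult_le_compat_l; lra.
  - rewrite E at 1. replace (P * IZR (Int_part (t / P)) + P) with (P * (IZR (Int_part (t / P)) + 1)) by ring.
    apply Rmult_lt_compat_l; lra.
Qed.

Definition glue (TL P : R) (phiL phiR : R -> R * R) (t : R) : R * R :=
  let u := t - P * IZR (Int_part (t / P)) in
  if Rle_dec u TL then phiL u else phiR (u - TL).

Lemma glue_pieces TL TR phiL phiR (P := TL + TR) (z := glue TL P phiL phiR) :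
  0 < TL -> 0 < TR -> phiL TL = phiR 0 -> phiR TR = phiL 0 ->
  forall k,
    (forall u, 0 <= u <= TL -> z (P * IZR k + u) = phiL u) /\
    (forall u, 0 <= u <= TR -> z (P * IZR k + TL + u) = phiR u).
Proof.
  intros HL HR E1 E2.
  assert (HP : 0 < P) by (unfold P; lra).
  assert (Q : forall k u, 0 <= u < P -> Int_part ((P * IZR k + u) / P) = k).
  { intros k u Hu. symmetry. apply Int_part_spec.
    replace ((P * IZR k + u) / P) with (IZR k + u / P) by (field; lra).
    assert (0 <= u / P) by (apply Rdiv_le_0_compat; lra).
    assert (u / P < 1) by (apply Rlt_div_l; lra). lra. }
  assert (A : forall k u, 0 <= u <= TL -> z (P * IZR k + u) = phiL u).
  { intros k u Hu. unfold z, glue. rewrite Q by (unfold P in *; lra).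
    replace (P * IZR k + u - P * IZR k) with u by ring.
    destruct (Rle_dec u TL); [reflexivity | lra]. }
  intros k. split; [apply A|]. intros u Hu.
  (* The end of the second piece is already the start of the next period. *)
  destruct (Req_dec u TR) as [->|N].
  - replace (P * IZR k + TL + TR) with (P * IZR (k + 1) + 0)
      by (rewrite plus_IZR; unfold P; ring).
    rewrite A by lra. now symmetry.
  - destruct (Req_dec u 0) as [->|N0].
    + rewrite Rplus_0_r, A by lra. exact E1.
    + unfold z, glue. rewrite Rplus_assoc, Q by (unfold P in *; lra).
      replace (P * IZR k + (TL + u) - P * IZR k) with (TL + u) by ring.
      destruct (Rle_dec (TL + u) TL); [lra|]. f_equal; ring.
Qed.

Lemma solution_of_passages gL gR b xL xR y y1 TL TR :
  left_passage gL b xL y TL y1 ->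
  left_passage gR b (- xR) (- y1) TR (- y) ->
  exists z, solution (gL, gR, b, xL, xR) z /\
    (forall t, z (t + (TL + TR)) = z t) /\
    (forall t, 0 <= t <= TL -> z t = flow gL b xL (0, y) t) /\
    (forall t, 0 <= t <= TR -> z (TL + t) = antipode (flow gR b (- xR) (0, - y1) t)).
Proof.
  intros [HL [NL EL]] [HR [NR ER]].
  set (m := (gL, gR, b, xL, xR)).
  set (phiL := flow gL b xL (0, y)).
  set (phiR := fun t => antipode (flow gR b (- xR) (0, - y1) t)).
  set (P := TL + TR). set (z := glue TL P phiL phiR).
  assert (GP := glue_pieces TL TR phiL phiR HL HR).
  assert (E1 : phiL TL = phiR 0).
  { unfold phiL, phiR. rewrite EL, flow_0. unfold antipode; simpl. f_equal; ring. }
  assert (E2 : phiR TR = phiL 0).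
  { unfold phiL, phiR. rewrite ER, flow_0. unfold antipode; simpl. f_equal; ring. }
  specialize (GP E1 E2). fold P z in GP.
  assert (NL' : forall u, 0 <= u <= TL -> fst (phiL u) <= 0).
  { intros u Hu. destruct (Req_dec u 0) as [->|]; [unfold phiL; rewrite flow_0; simpl; lra|].
    destruct (Req_dec u TL) as [->|]; [unfold phiL; rewrite EL; simpl; lra|].
    left; apply NL; lra. }
  assert (NR' : forall u, 0 <= u <= TR -> 0 <= fst (phiR u)).
  { intros u Hu. change (0 <= - fst (flow gR b (- xR) (0, - y1) u)).
    destruct (Req_dec u 0) as [->|]; [rewrite flow_0; simpl; lra|].
    destruct (Req_dec u TR) as [->|]; [rewrite ER; simpl; lra|].
    specialize (NR u ltac:(lra)). lra. }
  assert (HP : 0 < P) by (unfold P; lra).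
  exists z. split; [|split; [|split]].
  - intros t. destruct (euclidean_quotient P t HP) as [k Hk].
    set (u := t - P * IZR k). assert (Hu : 0 <= u < P) by (unfold u; lra).
    assert (Et : t = P * IZR k + u) by (unfold u; ring).
    clearbody u. subst t. clear Hk. split.
    + destruct (Rle_lt_or_eq_dec 0 u) as [Hu0|<-]; [lra| |].
      * destruct (Rle_or_lt u TL) as [Hu1|Hu1].
        -- exists (left_field m (phiL u)).
           destruct (GP k) as [G _]. split.
           ++ rewrite G by lra. apply filippov_left, NL'; lra.
           ++ destruct (flow_left_field gL gR b xL xR (0, y) u).
              apply diff_quot_left_piece with phiL u u; try assumption.
              intros h Hh. rewrite Rplus_assoc. apply G. lra.
        -- exists (right_field m (phiR (u - TL))).
           destruct (GP k) as [_ G].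
           assert (G' : forall h, - (u - TL) < h <= 0 ->
                     z (P * IZR k + u + h) = phiR (u - TL + h)).
           { intros h Hh. rewrite <- G by (unfold P in *; lra). f_equal; ring. }
           split.
           ++ rewrite <- (Rplus_0_r (P * IZR k + u)), G', Rplus_0_r by lra.
              apply filippov_right, NR'; unfold P in *; lra.
           ++ destruct (flow_right_field gL gR b xL xR (0, - y1) (u - TL)).
              apply diff_quot_left_piece with phiR (u - TL) (u - TL); try assumption; lra.
      (* At the start of a period the left derivative belongs to the right arc of the previous
         period, hence the index [k - 1]. *)
      * exists (right_field m (phiR TR)).
        destruct (GP (k - 1)%Z) as [_ G].
        assert (G' : forall h, - TR < h <= 0 ->
                     z (P * IZR k + 0 + h) = phiR (TR + h)).
        { intros h Hh. rewrite <- G by lra. f_equal. rewrite minus_IZR. unfold P; ring. }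
        split.
        ++ rewrite <- (Rplus_0_r (P * IZR k + 0)), G', Rplus_0_r by lra.
           apply filippov_right, NR'; lra.
        ++ destruct (flow_right_field gL gR b xL xR (0, - y1) TR).
           apply diff_quot_left_piece with phiR TR TR; try assumption; lra.
    + destruct (Rlt_or_le u TL) as [Hu1|Hu1].
      * exists (left_field m (phiL u)).
        destruct (GP k) as [G _]. split.
        -- rewrite G by lra. apply filippov_left, NL'; lra.
        -- destruct (flow_left_field gL gR b xL xR (0, y) u).
           apply diff_quot_right_piece with phiL u (TL - u); try assumption; [lra|].
           intros h Hh. rewrite Rplus_assoc. apply G. lra.
      * exists (right_field m (phiR (u - TL))).
        destruct (GP k) as [_ G].
        assert (G' : forall h, 0 <= h < P - u ->
                     z (P * IZR k + u + h) = phiR (u - TL + h)).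
        { intros h Hh. rewrite <- G by (unfold P in *; lra). f_equal; ring. }
        split.
        -- rewrite <- (Rplus_0_r (P * IZR k + u)), G', Rplus_0_r by lra.
           apply filippov_right, NR'; unfold P in *; lra.
        -- destruct (flow_right_field gL gR b xL xR (0, - y1) (u - TL)).
           apply diff_quot_right_piece with phiR (u - TL) (P - u); try assumption; lra.
  - intros t. destruct (euclidean_quotient P t HP) as [k Hk].
    destruct (GP k) as [G1 G2], (GP (k + 1)%Z) as [G3 G4].
    rewrite plus_IZR in G3, G4.
    destruct (Rle_or_lt (t - P * IZR k) TL) as [Ht|Ht].
    + replace (t + P) with (P * (IZR k + 1) + (t - P * IZR k)) by ring.
      rewrite G3, <- G1 by lra. f_equal; ring.
    + replace (t + P) with (P * (IZR k + 1) + TL + (t - P * IZR k - TL)) by ring.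
      rewrite G4, <- G2 by (unfold P in *; lra). f_equal; ring.
  - intros t Ht. destruct (GP 0%Z) as [G _]. rewrite <- (G t Ht). f_equal; ring.
  - intros t Ht. destruct (GP 0%Z) as [_ G]. change (z (TL + t) = phiR t).
    rewrite <- (G t Ht). f_equal; ring.
Qed.

(** * The return map near a cycle *)

Lemma periodic_shift (z : R -> R * R) T :
  (forall t, z (t + T) = z t) -> forall (k : Z) t, z (t + T * IZR k) = z t.
Proof.
  intros H.
  assert (N : forall n t, z (t + T * INR n) = z t).
  { induction n as [|n IH]; intros t.
    - f_equal; simpl; ring.
    - rewrite S_INR, <- (IH t), <- (H (t + T * INR n)). f_equal; ring. }
  intros k t. destruct (Z.le_gt_cases 0 k) as [Hk|Hk].
  - specialize (N (Z.to_nat k) t). now rewrite INR_IZR_INZ, Z2Nat.id in N by lia.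
  - specialize (N (Z.to_nat (- k)) (t + T * IZR k)).
    rewrite INR_IZR_INZ, Z2Nat.id, opp_IZR in N by lia.
    rewrite <- N. f_equal. ring.
Qed.

(** In time [T] the quantity [u ^ 2 + w ^ 2] is multiplied by [exp (2 c T)], which differs from 1;
    an orbit that returns must therefore be the focus. *)
Lemma flow_fixed_point c b xi p T :
  c <> 0 -> 0 < T -> flow c b xi p T = p -> forall t, flow c b xi p t = p.
Proof.
  intros Hc HT E t. destruct p as [x y]. unfold flow in *; cbn [fst snd] in *.
  set (u := x - xi) in *. set (w := c * u + 2 * c * xi - b - y) in *.
  set (e := exp (c * T)) in *. set (C := cos T) in *. set (S := sin T) in *.
  injection E as E1 E2.
  assert (U : e * (u * C + w * S) = u) by (unfold u in *; lra).
  assert (W : e * (w * C - u * S) = w) by (rewrite U in E2; unfold w in *; lra).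
  assert (He0 : 0 < e) by apply exp_pos.
  assert (He : e <> 1).
  { intros H. unfold e in H. rewrite <- exp_0 in H. apply exp_inv in H.
    assert (c * T <> 0) by (apply Rmult_integral_contrapositive_currified; lra). lra. }
  assert (CS : S * S + C * C = 1) by apply sin2_cos2.
  assert (N : u * u + w * w = e * e * (u * u + w * w)).
  { assert (K : (e * (u * C + w * S)) * (e * (u * C + w * S)) +
                (e * (w * C - u * S)) * (e * (w * C - u * S)) =
                e * e * (u * u + w * w) * (S * S + C * C)) by ring.
    rewrite U, W, CS in K. lra. }
  assert (Z : u * u + w * w = 0).
  { assert (e * e <> 1).
    { intros H. assert ((e - 1) * (e + 1) = 0) by lra.
      apply Rmult_integral in H0. lra. }
    assert (Z : (u * u + w * w) * (e * e - 1) = 0) by lra.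
    apply Rmult_integral in Z. lra. }
  assert (u = 0) by nra. assert (w = 0) by nra.
  rewrite H, H0. unfold w in H0. rewrite H in H0. unfold u in H. f_equal; lra.
Qed.

Lemma no_periodic_solution_left gL gR b xL xR z :
  gL <> 0 -> solution (gL, gR, b, xL, xR) z -> periodic z ->
  (forall t, fst (z t) < 0) -> False.
Proof.
  intros Hg H [[t1 N] [T [HT P]]] Hx.
  assert (F : forall t, 0 <= t <= T -> z (0 + t) = flow gL b xL (z 0) t).
  { apply linear_solution_flow.
    - intros t _. now apply (solution_continuous _ _ t H).
    - intros t _. destruct (solution_left _ _ _ H (Hx t)) as [D1 D2].
      rewrite (surjective_pairing (z t)), left_field_eq in D1, D2. now split. }
  assert (FT := F T ltac:(lra)). rewrite P in FT.
  assert (K := flow_fixed_point gL b xL (z 0) T Hg HT (eq_sym FT)).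
  apply N. destruct (euclidean_quotient T t1 HT) as [k Hk].
  replace t1 with (0 + (t1 - T * IZR k) + T * IZR k) by ring.
  rewrite periodic_shift, F by (auto; lra). apply K.
Qed.

Lemma periodic_mirror z : periodic z -> periodic (fun t => antipode (z t)).
Proof.
  intros [[t N] [T [HT P]]]. split.
  - exists t. intros E. apply N. rewrite <- (antipode_antipode (z t)), E.
    apply antipode_antipode.
  - exists T. split; [exact HT|]. intros s. now rewrite P.
Qed.

(** Isolation is demanded among all periodic orbits, including any that would avoid the line;
    nonzero [gL] and [gR] exclude those. *)
Lemma periodic_solution_meets_line gL gR b xL xR z :
  gL <> 0 -> gR <> 0 -> solution (gL, gR, b, xL, xR) z -> periodic z ->
  exists t, fst (z t) = 0.
Proof.
  intros HL HR H P.
  destruct (Classical_Prop.classic (exists t, fst (z t) = 0)) as [|N]; [assumption|].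
  exfalso.
  assert (N' : forall t, fst (z t) <> 0) by (intros t E; apply N; now exists t).
  assert (Cx : forall t, continuous (fun s => fst (z s)) t)
    by (intros t; apply (solution_continuous _ _ t H)).
  assert (S : forall s t, fst (z s) < 0 -> fst (z t) < 0).
  { intros s t Hs. destruct (Rlt_or_le (fst (z t)) 0) as [|Ht]; [assumption|exfalso].
    destruct (IVT_gen (fun s => fst (z s)) s t 0) as [r [_ Hr]].
    - intros r. apply continuity_pt_filterlim, Cx.
    - rewrite Rmin_left, Rmax_right; lra.
    - now apply (N' r). }
  destruct (Rlt_or_le (fst (z 0)) 0) as [H0|H0].
  - apply (no_periodic_solution_left _ _ _ _ _ z HL H P). intros t. now apply (S 0).
  - apply (no_periodic_solution_left gR gL b (- xR) (- xL) _ HR (solution_mirror _ _ H)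
             (periodic_mirror _ P)).
    intros t. unfold antipode; simpl.
    destruct (Rlt_or_le 0 (fst (z t))) as [|Ht]; [lra|].
    exfalso. specialize (N' t). specialize (S t 0). lra.
Qed.

Lemma solution_passage_right gL gR b xL xR z t0 y T y1 :
  solution (gL, gR, b, xL, xR) z -> z t0 = (0, y) -> Rabs b < - y ->
  left_passage gR b (- xR) (- y) T (- y1) ->
  forall t, 0 <= t <= T -> z (t0 + t) = antipode (flow gR b (- xR) (0, - y) t).
Proof.
  intros H E Hy HP t Ht.
  rewrite <- (antipode_antipode (z (t0 + t))). f_equal.
  apply (solution_passage gR gL b (- xR) (- xL) (fun s => antipode (z s)) t0 (- y) T (- y1));
    try assumption.
  - exact (solution_mirror _ _ H).
  - rewrite E. unfold antipode; simpl. f_equal; ring.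
Qed.

(* [PL y T y'] and [PR y' T y] describe passages through the left and the right
   half-plane whose ends are close to those of one fixed cycle through [(0, Y0)]
   and [(0, Y1)]. *)
Record isolated_return {gL gR b xL xR Y0 Y1 e d : R} {PL PR : R -> R -> R -> Prop} : Prop := {
  ir_e : 0 < e;
  ir_d : 0 < d;
  ir_Y0 : Rabs b + e <= Y0;
  ir_Y1 : Rabs b + e <= - Y1;
  ir_PL : forall y T y1, PL y T y1 -> left_passage gL b xL y T y1 /\ d <= T /\ y1 + b < 0;
  ir_PR : forall y1 T y2, PR y1 T y2 ->
    left_passage gR b (- xR) (- y1) T (- y2) /\ d <= T /\ 0 < y2 - b;
  ir_PL_ex : forall y, Rabs (y - Y0) < e -> exists T y1, PL y T y1;
  ir_PR_ex : forall y, Rabs (y - Y1) < e -> exists T y2, PR y T y2;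
  ir_PL_mono : forall y T y1 y' T' y1', PL y T y1 -> PL y' T' y1' -> y < y' -> y1' < y1;
  ir_PR_mono : forall y T y2 y' T' y2', PR y T y2 -> PR y' T' y2' -> y < y' -> y2' < y2;
  ir_unique : forall y T y1 T', PL y T y1 -> PR y1 T' y -> y = Y0
}.

Arguments isolated_return : clear implicits.

(** The only trace of closeness to the cycle that the return map argument uses. *)
Definition crosses_near (z : R -> R * R) (Y0 Y1 e : R) : Prop :=
  forall t, fst (z t) = 0 -> Rabs (snd (z t) - Y0) < e \/ Rabs (snd (z t) - Y1) < e.

Section ReturnMap.

Context {gL gR b xL xR Y0 Y1 e d : R} {PL PR : R -> R -> R -> Prop}.
Context (IR : isolated_return gL gR b xL xR Y0 Y1 e d PL PR).
Context {z : R -> R * R} (Hz : solution (gL, gR, b, xL, xR) z) (Hn : crosses_near z Y0 Y1 e).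

(** The landing point lies on the line, hence near [Y0] or [Y1]; the sign given by [ir_PL] excludes
    [Y0]. *)
Lemma left_step t0 y :
  z t0 = (0, y) -> Rabs (y - Y0) < e ->
  exists T y1, PL y T y1 /\ d <= T /\ z (t0 + T) = (0, y1) /\ Rabs (y1 - Y1) < e /\
    forall t, t0 < t < t0 + T -> fst (z t) < 0.
Proof.
  intros E Hy. destruct (ir_PL_ex IR y Hy) as [T [y1 P]].
  destruct (ir_PL IR _ _ _ P) as [HP [HT Hy1]].
  assert (Hby : Rabs b < y).
  { pose proof (ir_Y0 IR). apply Rabs_def2 in Hy. lra. }
  assert (F := solution_passage _ _ _ _ _ _ _ _ _ _ Hz E Hby HP).
  destruct HP as [HT0 [HP ET]].
  assert (E1 : z (t0 + T) = (0, y1)) by (rewrite F by lra; exact ET).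
  exists T, y1. repeat split; try assumption.
  - destruct (Hn (t0 + T)) as [K|K]; rewrite E1 in *; simpl in *; try reflexivity; [|exact K].
    pose proof (ir_Y0 IR).
    apply Rabs_def2 in K. pose proof (Rabs_maj2 b). lra.
  - intros t Ht. replace t with (t0 + (t - t0)) by ring. rewrite F by lra.
    apply HP; lra.
Qed.

Lemma right_step t0 y :
  z t0 = (0, y) -> Rabs (y - Y1) < e ->
  exists T y2, PR y T y2 /\ d <= T /\ z (t0 + T) = (0, y2) /\ Rabs (y2 - Y0) < e /\
    forall t, t0 < t < t0 + T -> 0 < fst (z t).
Proof.
  intros E Hy. destruct (ir_PR_ex IR y Hy) as [T [y2 P]].
  destruct (ir_PR IR _ _ _ P) as [HP [HT Hy2]].
  assert (Hby : Rabs b < - y).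
  { pose proof (ir_Y1 IR). apply Rabs_def2 in Hy. lra. }
  assert (F := solution_passage_right _ _ _ _ _ _ _ _ _ _ Hz E Hby HP).
  destruct HP as [HT0 [HP ET]].
  assert (E1 : z (t0 + T) = (0, y2)).
  { rewrite F, ET by lra. unfold antipode; simpl. f_equal; ring. }
  exists T, y2. repeat split; try assumption.
  - destruct (Hn (t0 + T)) as [K|K]; rewrite E1 in *; simpl in *; try reflexivity; [exact K|].
    pose proof (ir_Y1 IR).
    apply Rabs_def2 in K. pose proof (Rabs_maj2 b). pose proof (Rle_abs b). lra.
  - intros t Ht. replace t with (t0 + (t - t0)) by ring. rewrite F by lra.
    specialize (HP (t - t0) ltac:(lra)).
    change (0 < - fst (flow gR b (- xR) (0, - y) (t - t0))). lra.
Qed.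

(** The last clause ensures that no crossing at positive height is skipped between two returns, so
    that [no_drift] controls all of them and not just the iterates. *)
Lemma return_step t0 y :
  z t0 = (0, y) -> Rabs (y - Y0) < e ->
  exists T y1 T' y2, PL y T y1 /\ PR y1 T' y2 /\ d <= T + T' /\
    z (t0 + (T + T')) = (0, y2) /\ Rabs (y2 - Y0) < e /\
    forall t, t0 < t < t0 + (T + T') -> fst (z t) = 0 -> snd (z t) <= 0.
Proof.
  intros E Hy.
  destruct (left_step t0 y E Hy) as [T [y1 [P1 [HT [E1 [Hy1 N1]]]]]].
  destruct (right_step (t0 + T) y1 E1 Hy1) as [T' [y2 [P2 [HT' [E2 [Hy2 N2]]]]]].
  pose proof (ir_d IR).
  exists T, y1, T', y2. rewrite <- Rplus_assoc. repeat split; try assumption; [lra|].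
  intros t Ht H0. destruct (Rtotal_order t (t0 + T)) as [Hl|[->|Hr]].
  - specialize (N1 t ltac:(lra)). lra.
  - rewrite E1; simpl. pose proof (ir_Y1 IR).
    apply Rabs_def2 in Hy1. pose proof (Rabs_pos b). lra.
  - specialize (N2 t ltac:(lra)). lra.
Qed.

(* A planar return map is increasing, so its iterates are monotone and a periodic
   solution can only cross at a fixed point; [s = 1] or [s = -1] is the direction
   of the drift. *)
Lemma no_drift s t0 y T y1 T' y2 :
  s = 1 \/ s = - 1 -> periodic z ->
  z t0 = (0, y) -> 0 < y -> PL y T y1 -> PR y1 T' y2 -> 0 < T + T' ->
  z (t0 + (T + T')) = (0, y2) -> Rabs (y2 - Y0) < e -> s * (y2 - y) <= 0.
Proof.
  intros Hs [_ [P [HP Hper]]] E Hy P1 P2 HTT E2 Hy2.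
  destruct (Rle_or_lt (s * (y2 - y)) 0) as [|Hd]; [assumption|exfalso].
  set (t2 := t0 + (T + T')) in *.
  assert (Iter : forall n, exists r Y, t2 + INR n * d <= r /\ z r = (0, Y) /\
     Rabs (Y - Y0) < e /\ 0 <= s * (Y - y2) /\
     forall t, t2 <= t <= r -> fst (z t) = 0 -> 0 < snd (z t) -> 0 <= s * (snd (z t) - y2)).
  { induction n as [|n [r [Y [Hr [Er [HY [HsY Hall]]]]]]].
    - exists t2, y2. simpl. repeat split; try assumption; try lra.
      intros t Ht _ _. replace t with t2 by lra. rewrite E2; simpl. lra.
    - destruct (return_step r Y Er HY) as [U [Y' [U' [Y'' [Q1 [Q2 [HU [EU [HY'' Neg]]]]]]]]].
      pose proof (ir_d IR) as Hd0.
      (* [Y] lies strictly beyond [y] in the direction [s], and two decreasing half-maps compose to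
         an increasing one, so the image of [Y] lies beyond [y2], the image of [y]. *)
      assert (Adv : 0 <= s * (Y'' - y2)).
      { destruct Hs as [-> | ->].
        - assert (y < Y) by lra.
          pose proof (ir_PL_mono IR _ _ _ _ _ _ P1 Q1 H).
          pose proof (ir_PR_mono IR _ _ _ _ _ _ Q2 P2 H0). lra.
        - assert (Y < y) by lra.
          pose proof (ir_PL_mono IR _ _ _ _ _ _ Q1 P1 H).
          pose proof (ir_PR_mono IR _ _ _ _ _ _ P2 Q2 H0). lra. }
      exists (r + (U + U')), Y''. rewrite S_INR. repeat split; try assumption; [lra|].
      intros t Ht H0 Hpos. destruct (Rle_or_lt t r) as [Hle|Hlt]; [apply Hall; lra|].
      destruct (Req_dec t (r + (U + U'))) as [->|Ne]; [rewrite EU; exact Adv|].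
      specialize (Neg t ltac:(lra) H0). lra. }
  (* [t0 + P * (k + 1)] is a copy of [t0] later than [t2]. Each return lasts at least [d], so
     finitely many iterates pass it; its height is [y], on the wrong side of [y2]. *)
  destruct (euclidean_quotient P (t2 - t0) HP) as [k Hk].
  destruct (nfloor_ex (Rmax 0 ((t0 + P * IZR (k + 1) - t2) / d))) as [n Hn'];
    [apply Rmax_l|].
  pose proof (ir_d IR) as Hd0.
  destruct (Iter (S n)) as [r [Y [Hr [_ [_ [_ Hall]]]]]].
  assert (Hlate : t0 + P * IZR (k + 1) <= r).
  { pose proof (Rmax_r 0 ((t0 + P * IZR (k + 1) - t2) / d)).
    rewrite S_INR in Hr.
    assert ((t0 + P * IZR (k + 1) - t2) / d * d < (INR n + 1) * d)
      by (apply Rmult_lt_compat_r; lra).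
    replace ((t0 + P * IZR (k + 1) - t2) / d * d) with (t0 + P * IZR (k + 1) - t2) in H0
      by (field; lra). lra. }
  specialize (Hall (t0 + P * IZR (k + 1))).
  rewrite (periodic_shift z P Hper), E in Hall. simpl in Hall.
  rewrite plus_IZR in *. specialize (Hall ltac:(lra) eq_refl Hy). lra.
Qed.

(** Excluding drift in both directions leaves a fixed height, which [ir_unique] identifies. If the
    known crossing is near [Y1], one right arc leads to a crossing near [Y0]. *)
Lemma periodic_crosses_at_fixed_point :
  gL <> 0 -> gR <> 0 -> periodic z -> exists t0, z t0 = (0, Y0).
Proof.
  intros HL HR Hp.
  destruct (periodic_solution_meets_line _ _ _ _ _ _ HL HR Hz Hp) as [t H0].
  assert (Up : exists t0 y, z t0 = (0, y) /\ Rabs (y - Y0) < e).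
  { assert (Et : z t = (0, snd (z t))) by (rewrite <- H0; apply surjective_pairing).
    destruct (Hn t H0) as [K|K].
    - now exists t, (snd (z t)).
    - destruct (right_step t (snd (z t)) Et K) as [T [y2 [_ [_ [E [Hy _]]]]]].
      now exists (t + T), y2. }
  destruct Up as [t0 [y [E Hy]]].
  destruct (return_step t0 y E Hy) as [T [y1 [T' [y2 [P1 [P2 [HT [E2 [Hy2 _]]]]]]]]].
  assert (Hpos : 0 < y).
  { pose proof (ir_Y0 IR). apply Rabs_def2 in Hy.
    pose proof (Rabs_pos b). lra. }
  pose proof (ir_d IR) as Hd0.
  assert (D : forall s, s = 1 \/ s = - 1 -> s * (y2 - y) <= 0).
  { intros s Hs. apply (no_drift s t0 y T y1 T' y2); auto; lra. }
  pose proof (D 1 (or_introl eq_refl)). pose proof (D (-1) (or_intror eq_refl)).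
  replace y2 with y in * by lra. exists t0.
  rewrite E. f_equal. exact (ir_unique IR _ _ _ _ P1 P2).
Qed.

End ReturnMap.

(** Compactness of the cycle, as the positive minimum of one continuous function. It turns closeness
    to the cycle into closeness to [Y0] or [Y1] at crossings. *)
Lemma cycle_near_line (x y : R -> R) P Y0 Y1 e :
  0 < P -> 0 < e ->
  (forall t, 0 <= t <= P -> continuous x t /\ continuous y t) ->
  (forall t, 0 <= t <= P -> x t = 0 -> y t = Y0 \/ y t = Y1) ->
  exists d, 0 < d /\ forall t, 0 <= t <= P -> Rabs (x t) < d ->
    Rabs (y t - Y0) < e \/ Rabs (y t - Y1) < e.
Proof.
  intros HP He Hc H0.
  set (E := e * e * (e * e)).
  assert (HE : 0 < E) by (unfold E; repeat apply Rmult_lt_0_compat; assumption).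
  set (N := fun t => (y t - Y0) * (y t - Y0) * ((y t - Y1) * (y t - Y1))).
  (* [theta] vanishes only where [x = 0] and [N >= E], that is nowhere. *)
  set (theta := fun t => Rabs (x t) + ((E - N t) + Rabs (E - N t))).
  destruct (continuity_ab_min theta 0 P) as [r [Hmin Hr]]; [lra| |].
  { intros t Ht. destruct (Hc t Ht) as [Cx Cy]. apply continuity_pt_filterlim.
    assert (CY : forall Y, continuous (fun t => y t - Y) t).
    { intros Y. apply (continuous_minus y (fun _ => Y)); [exact Cy | apply continuous_const]. }
    assert (CN : continuous (fun t => E - N t) t).
    { apply (continuous_minus (fun _ => E) N); [apply continuous_const|].
      apply (continuous_mult (fun t => (y t - Y0) * (y t - Y0)) (fun t => (y t - Y1) * (y t - Y1))).
      - now apply (continuous_mult (fun t => y t - Y0) (fun t => y t - Y0)).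
      - now apply (continuous_mult (fun t => y t - Y1) (fun t => y t - Y1)). }
    apply (continuous_plus (fun t => Rabs (x t)) (fun t => E - N t + Rabs (E - N t))).
    - apply (continuous_comp x Rabs); [exact Cx | apply continuous_Rabs].
    - apply (continuous_plus (fun t => E - N t) (fun t => Rabs (E - N t))); [exact CN|].
      apply (continuous_comp (fun t => E - N t) Rabs); [exact CN | apply continuous_Rabs]. }
  assert (Hpos : forall t, 0 <= t <= P -> 0 < theta t).
  { intros t Ht. unfold theta. pose proof (Rle_abs (- (E - N t))). rewrite Rabs_Ropp in H.
    destruct (Req_dec (x t) 0) as [Hx|Hx].
    - assert (N t = 0) as -> by (unfold N; destruct (H0 t Ht Hx) as [-> | ->]; ring).
      rewrite Hx, Rabs_R0, Rabs_pos_eq; lra.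
    - pose proof (Rabs_pos_lt _ Hx). lra. }
  exists (theta r). split; [now apply Hpos|]. intros t Ht Hx.
  specialize (Hmin t Ht).
  assert (HN : N t < E).
  { destruct (Rlt_or_le (N t) E) as [|HN]; [assumption|].
    unfold theta at 2 in Hmin. rewrite (Rabs_left1 (E - N t)) in Hmin by lra. lra. }
  destruct (Rlt_or_le (Rabs (y t - Y0)) e) as [|A]; [now left|].
  destruct (Rlt_or_le (Rabs (y t - Y1)) e) as [|B]; [now right|].
  exfalso. apply (Rlt_not_le _ _ HN). unfold E, N.
  assert (S : forall a, e <= Rabs a -> e * e <= a * a).
  { intros a Ha. replace (a * a) with (Rabs a * Rabs a)
      by (rewrite <- Rabs_mult; apply Rabs_pos_eq, Rle_0_sqr).
    apply Rmult_le_compat; lra. }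
  apply Rmult_le_compat; try (apply Rmult_le_pos; lra); now apply S.
Qed.

(** A nearby periodic solution passes through [(0, Y0)], and from there the two passages force it
    along [z] forever, so the two orbits are the same set. *)
Lemma isolated_return_limit_cycle gL gR b xL xR Y0 Y1 e d PL PR TL TR :
  gL <> 0 -> gR <> 0 -> isolated_return gL gR b xL xR Y0 Y1 e d PL PR ->
  PL Y0 TL Y1 -> PR Y1 TR Y0 ->
  exists C, limit_cycle (gL, gR, b, xL, xR) C /\ C (0, Y0) /\
    forall p, C p -> fst p = 0 -> p = (0, Y0) \/ p = (0, Y1).
Proof.
  intros HgL HgR IR BL BR.
  destruct (ir_PL IR _ _ _ BL) as [PassL _]. destruct (ir_PR IR _ _ _ BR) as [PassR _].
  destruct (solution_of_passages _ _ _ _ _ _ _ _ _ PassL PassR) as [z [Hz [Hper [ZL ZR]]]].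
  set (P := TL + TR) in *.
  pose proof PassL as [HTL [NL EL]]. pose proof PassR as [HTR [NR ER]].
  pose proof (ir_e IR) as He. pose proof (ir_Y0 IR) as HY0. pose proof (ir_Y1 IR) as HY1.
  pose proof (Rabs_pos b) as Hb0. pose proof (Rle_abs b) as Hb1.
  pose proof (Rabs_maj2 b) as Hb2.
  assert (HP : 0 < P) by (unfold P; lra).
  assert (z0 : z 0 = (0, Y0)) by (rewrite ZL by lra; apply flow_0).
  assert (zTL : z TL = (0, Y1)) by (rewrite ZL by lra; exact EL).
  assert (zP : z P = (0, Y0)) by (rewrite <- (Rplus_0_l P), Hper; exact z0).
  assert (Hline : forall t, 0 <= t <= P -> fst (z t) = 0 -> z t = (0, Y0) \/ z t = (0, Y1)).
  { intros t Ht Hx. unfold P in Ht.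
    destruct (Req_dec t 0) as [->|]; [now left|].
    destruct (Req_dec t TL) as [->|]; [now right|].
    destruct (Req_dec t P) as [->|]; [now left|]. exfalso.
    destruct (Rlt_or_le t TL).
    - rewrite ZL in Hx by lra. specialize (NL t ltac:(lra)). lra.
    - replace t with (TL + (t - TL)) in Hx by ring. rewrite ZR in Hx by lra.
      specialize (NR (t - TL) ltac:(unfold P in *; lra)).
      change (- fst (flow gR b (- xR) (0, - Y1) (t - TL)) = 0) in Hx. lra. }
  assert (Red : forall t, exists u, 0 <= u <= P /\ z t = z u).
  { intros t. destruct (euclidean_quotient P t HP) as [k Hk].
    exists (t - P * IZR k). split; [lra|].
    rewrite <- (periodic_shift z P Hper k (t - P * IZR k)). f_equal; ring. }
  assert (HC : forall p, (exists t, z t = p) -> fst p = 0 -> p = (0, Y0) \/ p = (0, Y1)).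
  { intros p [t <-] Hx. destruct (Red t) as [u [Hu E]]. rewrite E in *. now apply Hline. }
  exists (fun p => exists t, z t = p).
  split; [|split; [now exists 0 | exact HC]]. split; [split; [|split]|].
  - exists z. split; [exact Hz|]. split; [|reflexivity]. split.
    + exists TL. rewrite z0, zTL. intros E; injection E. lra.
    + now exists P.
  - exists (0, Y0). split; [now exists 0 | reflexivity].
  - intros p Hp Hx. split; [exact Hx|].
    destruct (HC p Hp Hx) as [-> | ->]; rewrite left_field_eq, right_field_eq; simpl.
    + apply Rmult_neg_neg; lra.
    + apply Rmult_lt_0_compat; lra.
  (* Half of [e] is spent along the cycle and half on the distance between the two orbits. *)
  - destruct (cycle_near_line (fun t => fst (z t)) (fun t => snd (z t)) P Y0 Y1 (e / 2))
      as [d1 [Hd1 Near]]; [lra | lra | | |].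
    { intros t _. now apply (solution_continuous _ _ t Hz). }
    { intros t Ht Hx. destruct (Hline t Ht Hx) as [-> | ->]; simpl; tauto. }
    exists (Rmin d1 (e / 2)). split; [apply Rmin_glb_lt; lra|].
    intros C' [z' [Hz' [Hp' HC']]] Hclose.
    assert (Hn : crosses_near z' Y0 Y1 e).
    { intros t Hx. destruct (Hclose (z' t)) as [q [[s Hq] [B1 B2]]].
      { apply HC'. now exists t. }
      destruct (Red s) as [u [Hu E]]. rewrite E in Hq. subst q.
      change (Rabs (fst (z' t) - fst (z u)) < Rmin d1 (e / 2)) in B1.
      change (Rabs (snd (z' t) - snd (z u)) < Rmin d1 (e / 2)) in B2.
      pose proof (Rmin_l d1 (e / 2)); pose proof (Rmin_r d1 (e / 2)).
      rewrite Hx, Rabs_minus_sym, Rminus_0_r in B1.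
      assert (Tri : forall Y, Rabs (snd (z u) - Y) < e / 2 -> Rabs (snd (z' t) - Y) < e).
      { intros Y HY. apply Rabs_def2 in HY. apply Rabs_def2 in B2. apply Rabs_def1; lra. }
      destruct (Near u Hu ltac:(lra)); [left | right]; now apply Tri. }
    destruct (periodic_crosses_at_fixed_point IR Hz' Hn HgL HgR Hp') as [t0 E0].
    assert (Step : forall s, z' s = (0, Y0) -> forall u, 0 <= u <= P -> z' (s + u) = z u).
    { intros s Es.
      assert (F1 : forall u, 0 <= u <= TL -> z' (s + u) = z u).
      { intros u Hu. rewrite ZL by exact Hu.
        apply (solution_passage _ _ _ _ _ _ _ _ TL Y1 Hz' Es); [lra | exact PassL | exact Hu]. }
      assert (Es1 : z' (s + TL) = (0, Y1)) by (rewrite F1 by lra; exact zTL).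
      intros u Hu. destruct (Rle_or_lt u TL); [apply F1; lra|].
      replace (s + u) with (s + TL + (u - TL)) by ring.
      replace u with (TL + (u - TL)) at 2 by ring. unfold P in Hu. rewrite ZR by lra.
      apply (solution_passage_right _ _ _ _ _ _ _ _ TR Y0 Hz' Es1); [lra | exact PassR | lra]. }
    assert (Iter : forall n, z' (t0 + P * INR n) = (0, Y0)).
    { induction n as [|n IH]; [rewrite Rmult_0_r, Rplus_0_r; exact E0|].
      rewrite S_INR, Rmult_plus_distr_l, Rmult_1_r, <- Rplus_assoc, Step by (try exact IH; lra).
      exact zP. }
    destruct Hp' as [_ [T' [HT' Hper']]].
    intros p. rewrite HC'. split.
    (* Only forward passages have been followed, so [t] is first moved past [t0] by periods of
       [z']. *)
    + intros [t Et]. destruct (euclidean_quotient T' (t - t0) HT') as [k Hk].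
      assert (Et' : z' (t - T' * IZR k) = p).
      { rewrite <- Et, <- (periodic_shift z' T' Hper' k (t - T' * IZR k)). f_equal; ring. }
      set (s := t - T' * IZR k) in *.
      destruct (euclidean_quotient P (s - t0) HP) as [j Hj].
      assert (0 <= j)%Z.
      { destruct (Z.le_gt_cases 0 j) as [|Hneg]; [assumption|exfalso].
        assert (IZR j <= -1) by (apply IZR_le; lia).
        assert (P * IZR j <= P * -1) by (apply Rmult_le_compat_l; lra).
        unfold s in *; lra. }
      exists (s - (t0 + P * IZR j)). rewrite <- Et'.
      rewrite <- (Step (t0 + P * IZR j)).
      * f_equal; ring.
      * rewrite <- (Z2Nat.id j), <- INR_IZR_INZ by assumption. apply Iter.
      * lra.
    + intros [t Et]. destruct (Red t) as [u [Hu E]].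
      exists (t0 + u). rewrite Step by assumption. now rewrite <- E.
Qed.

(** * Half-orbits parametrized by flight time *)

(* This is [exp (- c t)] times the classical function
   [1 - exp (c t) (cos t - c sin t)] of half-return maps of foci. *)
Definition ret_num (c t : R) : R := exp (- c * t) - cos t + c * sin t.

(* A half-orbit of flight time [t] around the focus of abscissa [xi] starts on
   [x = 0] at height [xi * ret_height c t - b] and ends at height [- xi * ret_height (- c) t - b]. *)
Definition ret_height (c t : R) : R := ret_num c t / sin t.

Lemma exp_opp_mul c t : exp (c * t) * exp (- c * t) = 1.
Proof. rewrite <- exp_plus. replace (c * t + - c * t) with 0 by ring. apply exp_0. Qed.

(** [ret_num c t] is [exp (- c t)] times [phi t], where [phi 0 = 0] and [phi'] has the sign of
    [sin]. Splitting at [t / 2] keeps the second mean value point away from the zero of [sin] at 0;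
    if that point is [PI], then [t = PI] and [phi] is computed. *)
Lemma ret_num_pos c t : 0 < t <= PI -> 0 < ret_num c t.
Proof.
  intros Ht.
  set (phi := fun t => 1 - exp (c * t) * (cos t - c * sin t)).
  assert (D : forall s, is_derive phi s ((1 + c ^ 2) * exp (c * s) * sin s)).
  { intros s. unfold phi. auto_derive; auto. ring. }
  destruct (MVT_gen phi 0 (t / 2) (fun s => (1 + c ^ 2) * exp (c * s) * sin s))
    as [r [Hr E]].
  { intros s _. apply D. }
  { intros s _. apply continuity_pt_filterlim. eapply is_derive_continuous, D. }
  destruct (MVT_gen phi (t / 2) t (fun s => (1 + c ^ 2) * exp (c * s) * sin s))
    as [r' [Hr' E']].
  { intros s _. apply D. }
  { intros s _. apply continuity_pt_filterlim. eapply is_derive_continuous, D. }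
  rewrite Rmin_left, Rmax_right in Hr, Hr' by lra.
  assert (phi0 : phi 0 = 0).
  { unfold phi. rewrite Rmult_0_r, exp_0, cos_0, sin_0. ring. }
  assert (K : forall s, 0 < (1 + c ^ 2) * exp (c * s)).
  { intros s. apply Rmult_lt_0_compat; [nra | apply exp_pos]. }
  assert (0 <= sin r) by (apply sin_ge_0; lra).
  assert (0 <= sin r') by (apply sin_ge_0; lra).
  assert (H2 : 0 <= phi (t / 2) - phi 0).
  { rewrite E. repeat apply Rmult_le_pos; try lra; [nra | left; apply exp_pos]. }
  assert (H3 : 0 < phi t).
  { destruct (Req_dec (sin r') 0) as [Z|NZ].
    - assert (r' = PI).
      { destruct (Req_dec r' PI) as [|N]; [assumption|].
        assert (0 < sin r') by (apply sin_gt_0; lra). lra. }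
      assert (t = PI) as -> by lra.
      unfold phi. rewrite cos_PI, sin_PI. pose proof (exp_pos (c * PI)). lra.
    - assert (0 < phi t - phi (t / 2)); [|lra].
      rewrite E'. apply Rmult_lt_0_compat; [|lra].
      apply Rmult_lt_0_compat; [apply K | lra]. }
  replace (ret_num c t) with (exp (- c * t) * phi t).
  - apply Rmult_lt_0_compat; [apply exp_pos | exact H3].
  - unfold phi, ret_num. pose proof (exp_opp_mul c t).
    transitivity (exp (- c * t) - (exp (c * t) * exp (- c * t)) * (cos t - c * sin t));
      [ring | rewrite H1; ring].
Qed.

(** The sign of the derivative is that of [ret_num (- c)], so monotonicity of heights reduces to
    positivity of [ret_num]. *)
Lemma ret_height_derive c t :
  sin t <> 0 -> is_derive (ret_height c) t (exp (- c * t) * ret_num (- c) t / (sin t) ^ 2).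
Proof.
  intros Hs. unfold ret_height, ret_num. auto_derive; [exact Hs|].
  rewrite Ropp_involutive. pose proof (exp_opp_mul c t) as H.
  pose proof (sin2_cos2 t) as H2. unfold Rsqr in H2.
  field_simplify_eq; [|exact Hs].
  transitivity (exp (c * t) * exp (- c * t) - exp (- c * t) * cos t - exp (- c * t) * c * sin t);
    [rewrite H, <- H2 | ]; ring.
Qed.

Lemma ret_height_increasing c a b :
  a < b -> (forall t, a <= t <= b -> sin t <> 0 /\ 0 < ret_num (- c) t) ->
  ret_height c a < ret_height c b.
Proof.
  intros Hab H.
  destruct (MVT_gen (ret_height c) a b (fun t => exp (- c * t) * ret_num (- c) t / (sin t) ^ 2))
    as [r [Hr E]]; rewrite ?Rmin_left, ?Rmax_right in * by lra.
  - intros t Ht. apply ret_height_derive, H; lra.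
  - intros t Ht. apply continuity_pt_filterlim. eapply is_derive_continuous, ret_height_derive, H; lra.
  - destruct (H r Hr) as [H1 H2].
    assert (0 < ret_height c b - ret_height c a); [|lra]. rewrite E.
    apply Rmult_lt_0_compat; [|lra]. apply Rdiv_lt_0_compat.
    + apply Rmult_lt_0_compat; [apply exp_pos | exact H2].
    + apply pow2_gt_0. exact H1.
Qed.

Lemma ret_height_continuous c t : sin t <> 0 -> continuous (ret_height c) t.
Proof. intros H. eapply is_derive_continuous, ret_height_derive, H. Qed.

Lemma sin_pos_0_PI t : 0 < t < PI -> 0 < sin t.
Proof. intros [H1 H2]. now apply sin_gt_0. Qed.

Lemma sin_neg_PI_2PI t : PI < t < 2 * PI -> sin t < 0.
Proof. intros [H1 H2]. now apply sin_lt_0. Qed.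

(** Positivity up to [PI] is automatic, but for [c <> 0] one of the two values is negative at
    [2 PI]; [tm] bounds the flight times that stay on the good side. *)
Definition focus_domain (c tm : R) : Prop :=
  PI <= tm <= 2 * PI /\ forall t, 0 < t < tm -> 0 < ret_num c t /\ 0 < ret_num (- c) t.

(* The two admissible branches: [T < PI] for a focus on the far side of the
   line and [T > PI] for a focus on the near side. *)
Definition on_branch (tm xi T : R) : Prop :=
  (0 < xi /\ 0 < T < PI) \/ (xi < 0 /\ PI < T < tm).

(** Where [sin t <> 0], the abscissa along the arc is [exp (c t) * xi * sin t * (ret_height c t -
    ret_height c T)], and [ret_height] is increasing on either side of its pole [PI]. *)
Lemma half_passage c b xi T tm :
  focus_domain c tm -> on_branch tm xi T ->
  left_passage c b xi (xi * ret_height c T - b) T (- xi * ret_height (- c) T - b).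
Proof.
  intros [Htm Hee] HB.
  assert (Hpi := PI_RGT_0).
  assert (HT : 0 < T < tm) by (destruct HB as [[_ ?]|[_ ?]]; lra).
  assert (Hs : sin T <> 0).
  { destruct HB as [[_ H]|[_ H]].
    - apply Rgt_not_eq, sin_pos_0_PI, H.
    - apply Rlt_not_eq, sin_neg_PI_2PI; lra. }
  assert (F : forall t, fst (flow c b xi (0, xi * ret_height c T - b) t) =
      exp (c * t) * (xi * ret_num c t - xi * ret_height c T * sin t)).
  { intros t. unfold flow; cbn [fst snd]. unfold ret_num.
    transitivity (xi * (exp (c * t) * exp (- c * t)) +
      exp (c * t) * (- xi * cos t + (c * xi - xi * ret_height c T) * sin t));
      [rewrite exp_opp_mul|]; ring. }
  split; [lra|]. split.
  - intros t Ht. rewrite F.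
    assert (0 < ret_num c t) by (apply Hee; lra).
    assert (0 < ret_num c T) by (apply Hee; lra).
    assert (ret_height_t : sin t <> 0 -> ret_num c t = ret_height c t * sin t).
    { intros N. unfold ret_height. field. exact N. }
    rewrite <- (Rmult_0_r (exp (c * t))). apply Rmult_lt_compat_l; [apply exp_pos|].
    destruct HB as [[Hx HT']|[Hx HT']].
    + assert (Hst : 0 < sin t) by (apply sin_pos_0_PI; lra).
      assert (ret_height c t < ret_height c T).
      { apply ret_height_increasing; [lra|]. intros s Hs'. split.
        - apply Rgt_not_eq, sin_pos_0_PI; lra.
        - apply Hee; lra. }
      rewrite ret_height_t by lra.
      assert (0 < xi * sin t) by (apply Rmult_lt_0_compat; assumption). nra.
    + assert (HEE : ret_height c T < 0).
      { assert (sin T < 0) by (apply sin_neg_PI_2PI; lra).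
        unfold ret_height. apply Rmult_pos_neg; [assumption|]. now apply Rinv_lt_0_compat. }
      (* Heights can be compared with [ret_height c T] only past the pole; up to [PI] both terms of
         [F] have the right sign by themselves. *)
      destruct (Rle_or_lt t PI) as [Hle|Hlt].
      * assert (0 <= sin t) by (apply sin_ge_0; lra).
        assert (0 <= xi * ret_height c T) by nra.
        assert (xi * ret_num c t < 0) by nra. nra.
      * assert (Hst : sin t < 0) by (apply sin_neg_PI_2PI; lra).
        assert (ret_height c t < ret_height c T).
        { apply ret_height_increasing; [lra|]. intros s Hs'. split.
          - apply Rlt_not_eq, sin_neg_PI_2PI; lra.
          - apply Hee; lra. }
        rewrite ret_height_t by lra.
        assert (0 < xi * sin t) by nra. nra.
  - apply injective_projections.
    + rewrite F. cbn [fst]. unfold ret_height. field. exact Hs.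
    + unfold flow; cbn [fst snd].
      pose proof (exp_opp_mul c T) as H.
      pose proof (sin2_cos2 T) as H2. unfold Rsqr in H2.
      assert (K1 : ret_height c T * sin T = exp (- c * T) - cos T + c * sin T)
        by (unfold ret_height, ret_num; field; exact Hs).
      assert (K2 : ret_height (- c) T * sin T = exp (c * T) - cos T - c * sin T)
        by (unfold ret_height, ret_num; rewrite Ropp_involutive; field; exact Hs).
      set (p := exp (c * T)) in *. set (q := exp (- c * T)) in *.
      set (C := cos T) in *. set (S := sin T) in *.
      set (K := ret_height c T) in *. set (K' := ret_height (- c) T) in *.
      (* [W1] and [W2] evaluate the rotated coordinates at time [T]; [W2] is multiplied by [S]
         first, so that [K1] and [K2] apply. *)
      assert (W1 : p * ((0 - xi) * C + (c * (0 - xi) + 2 * c * xi - b - (xi * K - b)) * S)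
                   = - xi).
      { transitivity (p * xi * (c * S - C - K * S)); [ring|]. rewrite K1.
        transitivity (- xi * (p * q)); [ring | rewrite H; ring]. }
      assert (W2 : p * ((c * (0 - xi) + 2 * c * xi - b - (xi * K - b)) * C - (0 - xi) * S)
                   = c * xi + xi * K').
      { apply Rmult_eq_reg_r with S; [|exact Hs].
        transitivity (p * xi * ((c * S - K * S) * C + S * S)); [ring|]. rewrite K1.
        transitivity (xi * (p * (S * S + C * C) - p * q * C)); [ring|].
        rewrite H, H2. transitivity (xi * (c * S + K' * S)); [rewrite K2|]; ring. }
      rewrite W1, W2. ring.
Qed.

(** The case of a focus on the line, outside [on_branch]: all flights last exactly [PI]. The center
    is built from it. *)
Lemma half_passage_linear c y :
  0 < y -> left_passage c 0 0 y PI (- exp (c * PI) * y).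
Proof.
  intros Hy. pose proof PI_RGT_0. split; [lra|]. split.
  - intros t Ht. unfold flow; cbn [fst snd].
    assert (0 < sin t) by (apply sin_pos_0_PI; lra).
    assert (0 < exp (c * t) * (y * sin t))
      by (apply Rmult_lt_0_compat; [apply exp_pos | now apply Rmult_lt_0_compat]).
    nra.
  - unfold flow; cbn [fst snd]. rewrite sin_PI, cos_PI. f_equal; ring.
Qed.

Lemma ret_height_increasing_left c a b : 0 < a -> a < b -> b < PI -> ret_height c a < ret_height c b.
Proof.
  intros Ha Hab Hb. apply ret_height_increasing; [exact Hab|]. intros t Ht. split.
  - apply Rgt_not_eq, sin_pos_0_PI; lra.
  - apply ret_num_pos; lra.
Qed.

Lemma ret_height_increasing_right c tm a b :
  focus_domain c tm -> PI < a -> a < b -> b < tm -> ret_height c a < ret_height c b.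
Proof.
  intros [Htm Hee] Ha Hab Hb. pose proof PI_RGT_0.
  apply ret_height_increasing; [exact Hab|]. intros t Ht. split.
  - apply Rlt_not_eq, sin_neg_PI_2PI; lra.
  - apply Hee; lra.
Qed.

Lemma ret_height_pos c t : 0 < t < PI -> 0 < ret_height c t.
Proof.
  intros Ht. apply Rdiv_lt_0_compat; [apply ret_num_pos; lra | now apply sin_pos_0_PI].
Qed.

Lemma ret_height_neg c tm t : focus_domain c tm -> PI < t < tm -> ret_height c t < 0.
Proof.
  intros [Htm Hee] Ht. pose proof PI_RGT_0.
  apply Rmult_pos_neg; [apply Hee; lra|].
  apply Rinv_lt_0_compat, sin_neg_PI_2PI; lra.
Qed.

Lemma focus_domain_opp c tm : focus_domain c tm -> focus_domain (- c) tm.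
Proof.
  intros [H1 H2]. split; [exact H1|]. intros t Ht. rewrite Ropp_involutive.
  destruct (H2 t Ht). now split.
Qed.

Lemma ret_height_intermediate c a b v :
  a < b -> (forall t, a <= t <= b -> sin t <> 0) -> ret_height c a < v < ret_height c b ->
  exists t, a < t < b /\ ret_height c t = v.
Proof.
  intros Hab Hs Hv.
  destruct (IVT_interv (fun t => ret_height c t - v) a b) as [t [Ht E]]; try lra.
  - intros t Ht. apply continuity_pt_filterlim.
    apply (continuous_minus (ret_height c) (fun _ => v)); [|apply continuous_const].
    now apply ret_height_continuous, Hs.
  - exists t. split; [|lra].
    split; apply Rnot_le_lt; intros N.
    + replace t with a in E by lra. lra.
    + replace t with b in E by lra. lra.
Qed.

(* The orbit leaving [(0, y)] to the left and the one reaching it from the right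
   have the same ends, for [b = beta * kap / 2], [xL = kap] and [xR = lam * kap]. *)
Definition closing (g h lam beta T T' : R) : Prop :=
  ret_height (- g) T + lam * ret_height (- h) T' = beta /\ ret_height g T + lam * ret_height h T' = - beta.

(** [PL] and [PR] keep the flight times in windows around [T] and [T']; monotone heights turn these
    into windows of heights of size [e], and uniqueness of the closing solution becomes [ir_unique].
    The bound [a] on left flights also bounds the durations from below. The final clause singles out
    the one crossing at positive height, by which cycles are told apart. *)
Lemma closing_limit_cycle g h lam beta kap a T a2 T' tm :
  g <> 0 -> h <> 0 -> 0 < lam -> 0 < kap -> 0 < a < T -> T < a2 < PI -> PI < T' < tm ->
  focus_domain h tm -> closing g h lam beta T T' ->
  (forall S S', a < S < a2 -> PI < S' < tm -> closing g h lam beta S S' -> S = T) ->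
  let b := beta * kap / 2 in
  let y := kap * ret_height (- g) T - b in
  exists C, limit_cycle (- g, h, b, kap, lam * kap) C /\ C (0, y) /\
    forall p, C p -> fst p = 0 -> snd p <= 0 \/ p = (0, y).
Proof.
  intros Hg Hh Hlam Hkap Ha Ha2 HT' Hdom [E1 E2] Huniq b Y0.
  pose proof PI_RGT_0 as Hpi.
  assert (Hdom' := focus_domain_opp _ _ Hdom).
  assert (Hlk : 0 < lam * kap) by (apply Rmult_lt_0_compat; assumption).
  set (Y1 := - kap * ret_height g T - b).
  set (a' := (PI + T') / 2). set (a2' := (T' + tm) / 2).
  assert (Ha' : PI < a' < T' /\ T' < a2' < tm) by (unfold a', a2'; lra).
  set (PL := fun y S y1 => a < S < a2 /\ y = kap * ret_height (- g) S - b /\ y1 = - kap * ret_height g S - b).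
  set (PR := fun y1 S y2 => a' < S < a2' /\
     y1 = lam * kap * ret_height h S + b /\ y2 = - (lam * kap) * ret_height (- h) S + b).
  assert (F1 : Y0 = - (lam * kap) * ret_height (- h) T' + b).
  { unfold Y0, b. rewrite <- E1. field. }
  assert (F2 : Y1 = lam * kap * ret_height h T' + b).
  { unfold Y1, b. replace beta with (- (ret_height g T + lam * ret_height h T')) by lra. field. }
  pose proof (ret_height_pos (- g) T ltac:(lra)) as P1. pose proof (ret_height_pos g T ltac:(lra)) as P2.
  pose proof (ret_height_neg _ _ T' Hdom ltac:(lra)) as P3.
  pose proof (ret_height_neg _ _ T' Hdom' ltac:(lra)) as P4.
  (* The closing equations give each end height two expressions, one around each focus; one yields
     the bound by [b], the other the bound by [- b]. *)
  assert (BY0 : Rabs b < Y0) by (apply Rabs_def1; [rewrite F1 | unfold Y0]; nra).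
  assert (BY1 : Rabs b < - Y1) by (apply Rabs_def1; [unfold Y1 | rewrite F2]; nra).
  assert (G1 : ret_height (- g) a < ret_height (- g) T) by (apply ret_height_increasing_left; lra).
  assert (G2 : ret_height (- g) T < ret_height (- g) a2) by (apply ret_height_increasing_left; lra).
  assert (G3 : ret_height h a' < ret_height h T') by (apply (ret_height_increasing_right _ tm); auto; lra).
  assert (G4 : ret_height h T' < ret_height h a2') by (apply (ret_height_increasing_right _ tm); auto; lra).
  assert (exists e, 0 < e /\ e <= Y0 - Rabs b /\ e <= - Y1 - Rabs b /\
     e <= kap * (ret_height (- g) T - ret_height (- g) a) /\ e <= kap * (ret_height (- g) a2 - ret_height (- g) T) /\
     e <= lam * kap * (ret_height h T' - ret_height h a') /\ e <= lam * kap * (ret_height h a2' - ret_height h T'))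
    as [e [He [e1 [e2 [e3 [e4 [e5 e6]]]]]]].
  { assert (Min : forall x y, 0 < x -> 0 < y -> exists e, 0 < e /\ e <= x /\ e <= y).
    { intros x y Hx Hy. exists (Rmin x y). split; [now apply Rmin_glb_lt|].
      split; [apply Rmin_l | apply Rmin_r]. }
    destruct (Min (Y0 - Rabs b) (- Y1 - Rabs b)) as [r1 R1]; [lra | lra |].
    destruct (Min (kap * (ret_height (- g) T - ret_height (- g) a)) (kap * (ret_height (- g) a2 - ret_height (- g) T)))
      as [r2 R2]; [apply Rmult_lt_0_compat; lra | apply Rmult_lt_0_compat; lra |].
    destruct (Min (lam * kap * (ret_height h T' - ret_height h a')) (lam * kap * (ret_height h a2' - ret_height h T')))
      as [r3 R3]; [apply Rmult_lt_0_compat; lra | apply Rmult_lt_0_compat; lra |].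
    destruct (Min r1 r2) as [r4 R4]; [lra | lra |].
    destruct (Min r4 r3) as [r5 R5]; [lra | lra |].
    exists r5. lra. }
  assert (IR : isolated_return (- g) h b kap (lam * kap) Y0 Y1 e a PL PR).
  { assert (DomL : focus_domain (- g) PI).
    { split; [lra|]. intros t Ht. split; apply ret_num_pos; lra. }
    constructor; try lra.
    - intros y S y1 [HS [-> ->]]. split; [|split; [lra|]].
      + assert (K := half_passage (- g) b kap S PI DomL ltac:(left; lra)).
        rewrite Ropp_involutive in K. exact K.
      + pose proof (ret_height_pos g S ltac:(lra)). nra.
    - intros y1 S y2 [HS [-> ->]]. split; [|split; [lra|]].
      + assert (K := half_passage h b (- (lam * kap)) S tm Hdom ltac:(right; lra)).
        replace (- (lam * kap * ret_height h S + b)) with (- (lam * kap) * ret_height h S - b) by ring.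
        replace (- (- (lam * kap) * ret_height (- h) S + b))
          with (- - (lam * kap) * ret_height (- h) S - b) by ring. exact K.
      + pose proof (ret_height_neg _ _ S Hdom' ltac:(lra)). nra.
    - intros y Hy. apply Rabs_def2 in Hy.
      destruct (ret_height_intermediate (- g) a a2 ((y + b) / kap)) as [S [HS ES]]; [lra| | |].
      + intros t Ht. apply Rgt_not_eq, sin_pos_0_PI; lra.
      + unfold Y0 in Hy. split;
          [apply (Rlt_div_r (ret_height (- g) a)) | apply (Rlt_div_l _ (ret_height (- g) a2))]; lra.
      + exists S, (- kap * ret_height g S - b). split; [exact HS|]. split; [|reflexivity].
        rewrite ES. field. lra.
    - intros y Hy. apply Rabs_def2 in Hy.
      destruct (ret_height_intermediate h a' a2' ((y - b) / (lam * kap))) as [S [HS ES]]; [lra| | |].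
      + intros t Ht. destruct Hdom as [Htm _]. apply Rlt_not_eq, sin_neg_PI_2PI; lra.
      + rewrite F2 in Hy. split;
          [apply (Rlt_div_r (ret_height h a')) | apply (Rlt_div_l _ (ret_height h a2'))]; lra.
      + exists S, (- (lam * kap) * ret_height (- h) S + b). split; [exact HS|]. split; [|reflexivity].
        rewrite ES. field. lra.
    - intros y S y1 y' S' y1' [HS [-> ->]] [HS' [-> ->]] Hlt.
      assert (ret_height (- g) S < ret_height (- g) S') by nra.
      assert (S < S').
      { destruct (Rtotal_order S S') as [|[->|]]; [assumption | lra |].
        pose proof (ret_height_increasing_left (- g) S' S). lra. }
      pose proof (ret_height_increasing_left g S S'). nra.
    - intros y S y1 y' S' y1' [HS [-> ->]] [HS' [-> ->]] Hlt.
      assert (ret_height h S < ret_height h S') by nra.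
      assert (S < S').
      { destruct (Rtotal_order S S') as [|[->|]]; [assumption | lra |].
        pose proof (ret_height_increasing_right h tm S' S Hdom). lra. }
      pose proof (ret_height_increasing_right (- h) tm S S' Hdom'). nra.
    - intros y S y1 S' [HS [Ey Ey1]] [HS' [Ey1' Ey']].
      assert (S = T) as ->; [|exact Ey].
      apply (Huniq S S'); [lra | lra |].
      assert (Hb : b = beta * kap / 2) by reflexivity. split.
      + apply Rmult_eq_reg_l with kap; [|lra]. lra.
      + apply Rmult_eq_reg_l with kap; [|lra]. lra. }
  destruct (isolated_return_limit_cycle _ _ _ _ _ _ _ _ _ _ _ T T'
     (Ropp_neq_0_compat _ Hg) Hh IR) as [C [HC [C0 CL]]].
  - split; [lra | split; reflexivity].
  - split; [lra | split; assumption].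
  - exists C. split; [exact HC|]. split; [exact C0|].
    intros p Hp Hx. destruct (CL p Hp Hx) as [-> | ->]; [now right | left].
    simpl. pose proof (Rabs_pos b). lra.
Qed.

(** * The center *)

(** [E t * exp (- L t)] does not increase and [E t * exp (L t)] does not decrease; starting from 0,
    the first settles [t >= 0] and the second [t < 0]. *)
Lemma gronwall_zero (E E' : R -> R) L :
  (forall t, is_derive E t (E' t)) -> (forall t, 0 <= E t) ->
  (forall t, Rabs (E' t) <= L * E t) -> E 0 = 0 -> forall t, E t = 0.
Proof.
  intros D Pos B E0 t.
  assert (DM : forall M s, is_derive (fun s => E s * exp (M * s)) s
     ((E' s + M * E s) * exp (M * s))).
  { intros M s. evar_last.
    - apply (is_derive_mult E (fun s => exp (M * s)) s (E' s) (M * exp (M * s)));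
        [apply D | auto_derive; auto; ring | intros; apply Rmult_comm].
    - unfold plus, mult; simpl. ring. }
  assert (MVT : forall M, exists c, E t * exp (M * t) = (E' c + M * E c) * exp (M * c) * t).
  { intros M. destruct (MVT_gen (fun s => E s * exp (M * s)) 0 t
      (fun s => (E' s + M * E s) * exp (M * s))) as [c [_ Hc]].
    - intros s _. apply DM.
    - intros s _. apply continuity_pt_filterlim.
      exact (is_derive_continuous _ _ _ (DM M s)).
    - exists c. rewrite E0 in Hc. lra. }
  apply Rle_antisym; [|apply Pos].
  assert (Sgn : exists M, E t * exp (M * t) <= 0).
  { destruct (Rle_or_lt 0 t) as [Ht|Ht].
    - exists (- L). destruct (MVT (- L)) as [c ->].
      specialize (B c). apply Rabs_le_between in B. pose proof (exp_pos (- L * c)).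
      assert ((E' c + - L * E c) * exp (- L * c) <= 0) by nra. nra.
    - exists L. destruct (MVT L) as [c ->].
      specialize (B c). apply Rabs_le_between in B. pose proof (exp_pos (L * c)).
      assert (0 <= (E' c + L * E c) * exp (L * c)) by (apply Rmult_le_pos; lra). nra. }
  destruct Sgn as [M HM]. pose proof (exp_pos (M * t)).
  destruct (Rle_or_lt (E t) 0) as [|Hp]; [assumption|]. nra.
Qed.

(** For these parameters the two fields agree on the line, so the Filippov set is a single vector
    and the system is classical, with [|x|] in place of the switch. *)
Lemma center_field eta z t :
  solution (- eta, eta, 0, 0, 0) z ->
  is_derive (fun s => fst (z s)) t (2 * eta * Rabs (fst (z t)) - snd (z t)) /\
  is_derive (fun s => snd (z s)) t ((1 + eta ^ 2) * fst (z t)).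
Proof.
  intros H.
  assert (F : forall v, filippov (- eta, eta, 0, 0, 0) (z t) v ->
     v = (2 * eta * Rabs (fst (z t)) - snd (z t), (1 + eta ^ 2) * fst (z t))).
  { intros v. destruct (z t) as [x y]. unfold filippov. cbn [fst snd].
    rewrite left_field_eq, right_field_eq. intros [H1 [H2 H3]].
    destruct (Rtotal_order x 0) as [Hx|[Hx|Hx]].
    - rewrite (H1 Hx), Rabs_left by lra. f_equal; ring.
    - destruct (H3 Hx) as [s [_ ->]]. subst x. rewrite Rabs_R0.
      unfold plus, scal; simpl. unfold prod_plus, prod_scal, plus, scal, mult; simpl.
      unfold mult; simpl. f_equal; ring.
    - rewrite (H2 Hx), Rabs_pos_eq by lra. f_equal; ring. }
  destruct (H t) as [[v [Hv Lv]] [w [Hw Lw]]].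
  rewrite (F v Hv) in Lv. rewrite (F w Hw) in Lw.
  apply diff_quot_coords in Lv; [|apply at_left_proper_filter].
  apply diff_quot_coords in Lw; [|apply at_right_proper_filter].
  split; apply is_derive_sides; cbn [fst snd] in *; tauto.
Qed.

(** The field is Lipschitz because [| |x1| - |x2| | <= |x1 - x2|], so the squared distance satisfies
    [gronwall_zero]. A center requires every solution through a far point to be periodic, hence
    uniqueness. *)
Lemma center_uniqueness eta z1 z2 :
  solution (- eta, eta, 0, 0, 0) z1 -> solution (- eta, eta, 0, 0, 0) z2 ->
  z1 0 = z2 0 -> forall t, z1 t = z2 t.
Proof.
  intros H1 H2 E0.
  set (x1 := fun t => fst (z1 t)). set (y1 := fun t => snd (z1 t)).
  set (x2 := fun t => fst (z2 t)). set (y2 := fun t => snd (z2 t)).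
  assert (D1 : forall t, is_derive x1 t (2 * eta * Rabs (x1 t) - y1 t) /\
    is_derive y1 t ((1 + eta ^ 2) * x1 t)) by (intros t; exact (center_field _ _ t H1)).
  assert (D2 : forall t, is_derive x2 t (2 * eta * Rabs (x2 t) - y2 t) /\
    is_derive y2 t ((1 + eta ^ 2) * x2 t)) by (intros t; exact (center_field _ _ t H2)).
  assert (I : x1 0 = x2 0 /\ y1 0 = y2 0) by (unfold x1, x2, y1, y2; now rewrite E0).
  assert (G : forall t, x1 t = x2 t /\ y1 t = y2 t).
  { clearbody x1 x2 y1 y2. intros t.
    set (E := fun t => (x1 t - x2 t) * (x1 t - x2 t) + (y1 t - y2 t) * (y1 t - y2 t)).
    set (E' := fun t => 2 * (x1 t - x2 t) * (2 * eta * (Rabs (x1 t) - Rabs (x2 t)) - (y1 t - y2 t))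
       + 2 * (y1 t - y2 t) * ((1 + eta ^ 2) * (x1 t - x2 t))).
    assert (E t = 0).
    { apply (gronwall_zero E E' (4 * Rabs eta + (2 + eta ^ 2))).
      - intros s. destruct (D1 s) as [A1 B1], (D2 s) as [A2 B2].
        unfold E, E'. auto_derive; [repeat split; eexists; eassumption|].
        rewrite (is_derive_unique (fun v : R => x1 v) s _ A1),
          (is_derive_unique (fun v : R => x2 v) s _ A2),
          (is_derive_unique (fun v : R => y1 v) s _ B1),
          (is_derive_unique (fun v : R => y2 v) s _ B2). ring.
      - intros s. apply Rplus_le_le_0_compat; apply Rle_0_sqr.
      - intros s. unfold E, E'.
        set (u := x1 s - x2 s). set (v := y1 s - y2 s).
        set (r := Rabs (x1 s) - Rabs (x2 s)).
        assert (Hr : Rabs r <= Rabs u) by apply Rabs_triang_inv2.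
        replace (2 * u * (2 * eta * r - v) + 2 * v * ((1 + eta ^ 2) * u))
          with (4 * (eta * (u * r)) + 2 * eta ^ 2 * (u * v)) by ring.
        apply Rle_trans with (Rabs (4 * (eta * (u * r))) + Rabs (2 * eta ^ 2 * (u * v)));
          [apply Rabs_triang|].
        rewrite !Rabs_mult, (Rabs_pos_eq 4), (Rabs_pos_eq 2), (Rabs_pos_eq (eta ^ 2)) by nra.
        rewrite <- (Rabs_pos_eq (u * u)), <- (Rabs_pos_eq (v * v)) by nra.
        rewrite !Rabs_mult.
        pose proof (Rabs_pos u); pose proof (Rabs_pos v); pose proof (Rabs_pos eta).
        assert (Rabs u * Rabs r <= Rabs u * Rabs u) by (apply Rmult_le_compat_l; assumption).
        assert (Rabs eta * (Rabs u * Rabs r) <= Rabs eta * (Rabs u * Rabs u))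
          by (apply Rmult_le_compat_l; assumption).
        assert (2 * (Rabs u * Rabs v) <= Rabs u * Rabs u + Rabs v * Rabs v).
        { pose proof (Rle_0_sqr (Rabs u - Rabs v)). unfold Rsqr in *. lra. }
        assert (eta ^ 2 * (2 * (Rabs u * Rabs v)) <= eta ^ 2 * (Rabs u * Rabs u + Rabs v * Rabs v))
          by (apply Rmult_le_compat_l; [nra | assumption]).
        assert (0 <= Rabs eta * (Rabs v * Rabs v)) by (repeat apply Rmult_le_pos; assumption).
        assert (0 <= Rabs u * Rabs u) by (apply Rmult_le_pos; assumption).
        assert (0 <= Rabs v * Rabs v) by (apply Rmult_le_pos; assumption).
        lra.
      - unfold E. destruct I as [-> ->]. ring. }
    destruct (Rplus_sqr_eq_0 _ _ H). lra. }
  intros t. destruct (G t) as [Gx Gy]. apply injective_projections; assumption.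
Qed.

Lemma solution_time_shift m z s : solution m z -> solution m (fun t => z (t + s)).
Proof.
  intros H t.
  assert (E : forall h, diff_quot z (t + s) h = diff_quot (fun t => z (t + s)) t h).
  { intros h. unfold diff_quot. now replace (t + s + h) with (t + h + s) by ring. }
  destruct (H (t + s)) as [[v [Hv Lv]] [w [Hw Lw]]]. split.
  - exists v. split; [exact Hv|]. exact (filterlim_ext _ _ E Lv).
  - exists w. split; [exact Hw|]. exact (filterlim_ext _ _ E Lw).
Qed.

(* Each point of the closed left half-plane lies on the half-orbit of a point
   [(0, y)] with [y > 0]: polar coordinates in the plane [(x, c x - y)]. *)
Lemma linear_focus_sweeps_left c x0 y0 :
  x0 <= 0 -> (x0, y0) <> (0, 0) ->
  exists y t, 0 < y /\ 0 <= t <= PI /\ flow c 0 0 (0, y) t = (x0, y0).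
Proof.
  intros Hx Hp. set (w := c * x0 - y0).
  assert (Hpos : 0 < x0 * x0 + w * w).
  { destruct (Req_dec x0 0) as [E|N].
    - assert (y0 <> 0) by (intros E'; apply Hp; now rewrite E, E').
      unfold w. rewrite E. nra.
    - assert (0 < x0 * x0) by nra. nra. }
  set (r := sqrt (x0 * x0 + w * w)).
  assert (Hr : 0 < r) by now apply sqrt_lt_R0.
  assert (Hr2 : r * r = x0 * x0 + w * w) by (apply sqrt_sqrt; lra).
  (* From [(0, y)] the flow is [x = - r sin t], [w = - r cos t] with [r = y exp (c t)]; hence the
     time [acos q] and the height [r exp (- c t)] below. *)
  set (q := - w / r).
  assert (Hq2 : q * q = 1 - (x0 / r) * (x0 / r)).
  { unfold q. replace 1 with (r * r / (r * r)) by (field; lra).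
    rewrite Hr2 at 1. field. lra. }
  assert (Hq : -1 <= q <= 1).
  { assert (0 <= (x0 / r) * (x0 / r)) by apply Rle_0_sqr. split; nra. }
  exists (r * exp (- c * acos q)), (acos q).
  split; [apply Rmult_lt_0_compat; [exact Hr | apply exp_pos]|].
  split; [apply acos_bound|].
  assert (Ec : cos (acos q) = q) by (apply cos_acos; exact Hq).
  assert (Es : sin (acos q) = - x0 / r).
  { rewrite sin_acos by exact Hq. apply sqrt_lem_1.
    - unfold Rsqr. rewrite Hq2. assert (0 <= (x0 / r) * (x0 / r)) by apply Rle_0_sqr. lra.
    - apply Rdiv_le_0_compat; lra.
    - unfold Rsqr. rewrite Hq2. field. lra. }
  unfold flow; cbn [fst snd]. rewrite Ec, Es.
  pose proof (exp_opp_mul c (acos q)) as H.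
  set (p := exp (c * acos q)) in *. set (p' := exp (- c * acos q)) in *.
  replace (p * ((0 - 0) * q + (c * (0 - 0) + 2 * c * 0 - 0 - r * p') * (- x0 / r)))
    with (p * p' * x0) by (field; lra).
  replace (p * ((c * (0 - 0) + 2 * c * 0 - 0 - r * p') * q - (0 - 0) * (- x0 / r)))
    with (p * p' * w) by (unfold q; field; lra).
  rewrite H. unfold w. f_equal; ring.
Qed.

(** The left half-turn multiplies heights by [- exp (- eta PI)] and the right one by
    [- exp (eta PI)]: the product is 1 and every orbit closes. Points with [x > 0] follow by
    reflection, with [- eta] for [eta]. *)
Lemma center_orbit eta p :
  p <> (0, 0) ->
  exists z, solution (- eta, eta, 0, 0, 0) z /\ z 0 = p /\ periodic z.
Proof.
  assert (Left : forall eta x0 y0, x0 <= 0 -> (x0, y0) <> (0, 0) ->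
     exists z, solution (- eta, eta, 0, 0, 0) z /\ z 0 = (x0, y0) /\ periodic z).
  { clear. intros eta x0 y0 Hx Hp.
    destruct (linear_focus_sweeps_left (- eta) x0 y0 Hx Hp) as [y [t [Hy [Ht E]]]].
    pose proof PI_RGT_0 as Hpi.
    set (y1 := - exp (- eta * PI) * y).
    assert (Hy1 : 0 < - y1).
    { unfold y1. pose proof (exp_pos (- eta * PI)). nra. }
    assert (P1 := half_passage_linear (- eta) y Hy).
    assert (P2 := half_passage_linear eta (- y1) Hy1).
    fold y1 in P1.
    replace (- exp (eta * PI) * - y1) with (- y) in P2.
    2:{ unfold y1. transitivity (- (exp (eta * PI) * exp (- eta * PI)) * y);
        [rewrite exp_opp_mul|]; ring. }
    rewrite <- (Ropp_0) in P2 at 2.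
    destruct (solution_of_passages (- eta) eta 0 0 0 y y1 PI PI P1 P2)
      as [z [Hz [Hper [ZL _]]]].
    exists (fun s => z (s + t)). split; [now apply solution_time_shift|].
    split.
    - rewrite Rplus_0_l, ZL by exact Ht. exact E.
    - split.
      + rewrite Rplus_0_l.
        assert (z0 : z 0 = (0, y)) by (rewrite ZL by lra; apply flow_0).
        assert (z1 : z PI = (0, y1)) by (rewrite ZL by lra; apply P1).
        (* The orbit contains [(0, y)] and [(0, y1)], which differ, so one of them differs from
           [z t]. *)
        destruct (Classical_Prop.classic (z t = (0, y))) as [K|K].
        * exists (PI - t). replace (PI - t + t) with PI by ring.
          rewrite z1, K. intros F; injection F. lra.
        * exists (- t). rewrite Rplus_opp_l, z0. congruence.
      + exists (PI + PI). split; [lra|]. intros s. rewrite <- (Hper (s + t)). f_equal; ring. }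
  intros Hp. destruct p as [x0 y0]. destruct (Rle_or_lt x0 0) as [Hx|Hx]; [now apply Left|].
  destruct (Left (- eta) (- x0) (- y0)) as [z [Hz [z0 Pz]]]; [lra | |].
  - intros E. injection E. lra.
  - exists (fun t => antipode (z t)). split; [|split].
    + apply solution_mirror in Hz. unfold mirror in Hz.
      now rewrite Ropp_involutive, Ropp_0 in Hz.
    + rewrite z0. unfold antipode; simpl. now rewrite !Ropp_involutive.
    + now apply periodic_mirror.
Qed.

Lemma center eta : center_at_infinity (- eta, eta, 0, 0, 0).
Proof.
  exists 0. intros p Hp.
  assert (Np : p <> (0, 0)).
  { intros ->. change ((0, 0) : R * R) with (zero : prod_NormedModule _ R_NormedModule R_NormedModule) in Hp.
    rewrite norm_zero in Hp. lra. }
  destruct (center_orbit eta p Np) as [z [Hz [z0 Pz]]].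
  split; [now exists z|]. intros z' Hz' z0'.
  assert (E : forall t, z' t = z t) by (apply (center_uniqueness eta); congruence || assumption).
  destruct Pz as [[t N] [T [HT P]]]. split.
  - exists t. now rewrite !E.
  - exists T. split; [exact HT|]. intros s. now rewrite !E.
Qed.

(** * Monotone pieces and local inverses of C1 functions *)

(** [p] is the supremum of the points where [f <= u]. *)
Lemma last_crossing (f : R -> R) a b u :
  a < b -> (forall t, a <= t <= b -> continuous f t) -> f a <= u < f b ->
  exists p, a <= p < b /\ f p = u /\ forall t, p < t <= b -> u < f t.
Proof.
  intros Hab Hc Hu.
  set (A := fun t => a <= t <= b /\ f t <= u).
  destruct (completeness A) as [p [Hub Hlub]].
  { exists b. intros t [Ht _]. lra. }
  { exists a. unfold A. lra. }
  assert (Hap : a <= p) by (apply Hub; unfold A; lra).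
  assert (Hpb : p <= b) by (apply Hlub; intros t [Ht _]; lra).
  assert (Near : forall eps, 0 < eps -> exists d, 0 < d /\
      forall t, Rabs (t - p) < d -> Rabs (f t - f p) < eps).
  { intros eps He.
    destruct (proj1 (filterlim_locally _ _) (Hc p (conj Hap Hpb)) (mkposreal eps He)) as [d Hd].
    exists d. split; [apply cond_pos | exact Hd]. }
  assert (Hfp : f p <= u).
  { apply Rnot_lt_le. intros N. destruct (Near (f p - u)) as [d [Hd Nd]]; [lra|].
    assert (p <= p - d / 2); [|lra]. apply Hlub. intros t [Ht Hft].
    apply Rnot_lt_le. intros Hlt. assert (t <= p) by (apply Hub; split; assumption).
    specialize (Nd t). rewrite Rabs_left1 in Nd by lra. specialize (Nd ltac:(lra)).
    apply Rabs_def2 in Nd. lra. }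
  assert (Hpb' : p < b).
  { destruct (Rle_lt_or_eq_dec p b Hpb) as [| ->]; lra. }
  assert (Above : forall t, p < t <= b -> u < f t).
  { intros t Ht. apply Rnot_le_lt. intros N. assert (t <= p); [|lra].
    apply Hub. split; lra. }
  exists p. split; [lra|]. split; [|exact Above].
  apply Rle_antisym; [exact Hfp|]. apply Rnot_lt_le. intros N.
  destruct (Near (u - f p)) as [d [Hd Nd]]; [lra|].
  set (t := Rmin (p + d / 2) b).
  assert (p < t <= b) by (unfold t; split; [apply Rmin_glb_lt; lra | apply Rmin_r]).
  assert (t <= p + d / 2) by apply Rmin_l.
  specialize (Above t H). specialize (Nd t). rewrite Rabs_pos_eq in Nd by lra.
  specialize (Nd ltac:(lra)). apply Rabs_def2 in Nd. lra.
Qed.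

(** A monotone piece is found without knowing that any zero is simple: between the last passage at
    [u] and the next arrival at [v], the mean value theorem gives a point with positive derivative,
    and continuity of [f'] spreads this to an interval. *)
Lemma increasing_crossing (f f' : R -> R) a b u v :
  a < b -> (forall t, a <= t <= b -> is_derive f t (f' t) /\ continuous f' t) ->
  f a <= u -> u < v -> v <= f b ->
  exists p q, a < p /\ p < q /\ q < b /\ u < f p /\ f q < v /\
    forall s t, p <= s -> s < t -> t <= q -> f s < f t.
Proof.
  intros Hab Hd Hu Huv Hv.
  assert (Hc : forall t, a <= t <= b -> continuous f t).
  { intros t Ht. eapply is_derive_continuous, Hd, Ht. }
  destruct (last_crossing f a b u) as [p0 [Hp0 [Fp0 Ap0]]]; [lra | exact Hc | lra |].
  (* Reversing time and sign turns the first arrival at [v] after [p0] into a last crossing. *)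
  destruct (last_crossing (fun t => - f (- t)) (- b) (- p0) (- v)) as [q0 [Hq0 [Fq0 Aq0]]];
    [lra | | rewrite !Ropp_involutive; lra |].
  { intros t Ht. apply (continuous_opp (fun t => f (- t))).
    apply (continuous_comp Ropp f); [|apply Hc; lra].
    apply (is_derive_continuous (fun t => - t) t (-1)). auto_derive; auto; ring. }
  set (q := - q0). assert (Hq : p0 < q <= b) by (unfold q; lra).
  assert (Fq : f q = v) by (unfold q; lra).
  assert (Below : forall t, p0 <= t < q -> f t < v).
  { intros t Ht. specialize (Aq0 (- t)). rewrite Ropp_involutive in Aq0.
    specialize (Aq0 ltac:(unfold q in *; lra)). lra. }
  destruct (MVT_cor2 f f' p0 q) as [c [Hc1 Hc2]]; [lra| |].
  { intros t Ht. apply is_derive_Reals, Hd. lra. }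
  assert (Fc : 0 < f' c).
  { apply Rnot_le_lt. intros N. nra. }
  destruct (Hd c ltac:(lra)) as [_ Cc].
  destruct (proj1 (filterlim_locally _ _) Cc (mkposreal _ Fc)) as [d Hd'].
  set (r := Rmin (d / 2) (Rmin ((c - p0) / 2) ((q - c) / 2))).
  assert (Hdp : 0 < d) by apply cond_pos.
  assert (Hr : 0 < r) by (unfold r; repeat apply Rmin_glb_lt; lra).
  assert (r <= d / 2) by apply Rmin_l.
  assert (r <= (c - p0) / 2) by (unfold r; eapply Rle_trans; [apply Rmin_r | apply Rmin_l]).
  assert (r <= (q - c) / 2) by (unfold r; eapply Rle_trans; [apply Rmin_r | apply Rmin_r]).
  exists (c - r), (c + r). repeat split; try lra.
  - apply Ap0; lra.
  - apply Below; lra.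
  - intros s t Hs Hst Ht.
    destruct (MVT_cor2 f f' s t) as [x [Hx1 Hx2]]; [lra| |].
    { intros x Hx. apply is_derive_Reals, Hd. lra. }
    assert (0 < f' x).
    { specialize (Hd' x). change (Rabs (x - c) < d -> Rabs (f' x - f' c) < f' c) in Hd'.
      assert (K : Rabs (x - c) < d) by (apply Rabs_def1; lra).
      specialize (Hd' K). apply Rabs_def2 in Hd'. lra. }
    nra.
Qed.

Lemma decreasing_on (f f' : R -> R) a b :
  (forall t, a <= t <= b -> is_derive f t (f' t) /\ f' t < 0) ->
  forall s t, a <= s -> s < t -> t <= b -> f t < f s.
Proof.
  intros Hd s t Hs Hst Ht.
  destruct (MVT_cor2 f f' s t) as [c [Hc1 Hc2]]; [lra| |].
  - intros c Hc. apply is_derive_Reals, Hd. lra.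
  - destruct (Hd c ltac:(lra)) as [_ K]. nra.
Qed.

Lemma inverse_derive (f f' : R -> R) a b :
  a < b -> (forall t, a <= t <= b -> is_derive f t (f' t) /\ f' t < 0) ->
  exists r : R -> R, forall y, f b < y < f a ->
    a < r y < b /\ f (r y) = y /\ is_derive r y (/ f' (r y)).
Proof.
  intros Hab Hd.
  assert (Dec := decreasing_on f f' a b Hd).
  (* An informative existence, from which the function [r] is read off; outside the range its value
     is the default [a]. *)
  assert (Ex : forall y, {t | f b < y < f a -> a < t < b /\ f t = y}).
  { intros y. destruct (Rlt_dec (f b) y) as [Hy1|N]; [|exists a; lra].
    destruct (Rlt_dec y (f a)) as [Hy2|N]; [|exists a; lra].
    destruct (IVT_interv (fun t => y - f t) a b) as [t [Ht E]]; try lra.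
    - intros t Ht. apply continuity_pt_filterlim.
      apply (continuous_minus (fun _ => y) f); [apply continuous_const|].
      eapply is_derive_continuous, Hd, Ht.
    - exists t. intros _. split; [|lra].
      split; apply Rnot_le_lt; intros N.
      + replace t with a in E by lra. lra.
      + replace t with b in E by lra. lra. }
  set (r := fun y => proj1_sig (Ex y)).
  assert (Hr : forall y, f b < y < f a -> a < r y < b /\ f (r y) = y)
    by (intros y; exact (proj2_sig (Ex y))).
  clearbody r. exists r. intros y Hy. destruct (Hr y Hy) as [Hry Ery].
  split; [exact Hry|]. split; [exact Ery|].
  set (t := r y) in *.
  assert (Cont : forall eps, 0 < eps -> exists d, 0 < d /\
     forall h, Rabs h < d -> f b < y + h < f a /\ Rabs (r (y + h) - t) < eps).
  { intros eps He. set (e := Rmin (eps / 2) (Rmin ((t - a) / 2) ((b - t) / 2))).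
    assert (0 < e) by (unfold e; repeat apply Rmin_glb_lt; lra).
    assert (e <= eps / 2) by apply Rmin_l.
    assert (e <= (t - a) / 2) by (unfold e; eapply Rle_trans; [apply Rmin_r | apply Rmin_l]).
    assert (e <= (b - t) / 2) by (unfold e; eapply Rle_trans; [apply Rmin_r | apply Rmin_r]).
    assert (f (t + e) < f t) by (apply Dec; lra).
    assert (f t < f (t - e)) by (apply Dec; lra).
    assert (f b < f (t + e)) by (apply Dec; lra).
    assert (f (t - e) < f a) by (apply Dec; lra).
    exists (Rmin (y - f (t + e)) (f (t - e) - y)).
    split; [apply Rmin_glb_lt; lra|]. intros h Hh.
    pose proof (Rmin_l (y - f (t + e)) (f (t - e) - y)).
    pose proof (Rmin_r (y - f (t + e)) (f (t - e) - y)).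
    apply Rabs_def2 in Hh.
    assert (Hyh : f b < y + h < f a) by lra.
    split; [exact Hyh|]. destruct (Hr _ Hyh) as [Hs Es].
    set (s := r (y + h)) in *.
    assert (s < t + e).
    { apply Rnot_le_lt. intros N. destruct (Rle_lt_or_eq_dec _ _ N) as [L|L].
      - assert (f s < f (t + e)) by (apply Dec; lra). lra.
      - rewrite <- L in Es. lra. }
    assert (t - e < s).
    { apply Rnot_le_lt. intros N. destruct (Rle_lt_or_eq_dec _ _ N) as [L|L].
      - assert (f (t - e) < f s) by (apply Dec; lra). lra.
      - rewrite L in Es. lra. }
    apply Rabs_def1; lra. }
  destruct (Hd t ltac:(lra)) as [Df Nf].
  rewrite is_derive_eps in Df. rewrite is_derive_eps. intros eps He.
  set (l := f' t) in *.
  (* With [D] the difference quotient of [f], the error is [(l - D) / (D * l)]. The first bound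
     gives [D <= l / 2 < 0], hence [D * l >= l * l / 2]; the second then brings the error below
     [eps]. *)
  set (e := Rmin (- l / 2) (eps * (l * l) / 2)).
  assert (Hll : 0 < l * l) by nra.
  assert (He1 : 0 < e).
  { unfold e. apply Rmin_glb_lt; [lra|]. assert (0 < eps * (l * l)) by (apply Rmult_lt_0_compat; lra). lra. }
  assert (e <= - l / 2) by apply Rmin_l.
  assert (e <= eps * (l * l) / 2) by apply Rmin_r.
  destruct (Df e He1) as [d1 [Hd1 A1]].
  destruct (Cont d1 Hd1) as [d2 [Hd2 A2]].
  exists d2. split; [exact Hd2|]. intros h Hh Hb.
  destruct (A2 h Hb) as [Hyh Hs]. destruct (Hr _ Hyh) as [_ Es].
  set (k := r (y + h) - t) in *.
  assert (Hk : k <> 0).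
  { intros K. unfold k in K. replace (r (y + h)) with t in Es by lra. lra. }
  specialize (A1 k Hk Hs).
  assert (Eq : dquot f t k = h / k).
  { unfold dquot. replace (t + k) with (r (y + h)) by (unfold k; ring).
    rewrite Es, Ery. f_equal; ring. }
  rewrite Eq in A1. unfold dquot. fold t k.
  set (D := h / k) in *.
  assert (HD : D <= l / 2) by (apply Rabs_def2 in A1; lra).
  replace (k / h - / l) with ((l - D) / (D * l)).
  2:{ unfold D. field. repeat split; try assumption. lra. }
  unfold Rdiv. rewrite Rabs_mult, Rabs_minus_sym, Rabs_inv.
  assert (HDl : l * l / 2 <= D * l) by nra.
  rewrite (Rabs_pos_eq (D * l)) by nra.
  apply (Rlt_div_l (Rabs (D - l)) eps (D * l)); [nra|].
  apply Rlt_le_trans with (1 := A1).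
  apply Rle_trans with (eps * (l * l / 2)); [lra|].
  apply Rmult_le_compat_l; lra.
Qed.

(** * Expansion of the closing equation *)

Definition coord_den (c t : R) : R := exp (c * t) + exp (- c * t) - 2 * cos t.

(* [coord = 2 / (ret_height c + ret_height (- c))] is a coordinate near [t = PI], in which the
   half-return data are given by [skew]. *)
Definition coord (c t : R) : R := 2 * sin t / coord_den c t.

(** Off the zeros of [sin], the difference of [ret_height c] and [ret_height (- c)] divided by their
    sum; unlike the heights it stays finite at [PI]. *)
Definition skew (c t : R) : R := (exp (- c * t) - exp (c * t) + 2 * c * sin t) / coord_den c t.

Definition slope_num (c t : R) : R :=
  (exp (c * t) + exp (- c * t)) * cos t - 2 - c * (exp (c * t) - exp (- c * t)) * sin t.

(** The derivative of [skew c] with respect to [coord c] is [2 c + (1 + c ^ 2) * skew_excess c]. *)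
Definition skew_excess (c t : R) : R := (exp (c * t) - exp (- c * t)) * sin t / slope_num c t.

Lemma coord_den_ret_num c t : coord_den c t = ret_num c t + ret_num (- c) t.
Proof. unfold coord_den, ret_num. rewrite Ropp_involutive. ring. Qed.

Lemma coord_derive c t : coord_den c t <> 0 -> is_derive (coord c) t (2 * slope_num c t / coord_den c t ^ 2).
Proof.
  intros Hd. unfold coord, coord_den in *. auto_derive; [exact Hd|].
  pose proof (sin2_cos2 t) as H2. unfold Rsqr in H2. unfold slope_num.
  set (p := exp (c * t)) in *. set (q := exp (- c * t)) in *.
  set (C := cos t) in *. set (S := sin t) in *.
  transitivity ((2 * C * (p + q - 2 * C) - 2 * S * (c * p - c * q + 2 * S)) /
                (p + q - 2 * C) ^ 2); [field; exact Hd|].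
  unfold Rdiv. f_equal.
  transitivity (2 * (p + q) * C - 4 * (S * S + C * C) - 2 * c * (p - q) * S); [ring|].
  rewrite H2. ring.
Qed.

Definition skew_deriv (c t : R) : R :=
  (4 * c * slope_num c t + 2 * (1 + c ^ 2) * (exp (c * t) - exp (- c * t)) * sin t) / coord_den c t ^ 2.

Lemma skew_derive c t : coord_den c t <> 0 -> is_derive (skew c) t (skew_deriv c t).
Proof.
  intros Hd. unfold skew_deriv, skew, coord_den, slope_num in *. auto_derive; [exact Hd|].
  pose proof (sin2_cos2 t) as H2. unfold Rsqr in H2.
  pose proof (exp_opp_mul c t) as H.
  set (p := exp (c * t)) in *. set (q := exp (- c * t)) in *.
  set (C := cos t) in *. set (S := sin t) in *.
  transitivity (((- c * q - c * p + 2 * c * C) * (p + q - 2 * C)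
                 - (q - p + 2 * c * S) * (c * p - c * q + 2 * S)) /
                (p + q - 2 * C) ^ 2); [field; exact Hd|].
  unfold Rdiv. f_equal.
  transitivity (4 * c * (p + q) * C - 4 * c * (p * q) - 4 * c * (S * S + C * C)
    - 2 * c ^ 2 * (p - q) * S + 2 * (p - q) * S); [ring|].
  rewrite H, H2. ring.
Qed.

Lemma coord_den_PI c : coord_den c PI = exp (c * PI) + exp (- c * PI) + 2.
Proof. unfold coord_den. rewrite cos_PI. ring. Qed.

Lemma slope_num_PI c : slope_num c PI = - (exp (c * PI) + exp (- c * PI) + 2).
Proof. unfold slope_num. rewrite cos_PI, sin_PI. ring. Qed.

Lemma continuous_pos_near (f : R -> R) t :
  continuous f t -> 0 < f t ->
  exists d, 0 < d /\ forall s, Rabs (s - t) < d -> 0 < f s.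
Proof.
  intros Hc Hf. destruct (continuous_neg_near (fun s => - f s) t) as [d [Hd N]]; [|lra|].
  - now apply (continuous_opp f).
  - exists d. split; [exact Hd|]. intros s Hs. specialize (N s Hs). lra.
Qed.

Lemma near_min t (P Q : R -> Prop) :
  (exists d, 0 < d /\ forall s, Rabs (s - t) < d -> P s) ->
  (exists d, 0 < d /\ forall s, Rabs (s - t) < d -> Q s) ->
  exists d, 0 < d /\ forall s, Rabs (s - t) < d -> P s /\ Q s.
Proof.
  intros [d1 [H1 A1]] [d2 [H2 A2]]. exists (Rmin d1 d2).
  split; [now apply Rmin_glb_lt|]. intros s Hs.
  pose proof (Rmin_l d1 d2); pose proof (Rmin_r d1 d2).
  split; [apply A1 | apply A2]; lra.
Qed.

(* The remainder is [sin t] times a function with a double zero at [PI]. *)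
Lemma skew_excess_expansion c :
  0 < c ->
  let s0 := (exp (c * PI) - exp (- c * PI)) / 2 in
  exists j, 0 < j /\ exists d, 0 < d /\ forall t, Rabs (t - PI) < d ->
    0 < coord_den c t /\ slope_num c t < 0 /\ 0 < ret_num c t /\ 0 < ret_num (- c) t /\
    Rabs (skew_excess c t + s0 * coord c t - j * coord c t ^ 2) <= j / 6 * coord c t ^ 2.
Proof.
  intros Hc s0.
  pose proof (exp_opp_mul c PI) as Hpq.
  set (P := exp (c * PI)) in *. set (Q := exp (- c * PI)) in *.
  assert (HP : 0 < P) by apply exp_pos. assert (HQ : 0 < Q) by apply exp_pos.
  assert (HPQ : 2 <= P + Q).
  { pose proof (Rle_0_sqr (P - Q)). unfold Rsqr in H. nra. }
  (* [s0] makes the function [Z] below vanish at [PI], and [j] makes its derivative vanish there.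
     Positivity of [j] is what makes the cubic coefficient nonzero. *)
  set (j := c * (P + Q - 1) * (P + Q + 2) / 2).
  assert (Hj : 0 < j).
  { unfold j. repeat apply Rmult_lt_0_compat; lra. }
  exists j. split; [exact Hj|].
  set (Z := fun t => ((exp (c * t) - exp (- c * t)) / slope_num c t + 2 * s0 / coord_den c t)
                     * coord_den c t ^ 2 / 4 - j * sin t).
  assert (Z0 : Z PI = 0).
  { unfold Z. rewrite coord_den_PI, slope_num_PI, sin_PI. fold P Q. unfold s0. field. lra. }
  assert (DZ : is_derive Z PI 0).
  { unfold Z, slope_num, coord_den. auto_derive.
    - fold P Q. rewrite cos_PI, sin_PI. repeat split; lra.
    - fold P Q. rewrite cos_PI, sin_PI. unfold s0, j.
      field_simplify_eq; [|split; lra].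
      transitivity ((P * Q - 1) * (8 * c * P ^ 2 + 8 * c * Q ^ 2 + 32 * c * P + 32 * c * Q
                      + 16 * c * (P * Q + 1) + 16 * c)); [ring | rewrite Hpq; ring]. }
  (* Near [PI], [|Z|] is at most [j / 12] times [|t - PI|], and [|sin t|] is at least half of
     [|t - PI|]. *)
  assert (Small : exists d, 0 < d /\ forall t, Rabs (t - PI) < d ->
             Rabs (Z t) <= j / 6 * Rabs (sin t)).
  { rewrite is_derive_eps in DZ. destruct (DZ (j / 12)) as [d1 [Hd1 A1]]; [lra|].
    assert (DS : is_derive sin PI (-1)).
    { auto_derive; auto. rewrite cos_PI. ring. }
    rewrite is_derive_eps in DS. destruct (DS (1 / 2)) as [d2 [Hd2 A2]]; [lra|].
    exists (Rmin d1 d2). split; [now apply Rmin_glb_lt|]. intros t Ht.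
    pose proof (Rmin_l d1 d2); pose proof (Rmin_r d1 d2).
    destruct (Req_dec t PI) as [->|N].
    { rewrite Z0, sin_PI, Rabs_R0. lra. }
    set (k := t - PI) in *. assert (Hk : k <> 0) by (unfold k; lra).
    specialize (A1 k Hk ltac:(lra)). specialize (A2 k Hk ltac:(lra)).
    unfold dquot in A1, A2. replace (PI + k) with t in * by (unfold k; ring).
    rewrite Z0, !Rminus_0_r in A1. rewrite sin_PI, Rminus_0_r in A2.
    assert (Hk' := Rabs_pos_lt k Hk).
    assert (B1 : Rabs (Z t) <= j / 12 * Rabs k).
    { replace (Z t) with (Z t / k * k) by (field; exact Hk). rewrite Rabs_mult.
      apply Rmult_le_compat_r; lra. }
    assert (B2 : Rabs k / 2 <= Rabs (sin t)).
    { replace (sin t) with (sin t / k * k) by (field; exact Hk). rewrite Rabs_mult.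
      apply Rabs_def2 in A2. rewrite (Rabs_left1 (sin t / k)) by lra. nra. }
    apply Rle_trans with (1 := B1). nra. }
  assert (PosDen : exists d, 0 < d /\ forall t, Rabs (t - PI) < d -> 0 < coord_den c t).
  { apply continuous_pos_near.
    - unfold coord_den. eapply is_derive_continuous. auto_derive; auto.
    - rewrite coord_den_PI. fold P Q. lra. }
  assert (NegJ : exists d, 0 < d /\ forall t, Rabs (t - PI) < d -> slope_num c t < 0).
  { apply continuous_neg_near.
    - unfold slope_num. eapply is_derive_continuous. auto_derive; auto.
    - rewrite slope_num_PI. fold P Q. lra. }
  pose proof PI_RGT_0 as Hpi.
  assert (PosE : forall c', exists d, 0 < d /\ forall t, Rabs (t - PI) < d -> 0 < ret_num c' t).
  { intros c'. apply continuous_pos_near.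
    - unfold ret_num. eapply is_derive_continuous. auto_derive; auto.
    - apply ret_num_pos; lra. }
  destruct (near_min _ _ _ PosDen (near_min _ _ _ NegJ (near_min _ _ _ (PosE c)
             (near_min _ _ _ (PosE (- c)) Small)))) as [d [Hd A]].
  exists d. split; [exact Hd|]. intros t Ht.
  destruct (A t Ht) as [A1 [A2 [A3 [A4 A5]]]]. repeat split; try assumption.
  assert (E : skew_excess c t + s0 * coord c t - j * coord c t ^ 2 = sin t * Z t * (4 / coord_den c t ^ 2)).
  { unfold Z, skew_excess, coord. field. lra. }
  assert (E2 : j / 6 * coord c t ^ 2 = j / 6 * (Rabs (sin t) * Rabs (sin t)) * (4 / coord_den c t ^ 2)).
  { replace (Rabs (sin t) * Rabs (sin t)) with (sin t ^ 2)
      by (rewrite <- Rabs_mult, Rabs_pos_eq; [ring | apply Rle_0_sqr]).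
    unfold coord. field. lra. }
  assert (Hden : 0 < 4 / coord_den c t ^ 2) by (apply Rdiv_lt_0_compat; [lra | apply pow_lt; lra]).
  rewrite E, E2, !Rabs_mult, (Rabs_pos_eq (4 / coord_den c t ^ 2)) by lra.
  apply Rmult_le_compat_r; [lra|]. pose proof (Rabs_pos (sin t)). nra.
Qed.

(** [r] inverts [coord h] around [PI]. The cubic expansion of [skew] along [r] needs no third
    derivative: its derivative is [2 h + (1 + h ^ 2) * skew_excess], whose quadratic expansion is
    known, and the mean value theorem supplies the missing factor [|x|] in the remainder. Hence
    [A = (1 + h ^ 2) s0 / 2] and [B = (1 + h ^ 2) j / 3]. *)
Lemma coord_coordinate h :
  0 < h ->
  exists (tm A B d : R) (r V' : R -> R),
    PI < tm /\ focus_domain h tm /\ 0 < A /\ 0 < B /\ 0 < d /\ r 0 = PI /\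
    (forall s t, PI < s < tm -> PI < t < tm -> coord h s = coord h t -> s = t) /\
    (forall x y, - d < x -> x < y -> y < d -> r y < r x) /\
    forall x, Rabs x < d ->
      0 < r x < tm /\ coord h (r x) = x /\ continuous r x /\
      (0 < x -> forall t, r x <= t <= PI -> coord h t <= x) /\
      is_derive (fun y => skew h (r y)) x (V' x) /\ continuous V' x /\
      Rabs (skew h (r x) - (skew h PI + 2 * h * x - A * x ^ 2 + B * x ^ 3)) <= B / 2 * Rabs x ^ 3.
Proof.
  intros Hh. destruct (skew_excess_expansion h Hh) as [j [Hj [d0 [Hd0 Exp]]]].
  set (s0 := (exp (h * PI) - exp (- h * PI)) / 2) in *.
  pose proof PI_RGT_0 as Hpi.
  assert (Hs0 : 0 < s0).
  { assert (0 < h * PI) by (apply Rmult_lt_0_compat; lra).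
    assert (exp (- h * PI) < exp (h * PI)) by (apply exp_increasing; lra).
    unfold s0. lra. }
  set (e := Rmin d0 PI / 2).
  assert (He : 0 < e /\ e < d0 /\ e < PI).
  { unfold e. pose proof (Rmin_l d0 PI); pose proof (Rmin_r d0 PI).
    assert (0 < Rmin d0 PI) by (apply Rmin_glb_lt; lra). lra. }
  set (a := PI - e). set (tm := PI + e).
  assert (In : forall t, a <= t <= tm -> Rabs (t - PI) < d0).
  { intros t Ht. unfold a, tm in Ht. apply Rabs_def1; lra. }
  assert (Dw : forall t, a <= t <= tm ->
     is_derive (coord h) t (2 * slope_num h t / coord_den h t ^ 2) /\ 2 * slope_num h t / coord_den h t ^ 2 < 0).
  { intros t Ht. destruct (Exp t (In t Ht)) as [E1 [E2 _]]. split; [apply coord_derive; lra|].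
    unfold Rdiv. apply Rmult_neg_pos; [lra|]. apply Rinv_0_lt_compat, pow_lt, E1. }
  assert (Dec := decreasing_on _ _ _ _ Dw).
  assert (w0 : coord h PI = 0) by (unfold coord; rewrite sin_PI; unfold Rdiv; ring).
  assert (Ha : 0 < coord h a) by (rewrite <- w0; apply Dec; unfold a, tm; lra).
  assert (Htm : coord h tm < 0) by (rewrite <- w0; apply Dec; unfold a, tm; lra).
  destruct (inverse_derive (coord h) (fun t => 2 * slope_num h t / coord_den h t ^ 2) a tm)
    as [r Hr]; [unfold a, tm; lra | exact Dw |].
  set (d := Rmin (- coord h tm) (coord h a)).
  assert (Hd : 0 < d) by (apply Rmin_glb_lt; lra).
  assert (Hr' : forall x, Rabs x < d -> a < r x < tm /\ coord h (r x) = x /\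
                is_derive r x (/ (2 * slope_num h (r x) / coord_den h (r x) ^ 2))).
  { intros x Hx. apply Hr. apply Rabs_def2 in Hx.
    pose proof (Rmin_l (- coord h tm) (coord h a)); pose proof (Rmin_r (- coord h tm) (coord h a)).
    fold d in H, H0. lra. }
  assert (Inj : forall s t, a <= s <= tm -> a <= t <= tm -> coord h s = coord h t -> s = t).
  { intros s t Hs Ht E. destruct (Rtotal_order s t) as [L|[|L]]; [|assumption|].
    - assert (coord h t < coord h s) by (apply Dec; lra). lra.
    - assert (coord h s < coord h t) by (apply Dec; lra). lra. }
  set (V' := fun x => 2 * h + (1 + h ^ 2) * skew_excess h (r x)).
  set (A := (1 + h ^ 2) * s0 / 2). set (B := (1 + h ^ 2) * j / 3).
  assert (H1h : 0 < 1 + h ^ 2) by nra.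
  assert (DV : forall x, Rabs x < d -> is_derive (fun y => skew h (r y)) x (V' x)).
  { intros x Hx. destruct (Hr' x Hx) as [Hrx [_ Dr]].
    destruct (Exp (r x) (In (r x) ltac:(lra))) as [E1 [E2 _]].
    evar_last.
    - apply (is_derive_comp (skew h) r x); [apply skew_derive; lra | exact Dr].
    - unfold scal; simpl. unfold mult; simpl. unfold V', skew_deriv, skew_excess. field. split; lra. }
  assert (r0 : r 0 = PI).
  { destruct (Hr' 0) as [Hr0 [E _]]; [rewrite Rabs_R0; exact Hd|].
    apply Inj; [lra | unfold a, tm; lra | congruence]. }
  assert (Foc : focus_domain h tm).
  { split; [unfold tm; lra|]. intros t Ht.
    destruct (Rle_or_lt t PI); [split; apply ret_num_pos; lra|].
    destruct (Exp t (In t ltac:(unfold a; lra))) as [_ [_ [E3 [E4 _]]]]. now split. }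
  assert (HA : 0 < A).
  { unfold A. apply Rdiv_lt_0_compat; [apply Rmult_lt_0_compat; lra | lra]. }
  assert (HB : 0 < B).
  { unfold B. apply Rdiv_lt_0_compat; [apply Rmult_lt_0_compat; lra | lra]. }
  exists tm, A, B, d, r, V'.
  split; [unfold tm; lra|]. split; [exact Foc|]. split; [exact HA|]. split; [exact HB|].
  split; [exact Hd|]. split; [exact r0|]. split; [|split].
  - intros s t Hs Ht. apply Inj; unfold a; lra.
  - intros x y Hx Hxy Hy.
    destruct (Hr' x) as [Hrx [Ex _]]; [apply Rabs_def1; lra|].
    destruct (Hr' y) as [Hry [Ey _]]; [apply Rabs_def1; lra|].
    apply Rnot_le_lt. intros N. destruct (Rle_lt_or_eq_dec _ _ N) as [L|L].
    + assert (coord h (r y) < coord h (r x)) by (apply Dec; lra). lra.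
    + rewrite L in Ex. lra.
  - intros x H. split; [|split; [|split; [|split; [|split; [|split]]]]].
    + destruct (Hr' x H) as [Hrx _]. unfold a in Hrx. lra.
    + apply Hr', H.
    + destruct (Hr' x H) as [_ [_ Dr]]. exact (is_derive_continuous _ _ _ Dr).
    + intros Hx t Ht. destruct (Hr' x H) as [Hrx [Ex _]].
      destruct (Req_dec t (r x)) as [->|]; [lra|].
      assert (coord h t < coord h (r x)) by (apply Dec; unfold tm in *; lra). lra.
    + now apply DV.
    + destruct (Hr' x H) as [Hrx [_ Dr]].
      destruct (Exp (r x) (In (r x) ltac:(lra))) as [E1 [E2 _]].
      assert (CJ : ex_derive (fun t => 2 * h + (1 + h ^ 2) * skew_excess h t) (r x)).
      { unfold skew_excess, slope_num in *. auto_derive. lra. }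
      destruct CJ as [l CJ].
      exact (continuous_comp r (fun t => 2 * h + (1 + h ^ 2) * skew_excess h t) x
               (is_derive_continuous _ _ _ Dr) (is_derive_continuous _ _ _ CJ)).
    + set (K := fun x => skew h (r x) - (skew h PI + 2 * h * x - A * x ^ 2 + B * x ^ 3)).
      set (K' := fun x => (1 + h ^ 2) * (skew_excess h (r x) + s0 * x - j * x ^ 2)).
      assert (DK : forall y, Rabs y < d -> is_derive K y (K' y)).
      { intros y Hy. unfold K, K'. evar_last.
        - apply (is_derive_minus (fun x => skew h (r x))); [now apply DV|].
          instantiate (1 := 2 * h - 2 * A * y + 3 * B * y ^ 2).
          auto_derive; auto. ring.
        - unfold minus, plus, opp; simpl. unfold V', A, B. field. }
      destruct (MVT_gen K 0 x K') as [c [Hc E]].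
      * intros y Hy. apply DK. apply Rabs_def2 in H.
        unfold Rmin, Rmax in Hy. destruct (Rle_dec 0 x); apply Rabs_def1; lra.
      * intros y Hy. apply continuity_pt_filterlim.
        apply (is_derive_continuous K y (K' y)), DK. apply Rabs_def2 in H.
        unfold Rmin, Rmax in Hy. destruct (Rle_dec 0 x); apply Rabs_def1; lra.
      * assert (Hcx : Rabs c <= Rabs x).
        { unfold Rmin, Rmax in Hc. destruct (Rle_dec 0 x).
          - rewrite !Rabs_pos_eq; lra.
          - rewrite !Rabs_left1; lra. }
        assert (K0 : K 0 = 0) by (unfold K; rewrite r0; ring).
        rewrite K0, !Rminus_0_r in E. fold (K x). rewrite E, Rabs_mult.
        destruct (Hr' c ltac:(lra)) as [Hrc [Ec _]].
        destruct (Exp (r c) (In (r c) ltac:(lra))) as [_ [_ [_ [_ Bd]]]]. rewrite Ec in Bd.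
        assert (Kc : Rabs (K' c) <= B / 2 * Rabs x ^ 2).
        { unfold K'. rewrite Rabs_mult, (Rabs_pos_eq (1 + h ^ 2)) by lra.
          apply Rle_trans with ((1 + h ^ 2) * (j / 6 * c ^ 2)).
          - apply Rmult_le_compat_l; [lra | exact Bd].
          - unfold B. rewrite <- (pow2_abs c).
            assert (Rabs c ^ 2 <= Rabs x ^ 2) by (apply pow_incr; split; [apply Rabs_pos | exact Hcx]).
            assert (0 <= (1 + h ^ 2) * j) by (apply Rmult_le_pos; lra). nra. }
        replace (B / 2 * Rabs x ^ 3) with (B / 2 * Rabs x ^ 2 * Rabs x) by ring.
        apply Rmult_le_compat_r; [apply Rabs_pos | exact Kc].
Qed.

Lemma ret_height_coord c t :
  coord_den c t <> 0 -> sin t <> 0 ->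
  ret_height c t = (1 + skew c t) / coord c t /\ ret_height (- c) t = (1 - skew c t) / coord c t.
Proof.
  intros Hd Hs. unfold ret_height, coord, skew, ret_num. rewrite Ropp_involutive.
  unfold coord_den in *. split; field; split; assumption.
Qed.

(** The sum of the two equations contains neither [beta] nor [skew]: it reads
    [1 / coord g T + lam / coord h T' = 0]. Either equation then becomes the second condition. *)
Lemma closing_coord g h lam beta T T' :
  coord_den g T <> 0 -> coord_den h T' <> 0 -> sin T <> 0 -> sin T' <> 0 -> lam <> 0 ->
  closing g h lam beta T T' <->
  coord h T' = - lam * coord g T /\ beta * coord g T + skew g T - skew h T' = 0.
Proof.
  intros Hd Hd' Hs Hs' Hl. unfold closing.
  destruct (ret_height_coord g T Hd Hs) as [-> ->]. destruct (ret_height_coord h T' Hd' Hs') as [-> ->].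
  assert (W : coord g T <> 0).
  { unfold coord, Rdiv. repeat apply Rmult_integral_contrapositive_currified; try lra.
    now apply Rinv_neq_0_compat. }
  assert (W' : coord h T' <> 0).
  { unfold coord, Rdiv. repeat apply Rmult_integral_contrapositive_currified; try lra.
    now apply Rinv_neq_0_compat. }
  set (w := coord g T) in *. set (w' := coord h T') in *.
  set (n := skew g T). set (n' := skew h T'). split.
  - intros [E1 E2].
    assert (K : w' = - lam * w).
    { assert (S : ((1 - n) / w + lam * ((1 - n') / w') + ((1 + n) / w + lam * ((1 + n') / w'))) * (w * w' / 2) = 0)
        by (rewrite E1, E2; ring).
      field_simplify in S; [|split; assumption]. lra. }
    split; [exact K|]. rewrite K in E1. rewrite <- E1. field. split; assumption.
  - intros [E1 E2].
    assert (Eb : beta = (n' - n) / w).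
    { apply Rmult_eq_reg_r with w; [|exact W]. replace ((n' - n) / w * w) with (n' - n) by (field; exact W). lra. }
    rewrite E1, Eb. split; field; split; assumption.
Qed.

(* The successive choices [lam < 1], then [beta] slightly above its critical value,
   make the three lowest order terms dominate one after the other. *)
Lemma sign_pattern (V : R -> R) h A B d eps v0 :
  0 < h -> 0 < A -> 0 < B -> 0 < d -> 0 < eps ->
  (forall x, Rabs x < d ->
     Rabs (V x - (v0 + 2 * h * x - A * x ^ 2 + B * x ^ 3)) <= B / 2 * Rabs x ^ 3) ->
  exists lam beta x1 x2 x3,
    1 - eps < lam < 1 /\ 0 < lam /\ Rabs beta <= 4 * h + 1 /\
    0 < x3 /\ x3 < x2 /\ x2 < x1 /\ x1 < d /\
    0 < beta * x1 + V x1 - V (- lam * x1) /\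
    beta * x2 + V x2 - V (- lam * x2) < 0 /\
    0 < beta * x3 + V x3 - V (- lam * x3).
Proof.
  intros Hh HA HB Hd He Exp.
  set (x1 := d / 2).
  (* At [x1] the cubic term wins: [2 A mu x1 ^ 2] is at most half of [B / 2 * x1 ^ 3]. *)
  set (mu := Rmin (Rmin (eps / 2) (1 / 2)) (B * x1 / (8 * A))).
  assert (Hx1 : 0 < x1) by (unfold x1; lra).
  assert (Hmu : 0 < mu).
  { unfold mu. repeat apply Rmin_glb_lt; try lra. apply Rdiv_lt_0_compat; [apply Rmult_lt_0_compat|]; lra. }
  assert (Hmu1 : mu <= eps / 2) by (unfold mu; eapply Rle_trans; [apply Rmin_l | apply Rmin_l]).
  assert (Hmu2 : mu <= 1 / 2) by (unfold mu; eapply Rle_trans; [apply Rmin_l | apply Rmin_r]).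
  assert (Hmu3 : 8 * A * mu <= B * x1).
  { assert (mu <= B * x1 / (8 * A)) by apply Rmin_r.
    apply Rle_trans with (8 * A * (B * x1 / (8 * A))); [apply Rmult_le_compat_l; lra|].
    right. field. lra. }
  (* At [x2] the quadratic term wins: [3 B x2 ^ 3] is at most half of [A mu x2 ^ 2], and [del] below
     will add at most a quarter. *)
  set (x2 := Rmin (x1 / 2) (A * mu / (6 * B))).
  assert (HAmu : 0 < A * mu) by (apply Rmult_lt_0_compat; lra).
  assert (Hx2 : 0 < x2).
  { unfold x2. apply Rmin_glb_lt; [lra|]. apply Rdiv_lt_0_compat; lra. }
  assert (Hx21 : x2 <= x1 / 2) by apply Rmin_l.
  assert (Hx22 : 6 * B * x2 <= A * mu).
  { assert (x2 <= A * mu / (6 * B)) by apply Rmin_r.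
    apply Rle_trans with (6 * B * (A * mu / (6 * B))); [apply Rmult_le_compat_l; lra|].
    right. field. lra. }
  set (del := Rmin 1 (A * mu * x2 / 4)).
  assert (HAx : 0 < A * mu * x2) by (apply Rmult_lt_0_compat; lra).
  assert (Hdel : 0 < del) by (unfold del; apply Rmin_glb_lt; lra).
  assert (Hdel1 : del <= 1) by apply Rmin_l.
  assert (Hdel2 : del <= A * mu * x2 / 4) by apply Rmin_r.
  (* At [x3] the linear term wins: [2 A mu x3 ^ 2] is half of [del * x3]. *)
  set (x3 := del / (4 * (A * mu))).
  assert (Hx3 : 0 < x3) by (unfold x3; apply Rdiv_lt_0_compat; lra).
  assert (Ex3 : 4 * (A * mu) * x3 = del) by (unfold x3; field; lra).
  assert (Hx32 : x3 < x2) by nra.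
  (* [- 2 h (1 + lam)] cancels the linear term of [V x - V (- lam x)], so [del] is what remains of
     it. *)
  set (lam := 1 - mu). set (beta := - 2 * h * (1 + lam) + del).
  (* The quadratic coefficient is [- A (1 - lam ^ 2)], with [1 - lam ^ 2] between [mu] and [2 mu];
     the cubic one is [B (1 + lam ^ 3)], known up to half its size. *)
  assert (Main : forall x, 0 < x < d ->
     del * x - 2 * A * mu * x ^ 2 + B / 2 * x ^ 3 <= beta * x + V x - V (- lam * x) <=
     del * x - A * mu * x ^ 2 + 3 * B * x ^ 3).
  { intros x Hx.
    assert (Hlx : 0 < lam * x <= x) by (unfold lam; nra).
    assert (E1 := Exp x ltac:(rewrite Rabs_pos_eq; lra)).
    assert (E2 := Exp (- lam * x) ltac:(rewrite Rabs_left1; lra)).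
    rewrite (Rabs_pos_eq x) in E1 by lra.
    replace (Rabs (- lam * x)) with (lam * x) in E2 by (rewrite Rabs_left1; lra).
    apply Rabs_le_between in E1. apply Rabs_le_between in E2.
    assert (Cub : 0 <= lam ^ 3 * x ^ 3 <= x ^ 3).
    { replace (lam ^ 3 * x ^ 3) with ((lam * x) ^ 3) by ring.
      split; [apply pow_le; lra | apply pow_incr; lra]. }
    replace ((lam * x) ^ 3) with (lam ^ 3 * x ^ 3) in E2 by ring.
    replace ((- lam * x) ^ 3) with (- (lam ^ 3 * x ^ 3)) in E2 by ring.
    replace ((- lam * x) ^ 2) with (x ^ 2 - (mu * x ^ 2 + mu * (1 - mu) * x ^ 2)) in E2
      by (unfold lam; ring).
    assert (Hx2' : 0 < x ^ 2) by (apply pow_lt; lra).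
    assert (Q : 0 <= A * (mu * (1 - mu) * x ^ 2) <= A * (mu * x ^ 2)).
    { assert (0 <= mu * (1 - mu) * x ^ 2) by (repeat apply Rmult_le_pos; lra).
      split; [apply Rmult_le_pos; lra|]. apply Rmult_le_compat_l; [lra|].
      apply Rmult_le_compat_r; [lra|]. nra. }
    assert (0 <= B * (lam ^ 3 * x ^ 3)) by (apply Rmult_le_pos; lra).
    assert (B * (lam ^ 3 * x ^ 3) <= B * x ^ 3) by (apply Rmult_le_compat_l; lra).
    unfold beta. replace (- 2 * h * (1 + lam)) with (- 2 * h - 2 * h * lam) by ring.
    split; lra. }
  exists lam, beta, x1, x2, x3.
  assert (Hb : Rabs beta <= 4 * h + 1).
  { unfold beta, lam. apply Rabs_le. split; nra. }
  unfold lam at 1 2 3. repeat split; try lra; try exact Hb; try (unfold x1; lra).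
  - apply Rlt_le_trans with (2 := proj1 (Main x1 ltac:(unfold x1; lra))).
    assert (0 < x1 ^ 2) by (apply pow_lt; lra).
    replace (del * x1 - 2 * A * mu * x1 ^ 2 + B / 2 * x1 ^ 3)
      with (del * x1 + (B * x1 / 2 - 2 * A * mu) * x1 ^ 2) by field.
    assert (0 < del * x1) by (apply Rmult_lt_0_compat; lra).
    assert (0 <= (B * x1 / 2 - 2 * A * mu) * x1 ^ 2) by (apply Rmult_le_pos; lra). lra.
  - apply Rle_lt_trans with (1 := proj2 (Main x2 ltac:(unfold x1 in *; lra))).
    replace (del * x2 - A * mu * x2 ^ 2 + 3 * B * x2 ^ 3)
      with (x2 * (del - A * mu * x2 + (3 * B * x2) * x2)) by ring.
    assert (3 * B * x2 * x2 <= A * mu / 2 * x2) by (apply Rmult_le_compat_r; lra).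
    apply Rmult_pos_neg; lra.
  - apply Rlt_le_trans with (2 := proj1 (Main x3 ltac:(unfold x1 in *; lra))).
    replace (del * x3 - 2 * A * mu * x3 ^ 2 + B / 2 * x3 ^ 3)
      with (x3 * (del - 2 * (A * mu) * x3) + B / 2 * x3 ^ 3) by ring.
    assert (0 < x3 ^ 3) by (apply pow_lt; lra).
    assert (0 < B / 2 * x3 ^ 3) by (apply Rmult_lt_0_compat; lra).
    assert (0 < x3 * (del - 2 * (A * mu) * x3)) by (apply Rmult_lt_0_compat; lra). lra.
Qed.

(** * Three isolated solutions of the closing equations *)

Lemma exp_sum_increasing x y : 0 < x < y -> exp x + exp (- x) < exp y + exp (- y).
Proof.
  intros H.
  assert (E : exp (- x) * exp x = 1) by (rewrite <- exp_plus, Rplus_opp_l; apply exp_0).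
  assert (E' : exp (- y) * exp y = 1) by (rewrite <- exp_plus, Rplus_opp_l; apply exp_0).
  assert (1 < exp x) by (rewrite <- exp_0; apply exp_increasing; lra).
  assert (exp x < exp y) by (apply exp_increasing; lra).
  assert (exp (- x) < 1) by (rewrite <- exp_0; apply exp_increasing; lra).
  set (a := exp x) in *. set (b := exp y) in *.
  set (a' := exp (- x)) in *. set (b' := exp (- y)) in *.
  assert (0 < b') by apply exp_pos.
  assert (K : a' - b' = (b - a) * (a' * b')).
  { transitivity (a' * (b' * b) - b' * (a' * a)); [rewrite E, E' | ]; ring. }
  assert (a' * b' < 1) by nra. nra.
Qed.

Lemma coord_den_pos g t : 0 < t <= PI -> 0 < coord_den g t.
Proof. intros Ht. rewrite coord_den_ret_num. pose proof (ret_num_pos g t Ht). pose proof (ret_num_pos (- g) t Ht). lra. Qed.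

Lemma coord_pos g t : 0 < t < PI -> 0 < coord g t.
Proof.
  intros Ht. unfold coord. apply Rdiv_lt_0_compat; [|apply coord_den_pos; lra].
  pose proof (sin_pos_0_PI t Ht). lra.
Qed.

(** The slope enters only through [exp (c t) + exp (- c t)] in the denominator. The bound keeps
    [lam * coord g t] where the inverse of [coord h] is defined. *)
Lemma coord_decreasing_slope h g t : 0 < h <= g -> 0 < t <= PI -> coord g t <= coord h t.
Proof.
  intros [Hh Hg] Ht. destruct (Rle_lt_or_eq_dec h g Hg) as [Hlt| ->]; [|lra].
  assert (D : coord_den h t < coord_den g t).
  { unfold coord_den. assert (K := exp_sum_increasing (h * t) (g * t) ltac:(split; nra)).
    rewrite <- !Ropp_mult_distr_l. lra. }
  pose proof (coord_den_pos h t Ht). assert (0 <= sin t) by (apply sin_ge_0; lra).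
  unfold coord, Rdiv. apply Rmult_le_compat_l; [lra|]. apply Rinv_le_contravar; lra.
Qed.

(** [skew c PI] is [- tanh (c PI / 2)]. This gives the sign of the constant term
    [skew g PI - skew h PI]. *)
Lemma skew_PI_decreasing h g : 0 < h < g -> skew g PI < skew h PI.
Proof.
  intros H. pose proof PI_RGT_0.
  assert (F : forall c, skew c PI = -1 + 2 / (exp (c * PI) + 1)).
  { intros c. unfold skew. rewrite coord_den_PI, sin_PI. pose proof (exp_opp_mul c PI) as E.
    pose proof (exp_pos (c * PI)). pose proof (exp_pos (- c * PI)).
    set (p := exp (c * PI)) in *. set (q := exp (- c * PI)) in *.
    replace q with (/ p) by (apply Rmult_eq_reg_l with p; [rewrite Rinv_r; lra | lra]).
    field. split; [lra|]. nra. }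
  rewrite !F. assert (exp (h * PI) < exp (g * PI)) by (apply exp_increasing; nra).
  pose proof (exp_pos (h * PI)). apply Rplus_lt_compat_l. unfold Rdiv.
  apply Rmult_lt_compat_l; [lra|]. apply Rinv_lt_contravar; [|lra].
  apply Rmult_lt_0_compat; lra.
Qed.

(** [T] is unique in a window only, but with [T'] anywhere in [(PI, tm)]. The bound [t0] keeps the
    window close to [PI], where heights are large. *)
Definition isolated_closing (g h lam beta tm t0 T : R) : Prop :=
  exists a a2 T', t0 < a /\ 0 < a < T /\ T < a2 < PI /\ PI < T' < tm /\
    closing g h lam beta T T' /\
    forall S S', a < S < a2 -> PI < S' < tm -> closing g h lam beta S S' -> S = T.

Lemma sign_persists (f : R -> R) h :
  continuous f h -> f h <> 0 -> exists d, 0 < d /\ forall g, Rabs (g - h) < d -> 0 < f h * f g.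
Proof.
  intros Hc Hf. apply (continuous_pos_near (fun g => f h * f g) h).
  - apply (continuous_mult (fun _ => f h) f); [apply continuous_const | exact Hc].
  - nra.
Qed.

(** [sign_pattern] treats equal slopes and gives three signs. A slope [g] slightly above [h]
    preserves them and adds a fourth, negative, next to [PI]. Since [F g = (beta - f) * coord g],
    these are crossings of the level [beta] by [f]; monotone pieces with nested ranges of values
    then provide one level [b] crossed on all three. *)
Lemma three_closings h eps t0 :
  0 < h -> 0 < eps -> t0 < PI ->
  exists g lam beta tm, 0 < g /\ Rabs (g - h) < eps /\ 0 < lam /\ Rabs (lam - 1) < eps /\
    Rabs beta <= 4 * h + 2 /\ focus_domain h tm /\
    exists T1 T2 T3, T1 < T2 < T3 /\
      isolated_closing g h lam beta tm t0 T1 /\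
      isolated_closing g h lam beta tm t0 T2 /\
      isolated_closing g h lam beta tm t0 T3.
Proof.
  intros Hh Heps Ht0. pose proof PI_RGT_0 as Hpi.
  destruct (coord_coordinate h Hh) as
    [tm [A [B [d [r [V' [Htm [Foc [HA [HB [Hd [r0 [Inj [Dec Hr]]]]]]]]]]]]]].
  set (V := fun x => skew h (r x)).
  assert (Near : exists d1, 0 < d1 /\ d1 <= d /\ forall x, Rabs x < d1 -> t0 < r x).
  { destruct (Hr 0) as [_ [_ [Cr _]]]; [rewrite Rabs_R0; exact Hd|].
    destruct (continuous_pos_near (fun x => r x - t0) 0) as [d1 [Hd1 N]].
    - apply (continuous_minus r (fun _ => t0)); [exact Cr | apply continuous_const].
    - rewrite r0. lra.
    - exists (Rmin d1 d). split; [now apply Rmin_glb_lt|]. split; [apply Rmin_r|].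
      intros x Hx. pose proof (Rmin_l d1 d). specialize (N x). rewrite Rminus_0_r in N.
      specialize (N ltac:(lra)). lra. }
  destruct Near as [d1 [Hd1 [Hd1d Near]]].
  destruct (sign_pattern V h A B d1 eps (skew h PI)) as
    [lam [beta [x1 [x2 [x3 [Hlam [Hlam0 [Hbeta [Hx3 [Hx32 [Hx21 [Hx1 [S1 [S2 S3]]]]]]]]]]]]]];
    try assumption.
  { intros x Hx. apply (Hr x). lra. }
  set (F := fun g t => beta * coord g t + skew g t - V (- lam * coord g t)).
  assert (CV : forall x, Rabs x < d -> continuous V x).
  { intros x Hx. destruct (Hr x Hx) as [_ [_ [_ [_ [DV _]]]]].
    exact (is_derive_continuous _ _ _ DV). }
  assert (Point : forall x, 0 < x -> x <= x1 -> t0 < r x /\ 0 < r x < PI /\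
      coord h (r x) = x /\ F h (r x) = beta * x + V x - V (- lam * x)).
  { intros x Hx Hxx. assert (Hxd : Rabs x < d) by (rewrite Rabs_pos_eq; lra).
    destruct (Hr x Hxd) as [Hrx [Ex _]]. split; [apply Near; rewrite Rabs_pos_eq; lra|].
    assert (r x < PI) by (rewrite <- r0; apply Dec; lra).
    split; [lra|]. split; [exact Ex|]. unfold F. rewrite Ex. reflexivity. }
  destruct (Point x1) as [P1a [P1b [P1c P1d]]]; [lra | lra |].
  destruct (Point x2) as [P2a [P2b [P2c P2d]]]; [lra | lra |].
  destruct (Point x3) as [P3a [P3b [P3c P3d]]]; [lra | lra |].
  rewrite <- P1d in S1. rewrite <- P2d in S2. rewrite <- P3d in S3.
  set (t1 := r x1) in *. set (t2 := r x2) in *. set (t3 := r x3) in *.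
  assert (t12 : t1 < t2) by (apply Dec; lra).
  assert (t23 : t2 < t3) by (apply Dec; lra).
  assert (Dom : forall g t, h <= g -> t1 <= t <= PI -> Rabs (- lam * coord g t) < d).
  { intros g t Hg Ht.
    assert (coord h t <= x1).
    { apply (Hr x1); [rewrite Rabs_pos_eq; lra | lra | exact Ht]. }
    assert (coord g t <= coord h t) by (apply coord_decreasing_slope; lra).
    assert (0 <= coord g t).
    { destruct (Req_dec t PI) as [->|]; [unfold coord; rewrite sin_PI; lra|].
      left; apply coord_pos; lra. }
    rewrite Rabs_left1 by nra. nra. }
  assert (Cg : forall t, t1 <= t < PI -> continuous (fun g => F g t) h).
  { intros t Ht. pose proof (coord_den_pos h t ltac:(lra)) as Dn.
    assert (Cw : continuous (fun g => coord g t) h).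
    { eapply is_derive_continuous. unfold coord, coord_den in *. auto_derive; [lra | reflexivity]. }
    assert (Cn : continuous (fun g => skew g t) h).
    { eapply is_derive_continuous. unfold skew, coord_den in *. auto_derive; [lra | reflexivity]. }
    apply (continuous_minus (fun g => beta * coord g t + skew g t) (fun g => V (- lam * coord g t))).
    - apply (continuous_plus (fun g => beta * coord g t) (fun g => skew g t)); [|exact Cn].
      apply (continuous_mult (fun _ => beta) (fun g => coord g t)); [apply continuous_const | exact Cw].
    - apply (continuous_comp (fun g => - lam * coord g t) V).
      + apply (continuous_mult (fun _ => - lam) (fun g => coord g t)); [apply continuous_const | exact Cw].
      + apply CV, Dom; lra. }
  destruct (near_min h _ _ (sign_persists _ h (Cg t1 ltac:(lra)) ltac:(lra))
     (near_min h _ _ (sign_persists _ h (Cg t2 ltac:(lra)) ltac:(lra))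
        (sign_persists _ h (Cg t3 ltac:(lra)) ltac:(lra)))) as [dg [Hdg Pers]].
  set (g := h + Rmin (dg / 2) (eps / 2)).
  assert (Hg : h < g /\ g - h <= dg / 2 /\ g - h <= eps / 2).
  { unfold g. pose proof (Rmin_l (dg / 2) (eps / 2)); pose proof (Rmin_r (dg / 2) (eps / 2)).
    assert (0 < Rmin (dg / 2) (eps / 2)) by (apply Rmin_glb_lt; lra). lra. }
  clearbody g.
  destruct (Pers g) as [Q1 [Q2 Q3]]; [rewrite Rabs_pos_eq; lra|].
  assert (R1 : 0 < F g t1) by nra.
  assert (R2 : F g t2 < 0) by nra.
  assert (R3 : 0 < F g t3) by nra.
  clear Q1 Q2 Q3 Pers S1 S2 S3 P1d P2d P3d.
  assert (Dn : forall t, t1 <= t <= PI -> 0 < coord_den g t) by (intros t Ht; apply coord_den_pos; lra).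
  assert (Dw : forall t, t1 <= t <= PI -> is_derive (coord g) t (2 * slope_num g t / coord_den g t ^ 2)).
  { intros t Ht. apply coord_derive. specialize (Dn t Ht). lra. }
  assert (Dnn : forall t, t1 <= t <= PI -> is_derive (skew g) t (skew_deriv g t)).
  { intros t Ht. apply skew_derive. specialize (Dn t Ht). lra. }
  assert (DVw : forall t, t1 <= t <= PI -> is_derive (fun t => V (- lam * coord g t)) t
      (V' (- lam * coord g t) * (- lam * (2 * slope_num g t / coord_den g t ^ 2)))).
  { intros t Ht. destruct (Hr (- lam * coord g t)) as [_ [_ [_ [_ [DV _]]]]]; [apply Dom; lra|].
    evar_last.
    - apply (is_derive_comp V (fun t => - lam * coord g t)); [exact DV|].
      apply (is_derive_scal (coord g) t (- lam)), Dw, Ht.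
    - unfold scal; simpl. unfold mult; simpl. ring. }
  assert (Ct : forall t, t1 <= t <= PI -> continuous (F g) t).
  { intros t Ht.
    apply (continuous_minus (fun t => beta * coord g t + skew g t) (fun t => V (- lam * coord g t))).
    - apply (continuous_plus (fun t => beta * coord g t) (skew g));
        [|exact (is_derive_continuous _ _ _ (Dnn t Ht))].
      apply (continuous_mult (fun _ => beta) (coord g)); [apply continuous_const|].
      exact (is_derive_continuous _ _ _ (Dw t Ht)).
    - exact (is_derive_continuous _ _ _ (DVw t Ht)). }
  (* At [PI] the coordinate vanishes and only the constant term is left. *)
  assert (FPI : F g PI < 0).
  { unfold F, V. unfold coord at 1 2. rewrite sin_PI.
    replace (- lam * (2 * 0 / coord_den g PI)) with 0 by (unfold Rdiv; ring).
    rewrite r0. pose proof (skew_PI_decreasing h g ltac:(lra)). unfold Rdiv. lra. }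
  assert (E4 : exists t4, t3 < t4 < PI /\ F g t4 < 0).
  { destruct (continuous_neg_near (F g) PI (Ct PI ltac:(lra)) FPI) as [d4 [Hd4 N4]].
    exists (Rmax (PI - d4 / 2) ((t3 + PI) / 2)).
    pose proof (Rmax_l (PI - d4 / 2) ((t3 + PI) / 2)).
    pose proof (Rmax_r (PI - d4 / 2) ((t3 + PI) / 2)).
    assert (Rmax (PI - d4 / 2) ((t3 + PI) / 2) < PI) by (apply Rmax_lub_lt; lra).
    split; [lra|]. apply N4. rewrite Rabs_left1; lra. }
  destruct E4 as [t4 [t34 R4]].
  set (f := fun t => (V (- lam * coord g t) - skew g t) / coord g t).
  set (f' := fun t =>
    ((V' (- lam * coord g t) * (- lam * (2 * slope_num g t / coord_den g t ^ 2)) - skew_deriv g t) * coord g t -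
     (V (- lam * coord g t) - skew g t) * (2 * slope_num g t / coord_den g t ^ 2)) / coord g t ^ 2).
  assert (Wp : forall t, t1 <= t <= t4 -> 0 < coord g t) by (intros t Ht; apply coord_pos; lra).
  assert (Ff : forall t, t1 <= t <= t4 -> F g t = (beta - f t) * coord g t).
  { intros t Ht. unfold F, f. specialize (Wp t Ht). field. lra. }
  assert (Df : forall t, t1 <= t <= t4 -> is_derive f t (f' t) /\ continuous f' t).
  { intros t Ht. assert (Ht' : t1 <= t <= PI) by lra. split.
    - apply (is_derive_div (fun t => V (- lam * coord g t) - skew g t) (coord g)).
      + apply (is_derive_minus (fun t => V (- lam * coord g t)) (skew g)); auto.
      + auto.
      + specialize (Wp t Ht). lra.
    - assert (CJ : ex_derive (fun t => 2 * slope_num g t / coord_den g t ^ 2) t /\ ex_derive (skew_deriv g) t).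
      { specialize (Dn t Ht'). split.
        - unfold slope_num, coord_den in *. auto_derive. apply Rgt_not_eq.
          repeat apply Rmult_lt_0_compat; lra.
        - unfold skew_deriv, slope_num, coord_den in *. auto_derive. apply Rgt_not_eq.
          repeat apply Rmult_lt_0_compat; lra. }
      destruct CJ as [[l1 D1] [l2 D2]].
      assert (Cw := is_derive_continuous _ _ _ (Dw t Ht')).
      assert (Cn := is_derive_continuous _ _ _ (Dnn t Ht')).
      assert (Cv := is_derive_continuous _ _ _ (DVw t Ht')).
      assert (Cw' := is_derive_continuous _ _ _ D1).
      assert (Cn' := is_derive_continuous _ _ _ D2).
      assert (Cv' : continuous (fun t => V' (- lam * coord g t)) t).
      { apply (continuous_comp (fun t => - lam * coord g t) V').
        - apply (continuous_mult (fun _ => - lam) (coord g)); [apply continuous_const | exact Cw].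
        - apply (Hr (- lam * coord g t)), Dom; lra. }
      apply continuity_pt_filterlim in Cw. apply continuity_pt_filterlim in Cn.
      apply continuity_pt_filterlim in Cv. apply continuity_pt_filterlim in Cw'.
      apply continuity_pt_filterlim in Cn'. apply continuity_pt_filterlim in Cv'.
      apply continuity_pt_filterlim.
      apply (continuity_pt_div
        (fun t => (V' (- lam * coord g t) * (- lam * (2 * slope_num g t / coord_den g t ^ 2)) - skew_deriv g t) * coord g t -
                  (V (- lam * coord g t) - skew g t) * (2 * slope_num g t / coord_den g t ^ 2))
        (fun t => coord g t ^ 2)).
      + apply (continuity_pt_minus
          (fun t => (V' (- lam * coord g t) * (- lam * (2 * slope_num g t / coord_den g t ^ 2)) - skew_deriv g t) * coord g t)
          (fun t => (V (- lam * coord g t) - skew g t) * (2 * slope_num g t / coord_den g t ^ 2))).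
        * apply (continuity_pt_mult
            (fun t => V' (- lam * coord g t) * (- lam * (2 * slope_num g t / coord_den g t ^ 2)) - skew_deriv g t) (coord g));
            [|exact Cw].
          apply (continuity_pt_minus
            (fun t => V' (- lam * coord g t) * (- lam * (2 * slope_num g t / coord_den g t ^ 2))) (skew_deriv g));
            [|exact Cn'].
          apply (continuity_pt_mult (fun t => V' (- lam * coord g t))
                   (fun t => - lam * (2 * slope_num g t / coord_den g t ^ 2))); [exact Cv'|].
          now apply (continuity_pt_scal (fun t => 2 * slope_num g t / coord_den g t ^ 2)).
        * apply (continuity_pt_mult (fun t => V (- lam * coord g t) - skew g t)
                   (fun t => 2 * slope_num g t / coord_den g t ^ 2)); [|exact Cw'].
          now apply (continuity_pt_minus (fun t => V (- lam * coord g t)) (skew g)).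
      + apply (continuity_pt_mult (coord g) (fun t => coord g t * 1)); [exact Cw|].
        apply (continuity_pt_mult (coord g) (fun _ => 1)); [exact Cw|].
        apply continuity_pt_const. intros u v. reflexivity.
      + apply pow_nonzero. specialize (Wp t Ht). lra. }
  rewrite Ff in R1, R2, R3, R4 by lra.
  assert (G1 : f t1 < beta) by (specialize (Wp t1 ltac:(lra)); nra).
  assert (G2 : beta < f t2) by (specialize (Wp t2 ltac:(lra)); nra).
  assert (G3 : f t3 < beta) by (specialize (Wp t3 ltac:(lra)); nra).
  assert (G4 : beta < f t4) by (specialize (Wp t4 ltac:(lra)); nra).
  (* Cutting at distance 1 from [beta] keeps the final level below [4 h + 2] in absolute value. *)
  set (u0 := Rmax (Rmax (f t1) (f t3)) (beta - 1)).
  set (v0 := Rmin (Rmin (f t2) (f t4)) (beta + 1)).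
  assert (Hu0 : u0 < beta /\ f t1 <= u0 /\ f t3 <= u0 /\ beta - 1 <= u0).
  { unfold u0. split; [repeat apply Rmax_lub_lt; lra|].
    split; [eapply Rle_trans; [apply Rmax_l | apply Rmax_l]|].
    split; [eapply Rle_trans; [apply Rmax_r | apply Rmax_l]|]. apply Rmax_r. }
  assert (Hv0 : beta < v0 /\ v0 <= f t2 /\ v0 <= f t4 /\ v0 <= beta + 1).
  { unfold v0. split; [repeat apply Rmin_glb_lt; lra|].
    split; [eapply Rle_trans; [apply Rmin_l | apply Rmin_l]|].
    split; [eapply Rle_trans; [apply Rmin_l | apply Rmin_r]|]. apply Rmin_r. }
  destruct (increasing_crossing f f' t1 t2 u0 v0) as [p1 [q1 [B1 [B2 [B3 [B4 [B5 M1]]]]]]];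
    try lra; [intros t Ht; apply Df; lra|].
  assert (f p1 < f q1) by (apply M1; lra).
  (* Each new piece is sought between the end values of the previous one, so any value taken on the
     last piece is taken on all three. *)
  destruct (increasing_crossing (fun t => - f t) (fun t => - f' t) t2 t3 (- f q1) (- f p1))
    as [p2 [q2 [C1 [C2 [C3 [C4 [C5 M2]]]]]]]; try lra.
  { intros t Ht. destruct (Df t ltac:(lra)) as [E1 E2]. split.
    - now apply (is_derive_opp f).
    - now apply (continuous_opp f'). }
  assert (- f p2 < - f q2) by (apply M2; lra).
  destruct (increasing_crossing f f' t3 t4 (f q2) (f p2)) as [p3 [q3 [D1 [D2 [D3 [D4 [D5 M3]]]]]]];
    try lra; [intros t Ht; apply Df; lra|].
  assert (f p3 < f q3) by (apply M3; lra).
  set (b := (f p3 + f q3) / 2).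
  assert (Hb : f p1 < b < f q1 /\ f q2 < b < f p2 /\ f p3 < b < f q3) by (unfold b; lra).
  assert (Rt : forall p q s, s = 1 \/ s = -1 -> t1 <= p -> p < q -> q <= t4 ->
     s * f p < s * b < s * f q ->
     (forall x y, p <= x -> x < y -> y <= q -> s * f x < s * f y) ->
     exists T, p < T < q /\ isolated_closing g h lam b tm t0 T).
  { intros p q s Hs Hp Hpq Hq Hsb Mono.
    destruct (IVT_interv (fun t => s * f t - s * b) p q) as [T [HT ET]]; try lra.
    { intros t Ht. apply continuity_pt_filterlim.
      apply (continuous_minus (fun t => s * f t) (fun _ => s * b)); [|apply continuous_const].
      apply (continuous_mult (fun _ => s) f); [apply continuous_const|].
      destruct (Df t ltac:(lra)) as [E _]. exact (is_derive_continuous _ _ _ E). }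
    assert (HT' : p < T < q).
    { split; apply Rnot_le_lt; intros N.
      - replace T with p in ET by lra. lra.
      - replace T with q in ET by lra. lra. }
    assert (fT : f T = b) by (destruct Hs as [-> | ->]; lra).
    exists T. split; [exact HT'|].
    pose proof (Wp T ltac:(lra)) as WT.
    destruct (Hr (- lam * coord g T)) as [Hr1 [Hr2 _]]; [apply Dom; lra|].
    assert (Hr3 : PI < r (- lam * coord g T)).
    { assert (K := Dom g T ltac:(lra) ltac:(lra)). apply Rabs_def2 in K.
      pose proof (Rmult_lt_0_compat _ _ Hlam0 WT). rewrite <- r0. apply Dec; lra. }
    exists p, q, (r (- lam * coord g T)).
    destruct Foc as [Ftm Fee].
    assert (Denh : forall S', PI < S' < tm -> coord_den h S' <> 0 /\ sin S' <> 0).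
    { intros S' HS'. split.
      - rewrite coord_den_ret_num. destruct (Fee S' ltac:(lra)). lra.
      - apply Rlt_not_eq, sin_neg_PI_2PI; lra. }
    assert (Deng : forall S, p <= S <= q -> coord_den g S <> 0 /\ sin S <> 0).
    { intros S HS. split.
      - specialize (Dn S ltac:(lra)). lra.
      - apply Rgt_not_eq, sin_pos_0_PI; lra. }
    split; [lra|]. split; [lra|]. split; [lra|]. split; [lra|]. split.
    - destruct (Denh (r (- lam * coord g T))) as [K1 K2]; [lra|].
      destruct (Deng T) as [K3 K4]; [lra|].
      apply closing_coord; try assumption; [lra|]. split; [exact Hr2|].
      change (b * coord g T + skew g T - V (- lam * coord g T) = 0).
      rewrite <- fT. unfold f. field. lra.
    - intros S S' HS HS' Hcl.
      destruct (Denh S' HS') as [K1 K2]. destruct (Deng S) as [K3 K4]; [lra|].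
      apply closing_coord in Hcl; try assumption; [|lra]. destruct Hcl as [L1 L2].
      pose proof (Wp S ltac:(lra)) as WS.
      destruct (Hr (- lam * coord g S)) as [Hs1 [Hs2 _]]; [apply Dom; lra|].
      assert (Hs3 : PI < r (- lam * coord g S)).
      { assert (K := Dom g S ltac:(lra) ltac:(lra)). apply Rabs_def2 in K.
        pose proof (Rmult_lt_0_compat _ _ Hlam0 WS). rewrite <- r0. apply Dec; lra. }
      (* Injectivity of [coord h] determines [S'] from [S], leaving the single equation
         [f S = b]. *)
      assert (S' = r (- lam * coord g S)) as -> by (apply Inj; lra).
      assert (fS : f S = b).
      { unfold f, V. apply Rmult_eq_reg_r with (coord g S); [|lra].
        unfold Rdiv. rewrite Rmult_assoc, Rinv_l by lra. lra. }
      destruct (Rtotal_order S T) as [L|[L|L]]; [|exact L|].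
      + assert (s * f S < s * f T) by (apply Mono; lra). rewrite fS, fT in *. lra.
      + assert (s * f T < s * f S) by (apply Mono; lra). rewrite fS, fT in *. lra. }
  destruct (Rt p1 q1 1) as [T1 [HT1 I1]]; [now left | lra | lra | lra | lra | |].
  { intros x y Hx Hxy Hy. specialize (M1 x y Hx Hxy Hy). lra. }
  destruct (Rt p2 q2 (-1)) as [T2 [HT2 I2]]; [now right | lra | lra | lra | lra | |].
  { intros x y Hx Hxy Hy. specialize (M2 x y Hx Hxy Hy). lra. }
  destruct (Rt p3 q3 1) as [T3 [HT3 I3]]; [now left | lra | lra | lra | lra | |].
  { intros x y Hx Hxy Hy. specialize (M3 x y Hx Hxy Hy). lra. }
  exists g, lam, b, tm. split; [lra|]. split; [rewrite Rabs_pos_eq; lra|].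
  split; [exact Hlam0|]. split; [rewrite Rabs_left1; lra|].
  split; [apply Rabs_le_between in Hbeta; apply Rabs_le; lra|].
  split; [exact Foc|]. exists T1, T2, T3. split; [lra|]. now split; [|split].
Qed.

(** * Slopes of either sign, large heights, and the bound on the cyclicity *)

(** Time reversal combined with [y -> - y] changes the signs of both slopes and of [b]; it exchanges
    the two closing equations. *)
Lemma isolated_closing_opp g h lam beta tm t0 T :
  isolated_closing g h lam beta tm t0 T ->
  isolated_closing (- g) (- h) lam (- beta) tm t0 T.
Proof.
  assert (Sym : forall S S', closing (- g) (- h) lam (- beta) S S' <-> closing g h lam beta S S').
  { intros S S'. unfold closing. rewrite !Ropp_involutive. tauto. }
  intros [a [a2 [T' [H1 [H2 [H3 [H4 [H5 H6]]]]]]]]. exists a, a2, T'.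
  split; [exact H1|]. split; [exact H2|]. split; [exact H3|]. split; [exact H4|].
  split; [now apply Sym|]. intros S S' HS HS' Hcl. apply (H6 S S' HS HS'), Sym, Hcl.
Qed.

Lemma three_closings_signed eta eps t0 :
  eta <> 0 -> 0 < eps -> t0 < PI ->
  exists g lam beta tm, g <> 0 /\ Rabs (g - eta) < eps /\ 0 < lam /\ Rabs (lam - 1) < eps /\
    Rabs beta <= 4 * Rabs eta + 2 /\ focus_domain eta tm /\
    exists T1 T2 T3, T1 < T2 < T3 /\
      isolated_closing g eta lam beta tm t0 T1 /\
      isolated_closing g eta lam beta tm t0 T2 /\
      isolated_closing g eta lam beta tm t0 T3.
Proof.
  intros Heta Heps Ht0.
  destruct (three_closings (Rabs eta) eps t0 (Rabs_pos_lt _ Heta) Heps Ht0)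
    as [g [lam [beta [tm [Hg [Hge [Hl [Hle [Hb [Foc [T1 [T2 [T3 [HT [I1 [I2 I3]]]]]]]]]]]]]]]].
  destruct (Rle_or_lt 0 eta) as [Hp|Hn].
  - rewrite (Rabs_pos_eq eta) in * by lra. exists g, lam, beta, tm.
    repeat (split; [first [assumption | lra]|]). exists T1, T2, T3. tauto.
  - rewrite (Rabs_left eta) in * by lra. exists (- g), lam, (- beta), tm.
    split; [lra|]. split; [replace (- g - eta) with (- (g - - eta)) by ring; now rewrite Rabs_Ropp|].
    split; [exact Hl|]. split; [exact Hle|]. split; [now rewrite Rabs_Ropp|].
    split; [rewrite <- (Ropp_involutive eta); now apply focus_domain_opp|].
    exists T1, T2, T3. split; [exact HT|]. rewrite <- (Ropp_involutive eta).
    split; [|split]; now apply isolated_closing_opp.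
Qed.

(** Uniform in [c], because [t0] is fixed before the slope [g]: near [PI] the numerator stays above
    1/2 for every [c] while [sin] tends to 0. *)
Lemma ret_height_large K :
  0 < K -> exists t0, t0 < PI /\ forall c t, t0 < t < PI -> K < ret_height c t.
Proof.
  intros HK. pose proof PI2_3_2 as Hpi. unfold PI2 in Hpi.
  (* Distance 1 is less than [PI / 3], which gives [- cos t >= 1 / 2]; the other bound gives
     [K * sin t < 1 / 2]. *)
  exists (PI - Rmin 1 (/ (2 * K))).
  assert (HiK : 0 < / (2 * K)) by (apply Rinv_0_lt_compat; lra).
  pose proof (Rmin_l 1 (/ (2 * K))); pose proof (Rmin_r 1 (/ (2 * K))).
  assert (0 < Rmin 1 (/ (2 * K))) by (apply Rmin_glb_lt; lra).
  split; [lra|]. intros c t Ht. set (x := PI - t). assert (Hx : 0 < x < 1 /\ x < / (2 * K))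
    by (unfold x; lra).
  assert (Hc : 1 / 2 <= - cos t).
  { replace (- cos t) with (cos x).
    - rewrite <- cos_PI3. apply cos_decr_1; lra.
    - unfold x. rewrite Rtrigo_facts.cos_pi_minus. reflexivity. }
  assert (Hs : 0 < sin t <= x).
  { split; [apply sin_pos_0_PI; lra|].
    replace (sin t) with (sin x) by (unfold x; apply Rtrigo_facts.sin_pi_minus).
    left. apply sin_lt_x. lra. }
  assert (Hst : sin t < t) by (apply sin_lt_x; lra).
  assert (He : 1 / 2 <= ret_num c t).
  { unfold ret_num. pose proof (exp_pos (- c * t)). destruct (Rle_or_lt 0 c) as [Hc0|Hc0].
    - assert (0 <= c * sin t) by (apply Rmult_le_pos; lra). lra.
    - pose proof (exp_ineq1_le (- c * t)).
      assert (0 <= - c * (t - sin t)) by (apply Rmult_le_pos; lra). lra. }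
  unfold ret_height. apply (Rlt_div_r K); [lra|].
  assert (K * sin t < K * / (2 * K)) by (apply Rmult_lt_compat_l; lra).
  replace (K * / (2 * K)) with (1 / 2) in H2 by (field; lra). lra.
Qed.

(** The neighbourhood fixes the scale [kap], then [M / kap] fixes [t0], and only then are slope,
    ratio and [beta] chosen. Heights exceed [M] despite the small [kap] because flight times close
    to [PI] make [ret_height] large. *)
Lemma three_big_limit_cycles eta :
  eta <> 0 -> bifurcate_from_infinity (- eta, eta, 0, 0, 0) 3.
Proof.
  intros Heta U [[eps Heps] HU] M HM.
  assert (Habs := Rabs_pos_lt _ Heta). set (h := Rabs eta) in *.
  (* Small enough for [|b| <= (2 h + 1) kap] and [lam * kap < 2 kap] to stay below [eps]. *)
  set (kap := eps / (4 * h + 4)).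
  assert (Hkap : 0 < kap) by (apply Rdiv_lt_0_compat; lra).
  assert (Ekap : kap * (4 * h + 4) = eps) by (unfold kap; field; lra).
  (* The summand [2 h + 1] compensates for the [- b] in the height. *)
  destruct (ret_height_large (M / kap + (2 * h + 1))) as [t0 [Ht0 Big]].
  { assert (0 < M / kap) by (apply Rdiv_lt_0_compat; lra). lra. }
  destruct (three_closings_signed eta (Rmin eps 1) t0 Heta) as
    [g [lam [beta [tm [Hg [Hge [Hl [Hle [Hb [Foc [T1 [T2 [T3 [HT [I1 [I2 I3]]]]]]]]]]]]]]]];
    [apply Rmin_glb_lt; lra | exact Ht0 |].
  pose proof (Rmin_l eps 1); pose proof (Rmin_r eps 1).
  set (b := beta * kap / 2). set (m := (- g, eta, b, kap, lam * kap)).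
  fold h in Hb.
  assert (Hbk : Rabs b <= (2 * h + 1) * kap).
  { unfold b, Rdiv. rewrite !Rabs_mult, (Rabs_pos_eq kap), (Rabs_pos_eq (/ 2)) by lra. nra. }
  set (y := fun T => kap * ret_height (- g) T - b).
  assert (Cyc : forall T, isolated_closing g eta lam beta tm t0 T ->
     t0 < T /\ 0 < T < PI /\ M < y T /\
     exists C, limit_cycle m C /\ C (0, y T) /\
       forall p, C p -> fst p = 0 -> snd p <= 0 \/ p = (0, y T)).
  { intros T [a [a2 [T' [G1 [G2 [G3 [G4 [G5 G6]]]]]]]].
    assert (HTb : t0 < T < PI) by lra.
    split; [lra|]. split; [lra|]. split.
    - pose proof (Big (- g) T HTb) as K.
      assert (K2 : kap * (M / kap + (2 * h + 1)) < kap * ret_height (- g) T)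
        by (apply Rmult_lt_compat_l; assumption).
      replace (kap * (M / kap + (2 * h + 1))) with (M + (2 * h + 1) * kap) in K2
        by (field; lra).
      pose proof (Rle_abs b). unfold y. lra.
    - apply (closing_limit_cycle g eta lam beta kap a T a2 T' tm); assumption. }
  destruct (Cyc T1 I1) as [A1 [B1 [M1 [C1 [L1 [P1 O1]]]]]].
  destruct (Cyc T2 I2) as [A2 [B2 [M2 [C2 [L2 [P2 O2]]]]]].
  destruct (Cyc T3 I3) as [A3 [B3 [M3 [C3 [L3 [P3 O3]]]]]].
  assert (Y12 : y T1 < y T2).
  { unfold y. pose proof (ret_height_increasing_left (- g) T1 T2 ltac:(lra) ltac:(lra) ltac:(lra)). nra. }
  assert (Y23 : y T2 < y T3).
  { unfold y. pose proof (ret_height_increasing_left (- g) T2 T3 ltac:(lra) ltac:(lra) ltac:(lra)). nra. }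
  exists m. split.
  - apply HU. unfold m.
    assert (Hlk : lam * kap < 2 * kap) by (apply Rabs_def2 in Hle; apply Rmult_lt_compat_r; lra).
    assert (0 < lam * kap) by (apply Rmult_lt_0_compat; lra).
    assert (0 < kap * h) by (apply Rmult_lt_0_compat; lra).
    split; [split; [split; [split|]|]|].
    + change (Rabs (- g - - eta) < eps). replace (- g - - eta) with (- (g - eta)) by ring.
      rewrite Rabs_Ropp. lra.
    + change (Rabs (eta - eta) < eps). rewrite Rminus_diag, Rabs_R0. exact Heps.
    + change (Rabs (b - 0) < eps). rewrite Rminus_0_r. lra.
    + change (Rabs (kap - 0) < eps). rewrite Rminus_0_r, Rabs_pos_eq; lra.
    + change (Rabs (lam * kap - 0) < eps). rewrite Rminus_0_r, Rabs_pos_eq; lra.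
  - set (C := fun i => match i with O => C1 | S O => C2 | _ => C3 end).
    set (Y := fun i => match i with O => y T1 | S O => y T2 | _ => y T3 end).
    assert (HC : forall i, limit_cycle m (C i) /\ M < Y i /\ C i (0, Y i) /\
       forall p, C i p -> fst p = 0 -> snd p <= 0 \/ p = (0, Y i)).
    { intros [|[|i]]; unfold C, Y; tauto. }
    exists C. split.
    + intros i _. destruct (HC i) as [K1 [K2 [K3 _]]]. split; [exact K1|].
      exists (Y i). split; [lra | now split].
    + intros i j Hi Hj Hij E. destruct (HC i) as [_ [K2 [K3 _]]].
      destruct (HC j) as [_ [_ [_ K4]]].
      (* Equal orbits would share their only crossing at positive height, whereas the three heights
         are distinct. *)
      destruct (K4 (0, Y i)) as [K5|K5]; [now apply E | reflexivity | simpl in K5; lra |].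
      injection K5 as K5. apply Hij.
      destruct i as [|[|[|i]]], j as [|[|[|j]]]; try lia; unfold Y in K5; lra.
Qed.

Theorem proposition12 (eta : R) (heta : eta <> 0) :
  center_at_infinity (- eta, eta, 0, 0, 0) /\
  Rbar_le (Finite 3) (local_cyclicity_at_infinity (- eta, eta, 0, 0, 0)).
Proof.
  split; [apply center|]. unfold local_cyclicity_at_infinity.
  match goal with |- Rbar_le _ (Lub_Rbar ?E) => destruct (Lub_Rbar_correct E) as [Ub _] end.
  apply Ub. exists 3%nat. split; [simpl; ring | now apply three_big_limit_cycles].
Qed.
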